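(* Let $(M^7,g_0,\eta_0,\Upsilon_0)$ be a contact Calabi--Yau 7-manifold with $\mathcal{D}_0=\ker\eta_0$ and $\omega_0=\mathrm{d}\eta_0$, let $\epsilon>0$, and let $\varphi_0=\epsilon\,\eta_0\wedge\omega_0+\operatorname{Re}\Upsilon_0$, a coclosed $\mathrm{G}_2$-structure with dual 4-form $\psi_0=\frac12\omega_0^2-\epsilon\,\eta_0\wedge\operatorname{Im}\Upsilon_0$. Put $p(t)=(1+10\epsilon^2t)^{1/10}$ for $t\in(-\frac{1}{10\epsilon^2},\infty)$. Then the following family of coclosed $\mathrm{G}_2$-structures $\varphi_t$ on $M$, with associated dual 4-form $\psi_t$, metric $g_t$ and volume form $\mathrm{vol}_t$ given by \begin{align*} \varphi_t&=\epsilon\,p(t)^{-1}\eta_0\wedge\omega_0+p(t)^3\operatorname{Re}\Upsilon_0,\\ \psi_t&=\tfrac12p(t)^4\omega_0^2-\epsilon\,\eta_0\wedge\operatorname{Im}\Upsilon_0,\\ g_t&=\epsilon^2p(t)^{-6}\eta_0^2+p(t)^2g_{\mathcal{D}_0},\\ \mathrm{vol}_t&=\epsilon\,p(t)^3\eta_0\wedge\mathrm{vol}_{\mathcal{D}_0}, \end{align*} for $t\in(-\frac{1}{10\epsilon^2},\infty)$, solves the Laplacian coflow $\frac{\partial\psi_t}{\partial t}=\Delta_{\psi_t}\psi_t$ with initial data (at $t=0$) determined by $\varphi_0$. Hence the solution of the Laplacian coflow is immortal (it exists for all positive times), with a finite time singularity (backwards in time) at $t=-\frac{1}{10\epsilo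n^2}$.
   Context: Contact Calabi--Yau (cCY) 7-manifold $(M^7,g_0,\eta_0,\Upsilon_0)$: $(M^7,g_0)$ is a Sasakian 7-manifold with contact form $\eta_0$; $\mathcal{D}_0=\ker\eta_0$ is the horizontal distribution with transverse complex structure $J$; $g_0=\eta_0^2+g_{\mathcal{D}_0}$ with $\eta_0^2=\eta_0\otimes\eta_0$ and $g_{\mathcal{D}_0}$ the transverse metric; the normalisation is that $\omega_0=\mathrm{d}\eta_0$ is the transverse K\''ahler form, $\omega_0=g_{\mathcal{D}_0}(J\cdot,\cdot)$; and $\Upsilon_0$ is a nowhere vanishing transverse $(3,0)$-form on $\mathcal{D}_0$ with $\mathrm{d}\Upsilon_0=0$ and $\frac{\omega_0^3}{3!}=\frac{i}{8}\Upsilon_0\wedge\overline{\Upsilon}_0$. Write $\mathrm{vol}_{\mathcal{D}_0}=\frac{1}{3!}\omega_0^3$. (The symbol $g_0$ denotes the given Sasakian metric; the flow metric at $t=0$ is $\epsilon^2\eta_0^2+g_{\mathcal{D}_0}$.) $\mathrm{G}_2$-structures: a $\mathrm{G}_2$-structure on $M^7$ is a 3-form $\varphi$ pointwise isomorphic to $e^{123}+e^{145}+e^{167}+e^{246}-e^{257}-e^{347}-e^{356}$ on $\mathbb{R}^7$. It determines a metric $g_\varphi$ and volume form $\mathrm{vol}_\varphi$ by $6g_\varphi(X,Y)\mathrm{vol}_\varphi=(X\lrcorner\varphi)\wedge(Y\lrcorner\varphi)\wedge\varphi$, hence a Hodge star $*_\varphi$ and dual 4-form $\psi=*_\varphi\varphi$.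 It is coclosed if $\mathrm{d}\psi=0$. In the Laplacian coflow, $\psi_t=*_t\varphi_t$ is the dual 4-form of $\varphi_t$ (orientation fixed along the flow), and $\Delta_{\psi_t}=\mathrm{d}\mathrm{d}^{*_t}+\mathrm{d}^{*_t}\mathrm{d}$ is the (non-negative) Hodge Laplacian of $g_t=g_{\varphi_t}$ on 4-forms. A finite time singularity at an end point of the time interval means that the family of $\mathrm{G}_2$-structures degenerates there and cannot be continued to that time. *)

(* Defs.v *)
From HB Require Import structures.
From mathcomp Require Import all_boot all_order all_fingroup all_algebra.
From mathcomp Require Import all_classical all_reals all_analysis.
From mathcomp Require complex.
Import Order.TTheory GRing.Theory Num.Theory numFieldNormedType.Exports.

Set Implicit Arguments.
Unset Strict Implicit.
Unset Printing Implicit Defensive.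

Local Open Scope classical_set_scope.
Local Open Scope ring_scope.

Section Smooth.
Context {R : realType}.

Fixpoint Ck_on (k : nat) (V W : normedModType R) (U : set V) (f : V -> W)
    : Prop :=
  match k with
  | 0 => forall x, U x -> {for x, continuous f}
  | k'.+1 => (forall x, U x -> differentiable f x) /\
             (forall v, Ck_on k' U (fun x => 'D_v f x))
  end.

Definition smooth_on (V W : normedModType R) (U : set V) (f : V -> W) : Prop :=
  forall k, Ck_on k U f.

End Smooth.

(* [chart i] and [chart_inv i] are total functions; only their values on
   [chart_dom i], resp. on [chart_img i] (below), are meaningful. *)
Record manifold (R : realType) (n : nat) := Manifold {
  carrier :> topologicalType ;
  mfd_nonempty : [set: carrier] !=set0 ;
  mfd_hausdorff : hausdorff_space carrier ;
  mfd_second_countable : @second_countable carrier ;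
  atlas : Type ;
  chart_dom : atlas -> set carrier ;
  chart : atlas -> carrier -> 'rV[R]_n ;
  chart_inv : atlas -> 'rV[R]_n -> carrier ;
  chart_dom_open : forall i, open (chart_dom i) ;
  chart_dom_cover : forall x, exists i, chart_dom i x ;
  chart_img_open : forall i, open (chart i @` chart_dom i) ;
  chartK : forall i x, chart_dom i x -> chart_inv i (chart i x) = x ;
  chart_continuous : forall i x, chart_dom i x ->
    {for x, continuous (chart i)} ;
  chart_inv_continuous : forall i u, (chart i @` chart_dom i) u ->
    {for u, continuous (chart_inv i)} ;
  transition_smooth : forall i j,
    smooth_on (chart i @` (chart_dom i `&` chart_dom j))
      (fun u => chart j (chart_inv i u))
}.

(* A covariant k-tensor on R^n is a function of a k x n matrix, whose rows are
   its k vector arguments. *)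

Section Algebra.
Context {R : realType} {n : nat}.

Definition multilinear (k : nat) (T : 'M[R]_(k, n) -> R) : Prop :=
  forall (a : 'I_k) (A B C : 'M[R]_(k, n)) (b c : R),
    row a A = b *: row a B + c *: row a C ->
    row' a B = row' a A -> row' a C = row' a A ->
    T A = b * T B + c * T C.

Definition alternating (k : nat) (T : 'M[R]_(k, n) -> R) : Prop :=
  multilinear T /\
  forall (V : 'M[R]_(k, n)) (a b : 'I_k), a != b -> row a V = row b V -> T V = 0.

(* The codomain A is R for real forms and R[i] for complex-valued ones. *)
Definition tprod (A : fieldType) (k l : nat) (al : 'M[R]_(k, n) -> A)
    (be : 'M[R]_(l, n) -> A) : 'M[R]_(k + l, n) -> A :=
  fun V => al (usubmx V) * be (dsubmx V).

(* 1/(k! l!) normalisation: (e^1 /\ e^2)(e_1, e_2) = 1. *)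
Definition wedge_form (A : fieldType) (k l : nat) (al : 'M[R]_(k, n) -> A)
    (be : 'M[R]_(l, n) -> A) : 'M[R]_(k + l, n) -> A :=
  fun V => (k`! * l`!)%:R^-1 *
    \sum_(s : 'S_(k + l)) (-1) ^+ s * tprod al be (row_perm s V).

Definition contract (A : Type) (k : nat) (X : 'rV[R]_n)
    (al : 'M[R]_(k.+1, n) -> A) : 'M[R]_(k, n) -> A :=
  fun V => al (col_mx X V : 'M[R]_(1 + k, n)).

Definition bilin (g : 'M[R]_(2, n) -> R) (X Y : 'rV[R]_n) : R :=
  g (col_mx X Y : 'M[R]_(1 + 1, n)).

Definition gram (g : 'M[R]_(2, n) -> R) (m : nat) (E : 'M[R]_(m, n)) : 'M[R]_m :=
  \matrix_(a, b) bilin g (row a E) (row b E).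

Definition inner_product (g : 'M[R]_(2, n) -> R) : Prop :=
  [/\ multilinear g, forall X Y, bilin g X Y = bilin g Y X &
      forall X, X != 0 -> 0 < bilin g X X].

(* One of the two unit volume forms of g: the sign is the orientation. *)
Definition volume_form (g : 'M[R]_(2, n) -> R) (vol : 'M[R]_n -> R) : Prop :=
  alternating vol /\ forall E : 'M[R]_n, vol E ^+ 2 = \det (gram g E).

(* (star be)_{j_1..j_l} = 1/k! be^{i_1..i_k} vol_{i_1..i_k j_1..j_l}, with the
   indices of be raised by g; hence al /\ star be = <al, be>_g vol. *)
Definition hodge_star (k l : nat) (e : (k + l = n)%N) (g : 'M[R]_(2, n) -> R)
    (vol : 'M[R]_n -> R) (be : 'M[R]_(k, n) -> R) : 'M[R]_(l, n) -> R :=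
  fun V => k`!%:R^-1 *
    \sum_(f : {ffun 'I_k -> 'I_n})
      be (rowsub f (invmx (gram g 1%:M))) *
      vol (castmx (e, erefl n) (col_mx (rowsub f 1%:M) V)).

End Algebra.

Section Fields.
Context {R : realType} {n : nat} (M : manifold R n).

Definition chart_img (i : atlas M) : set 'rV[R]_n := chart i @` chart_dom i.

Definition transition (i j : atlas M) (u : 'rV[R]_n) : 'rV[R]_n :=
  chart j (chart_inv i u).

Definition overlap (i j : atlas M) : set 'rV[R]_n :=
  chart i @` (chart_dom i `&` chart_dom j).

(* Covariant k-tensor fields: [T i u] is the expression in chart i at the point
   of coordinates u. Only the values at [u] in [chart_img i] are meaningful. *)
Definition tfield (A : Type) (k : nat) : Type :=
  atlas M -> 'rV[R]_n -> 'M[R]_(k, n) -> A.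

Definition eq_field (A : Type) (k : nat) (S T : tfield A k) : Prop :=
  forall i u, chart_img i u -> forall V, S i u V = T i u V.

(* 'J f u acts on row vectors from the right. *)
Definition tensor_field (k : nat) (T : tfield R k) : Prop :=
  [/\ forall i u, chart_img i u -> multilinear (T i u),
      forall i V, smooth_on (chart_img i) (fun u => T i u V : R^o) &
      forall i j u, overlap i j u -> forall V,
        T i u V = T j (transition i j u) (V *m jacobian (transition i j) u)].

Definition diff_form (k : nat) (al : tfield R k) : Prop :=
  tensor_field al /\ forall i u, chart_img i u -> alternating (al i u).

Definition vector_field (X : atlas M -> 'rV[R]_n -> 'rV[R]_n) : Prop :=
  (forall i, smooth_on (chart_img i) (X i)) /\
  forall i j u, overlap i j u ->
    X i u *m jacobian (transition i j) u = X j (transition i j u).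

(* Fields of endomorphisms of the tangent spaces: X |-> X *m Phi i u. *)
Definition endo_field (Phi : atlas M -> 'rV[R]_n -> 'M[R]_n) : Prop :=
  (forall i, smooth_on (chart_img i) (Phi i)) /\
  forall i j u, overlap i j u ->
    Phi i u *m jacobian (transition i j) u =
    jacobian (transition i j) u *m Phi j (transition i j u).

Definition lie_bracket (X Y : 'rV[R]_n -> 'rV[R]_n) (u : 'rV[R]_n) : 'rV[R]_n :=
  'D_(X u) Y u - 'D_(Y u) X u.

(* [Phi, Phi](X, Y) =
     Phi^2 [X, Y] + [Phi X, Phi Y] - Phi [Phi X, Y] - Phi [X, Phi Y],
   for vector fields X, Y in a coordinate patch. *)
Definition nijenhuis (Phi : 'rV[R]_n -> 'M[R]_n) (X Y : 'rV[R]_n -> 'rV[R]_n)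
    (u : 'rV[R]_n) : 'rV[R]_n :=
  let PX := fun w => X w *m Phi w in
  let PY := fun w => Y w *m Phi w in
  lie_bracket X Y u *m Phi u *m Phi u + lie_bracket PX PY u
  - lie_bracket PX Y u *m Phi u - lie_bracket X PY u *m Phi u.

Definition ftprod (A : fieldType) k l (S : tfield A k) (T : tfield A l)
    : tfield A (k + l) := fun i u => tprod (S i u) (T i u).

Definition fwedge (A : fieldType) k l (al : tfield A k) (be : tfield A l)
    : tfield A (k + l) := fun i u => wedge_form (al i u) (be i u).

(* d al (V_0, .., V_k) = \sum_a (-1)^a V_a (al (V_0, .., V_a omitted, .., V_k))
   for constant vector fields V_a in the chart. *)
Definition extd k (al : tfield R k) : tfield R k.+1 :=
  fun i u V => \sum_(a < k.+1)
    (-1) ^+ a * 'D_(row a V) (fun w => al i w (row' a V) : R^o) u.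

Definition fstar k l (e : (k + l = n)%N) (g : tfield R 2) (vol : tfield R n)
    (al : tfield R k) : tfield R l :=
  fun i u => hodge_star e (g i u) (vol i u) (al i u).

Lemma codiff_dim k l : (k.+1 + l = n -> l.+1 + k = n)%N.
Proof. by move=> <-; rewrite addSnnS addnC. Qed.

Lemma laplacian_dim k l : (k.+1 + l.+1 = n -> k.+2 + l = n)%N.
Proof. by move=> <-; rewrite addSnnS. Qed.

(* On p-forms of a Riemannian n-manifold, d^* = (-1)^(n(p+1)+1) * d *;
   here p = k + 1. *)
Definition codiff k l (e : (k.+1 + l = n)%N) (g : tfield R 2) (vol : tfield R n)
    (al : tfield R k.+1) : tfield R k :=
  (-1) ^+ (n * (k.+1).+1 + 1) *:
    fstar (codiff_dim e) g vol (extd (fstar e g vol al)).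

Definition hodge_laplacian k l (e : (k.+1 + l.+1 = n)%N) (g : tfield R 2)
    (vol : tfield R n) (al : tfield R k.+1) : tfield R k.+1 :=
  extd (codiff e g vol al) + codiff (laplacian_dim e) g vol (extd al).

Definition riemannian_metric (g : tfield R 2) : Prop :=
  tensor_field g /\ forall i u, chart_img i u -> inner_product (g i u).

Import complex.
Local Open Scope complex_scope.

Definition fRe k (al : tfield R[i] k) : tfield R k :=
  fun i u V => complex.Re (al i u V).
Definition fIm k (al : tfield R[i] k) : tfield R k :=
  fun i u V => complex.Im (al i u V).
Definition fconj k (al : tfield R[i] k) : tfield R[i] k :=
  fun i u V => conjc (al i u V).
Definition fC k (al : tfield R k) : tfield R[i] k :=
  fun i u V => (al i u V)%:C.

End Fields.

Arguments tfield {R n} M A k.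

Declare Scope form_scope.
Delimit Scope form_scope with form.
Notation "a ∧ b" := (fwedge a b) (at level 40, left associativity) : form_scope.
Notation "a ⊗ b" := (ftprod a b) (at level 40, left associativity) : form_scope.
Notation "a ≡ b" := (eq_field a b) (at level 70, no associativity) : form_scope.
Local Open Scope form_scope.

(* Normal contact metric structures, with the exterior derivative normalised by
   d eta (X, Y) = X eta(Y) - Y eta(X) - eta([X, Y]) and the metric by
   d eta = g(Phi ., .); normality then reads [Phi, Phi] + d eta (x) xi = 0. As
   the left-hand side is tensorial, it is tested on coordinate-constant
   vector fields. *)
Record sasakian7 (R : realType) (M : manifold R 7) := Sasakian7 {
  sas_g : tfield M R 2 ;
  sas_eta : tfield M R 1 ;
  sas_xi : atlas M -> 'rV[R]_7 -> 'rV[R]_7 ;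
  sas_Phi : atlas M -> 'rV[R]_7 -> 'M[R]_7 ;
  sas_metric : riemannian_metric sas_g ;
  sas_eta_form : diff_form sas_eta ;
  sas_xi_field : vector_field sas_xi ;
  sas_Phi_field : endo_field sas_Phi ;
  sas_contact : forall i u, chart_img i u -> exists V,
    (sas_eta ∧ (extd sas_eta ∧ extd sas_eta ∧ extd sas_eta)) i u V != 0 ;
  sas_reeb : forall i u, chart_img i u ->
    sas_eta i u (sas_xi i u) = 1 /\
    forall Y, contract (sas_xi i u) (extd sas_eta i u) Y = 0 ;
  sas_Phi_sqr : forall i u, chart_img i u -> forall X : 'rV[R]_7,
    X *m sas_Phi i u *m sas_Phi i u = - X + sas_eta i u X *: sas_xi i u ;
  sas_compatible : forall i u, chart_img i u -> forall X Y : 'rV[R]_7,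
    bilin (sas_g i u) (X *m sas_Phi i u) (Y *m sas_Phi i u) =
    bilin (sas_g i u) X Y - sas_eta i u X * sas_eta i u Y ;
  sas_deta : forall i u, chart_img i u -> forall X Y : 'rV[R]_7,
    bilin (extd sas_eta i u) X Y = bilin (sas_g i u) (X *m sas_Phi i u) Y ;
  sas_normal : forall i u, chart_img i u -> forall X Y : 'rV[R]_7,
    nijenhuis (sas_Phi i) (cst X) (cst Y) u
    + bilin (extd sas_eta i u) X Y *: sas_xi i u = 0
}.

Import complex.
Local Open Scope complex_scope.

(* [ccy_type] says that Upsilon is of type (3,0) on D = ker eta with respect to
   the transverse complex structure J = Phi|_D. *)
Record contactCY (R : realType) (M : manifold R 7) := ContactCY {
  ccy_sasakian :> sasakian7 M ;
  ccy_Upsilon : tfield M R[i] 3 ;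
  ccy_Re_form : diff_form (fRe ccy_Upsilon) ;
  ccy_Im_form : diff_form (fIm ccy_Upsilon) ;
  ccy_nonvanishing : forall i u, chart_img i u ->
    exists V, ccy_Upsilon i u V != 0 ;
  ccy_transverse : forall i u, chart_img i u -> forall W,
    contract (sas_xi ccy_sasakian i u) (ccy_Upsilon i u) W = 0 ;
  ccy_type : forall i u, chart_img i u ->
    forall (X : 'rV[R]_7) (W : 'M[R]_(2, 7)),
    sas_eta ccy_sasakian i u X = 0 ->
    (forall a, sas_eta ccy_sasakian i u (row a W) = 0) ->
    contract (X *m sas_Phi ccy_sasakian i u) (ccy_Upsilon i u) W =
    (0 +i* 1) * contract X (ccy_Upsilon i u) W ;
  ccy_closed : extd (fRe ccy_Upsilon) ≡ 0 /\ extd (fIm ccy_Upsilon) ≡ 0 ;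
  ccy_volume :
    let om := extd (sas_eta ccy_sasakian) in
    fC (3`!%:R^-1 *: (om ∧ om ∧ om)) ≡
    (fun i u V => (0 +i* 1) / 8%:R * (ccy_Upsilon ∧ fconj ccy_Upsilon) i u V)
}.

Section ContactCYForms.
Context {R : realType} {M : manifold R 7} (C : contactCY M).

Definition ccy_eta : tfield M R 1 := sas_eta C.
Definition ccy_omega : tfield M R 2 := extd ccy_eta.
Definition ccy_gD : tfield M R 2 := sas_g C - ccy_eta ⊗ ccy_eta.
Definition ccy_volD : tfield M R 6 :=
  3`!%:R^-1 *: (ccy_omega ∧ ccy_omega ∧ ccy_omega).

End ContactCYForms.

Section G2.
Context {R : realType}.

(* e^{ijk}, with 1 <= i, j, k <= 7. *)
Definition e3 (i j k : nat) (V : 'M[R]_(3, 7)) : R :=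
  \det (colsub (fun b : 'I_3 => inord (nth 0%N [:: i; j; k] b).-1 : 'I_7) V).

Definition g2_model (V : 'M[R]_(3, 7)) : R :=
  e3 1 2 3 V + e3 1 4 5 V + e3 1 6 7 V + e3 2 4 6 V
  - e3 2 5 7 V - e3 3 4 7 V - e3 3 5 6 V.

Definition g2_form (phi : 'M[R]_(3, 7) -> R) : Prop :=
  exists2 A : 'M[R]_7, A \in unitmx & forall V, phi V = g2_model (V *m A).

(* (g, vol) are the metric and volume form determined by phi. *)
Definition g2_metric (phi : 'M[R]_(3, 7) -> R) (g : 'M[R]_(2, 7) -> R)
    (vol : 'M[R]_7 -> R) : Prop :=
  [/\ inner_product g, volume_form g vol &
      forall (X Y : 'rV[R]_7) (V : 'M[R]_7),
        6%:R * bilin g X Y * vol V =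
        wedge_form (wedge_form (contract X phi) (contract Y phi)) phi V].

Variable M : manifold R 7.

Record g2data := G2Data {
  g2phi : tfield M R 3 ;
  g2psi : tfield M R 4 ;
  g2g : tfield M R 2 ;
  g2vol : tfield M R 7
}.

Definition g2_structure (D : g2data) : Prop :=
  [/\ [/\ diff_form (g2phi D), diff_form (g2psi D), riemannian_metric (g2g D)
        & diff_form (g2vol D)],
      forall i u, chart_img i u -> g2_form (g2phi D i u),
      forall i u, chart_img i u ->
        g2_metric (g2phi D i u) (g2g D i u) (g2vol D i u) &
      g2psi D ≡ fstar (erefl : (3 + 4 = 7)%N) (g2g D) (g2vol D) (g2phi D)].

Definition coclosed (D : g2data) : Prop := extd (g2psi D) ≡ 0.

Definition g2_laplacian (D : g2data) (al : tfield M R 4) : tfield M R 4 :=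
  hodge_laplacian (erefl : (4 + 3 = 7)%N) (g2g D) (g2vol D) al.

(* [laplacian_coflow J S]: S is a solution of d psi / dt = Delta_psi psi for the
   times in the open interval J, the orientation being fixed. *)
Definition laplacian_coflow (J : set R) (S : R -> g2data) : Prop :=
  [/\ forall t, J t -> g2_structure (S t),
      forall s t, J s -> J t -> forall i u, chart_img i u -> forall V,
        0 <= g2vol (S s) i u V * g2vol (S t) i u V &
      forall t, J t -> forall i u, chart_img i u -> forall V,
        is_derive t 1 (fun s => g2psi (S s) i u V : R^o)
          (g2_laplacian (S t) (g2psi (S t)) i u V)].

Definition converges_right k (T : R -> tfield M R k) (a : R) (L : tfield M R k)
    : Prop :=
  forall i u, chart_img i u -> forall V,
    (T t i u V : R^o) @[t --> a^'+] --> (L i u V : R^o).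

(* S has a limit G2-structure at its left end point a, already in the weakest
   (pointwise) sense and for only one of the 3-form and the 4-form. Any
   continuation of S through a whose 3-form or 4-form is continuous in time
   provides such a limit. *)
Definition continues_to (S : R -> g2data) (a : R) : Prop :=
  exists2 D : g2data, g2_structure D &
    converges_right (fun t => g2phi (S t)) a (g2phi D) \/
    converges_right (fun t => g2psi (S t)) a (g2psi D).

Definition degenerates_at (S : R -> g2data) (a : R) : Prop :=
  converges_right (fun t => g2vol (S t)) a 0.

(* For a family parametrised by times > a. *)
Definition backward_singularity (S : R -> g2data) (a : R) : Prop :=
  degenerates_at S a /\ ~ continues_to S a.

End G2.

Section Solution.
Context {R : realType} {M : manifold R 7} (C : contactCY M) (eps : R).

Local Notation eta := (ccy_eta C).
Local Notation omega := (ccy_omega C).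
Local Notation Upsilon := (ccy_Upsilon C).

Definition ccy_p (t : R) : R := (1 + 10%:R * eps ^+ 2 * t) `^ (10%:R^-1).

Definition ccy_phi0 : tfield M R 3 := eps *: (eta ∧ omega) + fRe Upsilon.

Definition ccy_psi0 : tfield M R 4 :=
  2%:R^-1 *: (omega ∧ omega) - eps *: (eta ∧ fIm Upsilon).

Definition ccy_family (t : R) : g2data M :=
  let p := ccy_p t in
  {| g2phi := (eps * p ^- 1) *: (eta ∧ omega) + p ^+ 3 *: fRe Upsilon ;
     g2psi := (2%:R^-1 * p ^+ 4) *: (omega ∧ omega) - eps *: (eta ∧ fIm Upsilon) ;
     g2g := (eps ^+ 2 * p ^- 6) *: (eta ⊗ eta) + p ^+ 2 *: ccy_gD C ;
     g2vol := (eps * p ^+ 3) *: (eta ∧ ccy_volD C) |}.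

End Solution.

(* Main.v *)
Require Import Defs.
From mathcomp Require Import all_boot all_order all_fingroup all_algebra.
From mathcomp Require Import all_classical all_reals all_analysis.
From mathcomp Require Import zify ring lra.
From mathcomp Require complex.
Import Order.TTheory GRing.Theory Num.Theory numFieldNormedType.Exports.

Set Implicit Arguments.
Unset Strict Implicit.
Unset Printing Implicit Defensive.

Local Open Scope classical_set_scope.
Local Open Scope ring_scope.

(* At each point one finds a unitary coframe e0 = eta, e1, .., e6 in which
   omega = e12 + e34 + e56 and Upsilon = (e1 + i e2)(e3 + i e4)(e5 + i e6): the
   volume normalisation forces |Upsilon(X0, X1, X2)| = 1 on a unitary triple,
   and rotating X0 removes the phase.  In the rescaled coframe
   (eps p^-3 e0, p e1, .., p e6) the forms phi_t and psi_t become the constant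
   model forms of G2, so that g_t, vol_t and the Hodge stars reduce to integer
   computations.  Globally d eta = omega, d omega = 0,
   d (eta /\ omega) = omega /\ omega and
   d (eta /\ Im Upsilon) = omega /\ Im Upsilon = 0 by type.  Hence psi_t is
   coclosed, d^* psi_t = * d phi_t = 2 eps^2 p^-6 eta /\ omega, and the coflow is
   the equation 2 p^3 p' = 2 eps^2 p^-6, solved by p^10 = 1 + 10 eps^2 t.
   At the left end point p -> 0: the volume forms vanish, phi_t blows up and
   psi_t tends to - eps eta /\ Im Upsilon, which vanishes on ker eta, whereas no
   G2 4-form vanishes on a hyperplane. *)

(** * Antisymmetrisation and wedge products *)

(** The wedge and the star are sums over all permutations or index functions, far too many in
    dimension 7 for direct evaluation. Constant-coefficient forms are therefore integer combinations
    of minors indexed by lists: the wedge concatenates lists, the star takes the complementary list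
    with a sorting sign, contraction deletes an index, and an insertion sort decides equality. A
    coframe is a matrix [A] acting on row vectors from the right, inverse to the matrix whose rows
    are the frame vectors; pulling back along [A] reduces pointwise identities to computations on
    lists. The frame is chosen at each point separately, with no regularity in the point:
    derivatives are taken only of the global fields built from eta, omega and Upsilon. The exponents
    of p are forced as follows. The Laplacian of psi_t has only an omega /\ omega component, so the
    coefficient of eta /\ Im Upsilon must stay eps. If horizontal covectors are scaled by p, then
    eta must be scaled by eps p^-3, and this fixes all the other coefficients. *)

Section Antisymmetrization.
Context {R : realType} {n : nat} {A : fieldType}.
Implicit Types k l : nat.

(** No factor 1/k! is included: [wedge_form] is [alt] of a tensor product divided by k! l!, and
    identities between nested antisymmetrisations stay free of division. *)
Definition alt k (T : 'M[R]_(k, n) -> A) : 'M[R]_(k, n) -> A :=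
  fun V => \sum_(s : 'S_k) (-1) ^+ s * T (row_perm s V).

Lemma eq_alt k (S T : 'M[R]_(k, n) -> A) : S =1 T -> alt S =1 alt T.
Proof. by move=> ST V; apply: eq_bigr => s _; rewrite ST. Qed.

(** This collapses nested antisymmetrisations: a permutation applied inside the outer [alt] costs
    its sign, which cancels the sign it already carries. *)
Lemma alt_row_perm k (T : 'M[R]_(k, n) -> A) (s : 'S_k) V :
  alt (fun W => T (row_perm s W)) V = (-1) ^+ s * alt T V.
Proof.
rewrite /alt mulr_sumr.
under eq_bigr do rewrite -row_permM.
rewrite [RHS](reindex_inj (mulgI s)) /=; apply: eq_bigr => t _.
by rewrite mulrA odd_permM signr_addb mulrA -signr_addb addbb mul1r.
Qed.

Lemma alt_perm k (T : 'M[R]_(k, n) -> A) (s : 'S_k) V :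
  alt T (row_perm s V) = (-1) ^+ s * alt T V.
Proof.
rewrite /alt mulr_sumr [RHS](reindex_inj (mulIg s)) /=; apply: eq_bigr => t _.
rewrite row_permM mulrA odd_permM addbC signr_addb mulrA -signr_addb addbb.
by rewrite mul1r.
Qed.

Lemma alt_sum k (I : finType) (c : I -> A) (T : I -> 'M[R]_(k, n) -> A) V :
  alt (fun W => \sum_i c i * T i W) V = \sum_i c i * alt (T i) V.
Proof.
rewrite /alt; under eq_bigr do rewrite mulr_sumr.
rewrite exchange_big /=; apply: eq_bigr => i _; rewrite mulr_sumr.
by apply: eq_bigr => s _; rewrite mulrCA.
Qed.

Lemma altD k (S T : 'M[R]_(k, n) -> A) V :
  alt (fun W => S W + T W) V = alt S V + alt T V.
Proof.
by rewrite /alt -big_split; apply: eq_bigr => s _; rewrite mulrDr.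
Qed.

Lemma altZ k c (T : 'M[R]_(k, n) -> A) V :
  alt (fun W => c * T W) V = c * alt T V.
Proof.
by rewrite /alt mulr_sumr; apply: eq_bigr => s _; rewrite mulrCA.
Qed.

End Antisymmetrization.

Section DirectSumPerm.
Variables k l : nat.

Definition dsum_fun (s : 'S_k) (t : 'S_l) (i : 'I_(k + l)) : 'I_(k + l) :=
  match fintype.split i with inl j => lshift l (s j) | inr j => rshift k (t j) end.

Lemma dsum_fun_inj s t : injective (dsum_fun s t).
Proof.
apply: (can_inj (g := dsum_fun (s^-1)%g (t^-1)%g)) => i; rewrite /dsum_fun.
by case: (split_ordP i) => j ->;
  rewrite ?(unsplitK (inl _ : 'I_k + 'I_l)) ?(unsplitK (inr _ : 'I_k + 'I_l)) permK.
Qed.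

Definition dsum_perm s t : 'S_(k + l) := perm (@dsum_fun_inj s t).

Lemma dsum_perml s t i : dsum_perm s t (lshift l i) = lshift l (s i).
Proof. by rewrite permE /dsum_fun (unsplitK (inl _ : 'I_k + 'I_l)). Qed.

Lemma dsum_permr s t i : dsum_perm s t (rshift k i) = rshift k (t i).
Proof. by rewrite permE /dsum_fun (unsplitK (inr _ : 'I_k + 'I_l)). Qed.

(** The permutation matrix of the direct sum is block diagonal, so its determinant is the product of
    the two signs; over [int] the signs 1 and -1 differ, which gives back the parity. *)
Lemma odd_dsum_perm s t : dsum_perm s t = s (+) t :> bool.
Proof.
have E : perm_mx (dsum_perm s t) =
    block_mx (perm_mx s) 0 0 (perm_mx t) :> 'M[int]_(k + l).
  apply/matrixP=> i j; rewrite !mxE.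
  by case: (split_ordP i) => i' ->; rewrite !mxE;
    case: (split_ordP j) => j' ->;
    rewrite ?dsum_perml ?dsum_permr !mxE ?eq_lshift ?eq_rshift ?eq_lrshift
      ?eq_rlshift.
have := congr1 determinant E; rewrite det_ublock !det_perm -signr_addb.
by case: (dsum_perm s t : bool); case: (_ (+) _) => //= /eqP; rewrite ?expr0z.
Qed.

End DirectSumPerm.

Section TensorProduct.
Context {R : realType} {n : nat} {A : fieldType}.

Lemma usubmx_dsum k l (s : 'S_k) (t : 'S_l) (V : 'M[R]_(k + l, n)) :
  usubmx (row_perm (dsum_perm s t) V) = row_perm s (usubmx V).
Proof. by apply/matrixP=> i j; rewrite !mxE dsum_perml. Qed.

Lemma dsubmx_dsum k l (s : 'S_k) (t : 'S_l) (V : 'M[R]_(k + l, n)) :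
  dsubmx (row_perm (dsum_perm s t) V) = row_perm t (dsubmx V).
Proof. by apply/matrixP=> i j; rewrite !mxE dsum_permr. Qed.

(** Each inner permutation s extends by the identity to k + l arguments and is absorbed by the outer
    sum, so the k! inner terms are equal. This is the associativity of the wedge product in
    unnormalised form. *)
Lemma alt_tprodl k l (S : 'M[R]_(k, n) -> A) (T : 'M[R]_(l, n) -> A) V :
  alt (tprod (alt S) T) V = k`!%:R * alt (tprod S T) V.
Proof.
rewrite (eq_alt (T := fun W => \sum_(s : 'S_k) (-1) ^+ s *
    tprod S T (row_perm (dsum_perm s 1) W))); last first.
  move=> W; rewrite /tprod /alt mulr_suml; apply: eq_bigr => s _.
  by rewrite usubmx_dsum dsubmx_dsum row_perm1 mulrA.
rewrite alt_sum; under eq_bigr do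
  rewrite alt_row_perm odd_dsum_perm odd_perm1 addbF mulrA -signr_addb addbb mul1r.
by rewrite sumr_const (card_Sn k) mulr_natl.
Qed.

Lemma alt_tprodr k l (S : 'M[R]_(k, n) -> A) (T : 'M[R]_(l, n) -> A) V :
  alt (tprod S (alt T)) V = l`!%:R * alt (tprod S T) V.
Proof.
rewrite (eq_alt (T := fun W => \sum_(s : 'S_l) (-1) ^+ s *
    tprod S T (row_perm (dsum_perm 1 s) W))); last first.
  move=> W; rewrite /tprod /alt mulr_sumr; apply: eq_bigr => s _.
  by rewrite usubmx_dsum dsubmx_dsum row_perm1 mulrCA.
rewrite alt_sum; under eq_bigr do
  rewrite alt_row_perm odd_dsum_perm odd_perm1 addFb mulrA -signr_addb addbb mul1r.
by rewrite sumr_const (card_Sn l) mulr_natl.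
Qed.

Lemma wedge_formE k l (al : 'M[R]_(k, n) -> A) (be : 'M[R]_(l, n) -> A) V :
  wedge_form al be V = (k`! * l`!)%:R^-1 * alt (tprod al be) V.
Proof. by []. Qed.

End TensorProduct.

Section Alternating.
Context {R : realType} {n : nat}.
Implicit Types k l : nat.

Lemma row'_row_eq k (a b : 'I_k) (U V : 'M[R]_(k, n)) :
  row' a U = row' a V -> b != a -> row b U = row b V.
Proof.
move=> UV; case: (unliftP a b) => [j ->|->]; rewrite ?eqxx // => _.
have := congr1 (row j) UV => /rowP h; apply/rowP => x.
by have := h x; rewrite !mxE.
Qed.

Lemma row'_eqP k (a : 'I_k) (U V : 'M[R]_(k, n)) :
  (forall b, b != a -> row b U = row b V) -> row' a U = row' a V.
Proof.
move=> UV; apply/matrixP => i j; rewrite !mxE.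
have la : lift a i != a by rewrite eq_sym neq_lift.
by have /rowP/(_ j) := UV _ la; rewrite !mxE.
Qed.

End Alternating.

(** * Forms with integer coefficients in a frame *)

Section CoordinateForms.
Context {R : realType} {m : nat}.
Implicit Types (k l : nat) (I J L : seq nat).

(** The covector e^I as the minor of V on the columns I, counted from 0. Lists keep the index
    calculus computable; their length and range are checked where they matter. *)
Definition ecov k I (V : 'M[R]_(k, m.+1)) : R :=
  \det (colsub (fun b : 'I_k => inord (nth 0%N I b)) V).

Lemma ecov_alt k I V :
  ecov I V = alt (fun W : 'M[R]_(k, m.+1) => \prod_b W b (inord (nth 0%N I b))) V.
Proof.
rewrite /ecov -det_tr /alt; apply: eq_bigr => s _; congr (_ * _).
by apply: eq_bigr => b _; rewrite !mxE.
Qed.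

(** Both minors are antisymmetrised monomials; flattening the nested sums produces exactly the
    factor k! l! that [wedge_form] divides out. *)
Lemma wedge_ecov k l I J V : size I = k ->
  wedge_form (@ecov k I) (@ecov l J) V = ecov (I ++ J) V.
Proof.
move=> sI; rewrite wedge_formE.
rewrite (eq_alt (T := tprod (alt (fun W : 'M[R]_(k, m.+1) =>
    \prod_b W b (inord (nth 0%N I b)))) (alt (fun W : 'M[R]_(l, m.+1) =>
    \prod_b W b (inord (nth 0%N J b)))))); last first.
  by move=> W; rewrite /tprod !ecov_alt.
rewrite alt_tprodl (_ : alt _ V = l`!%:R * ecov (I ++ J) V).
  rewrite [k`!%:R * _]mulrA -natrM mulrA mulVf ?mul1r//.
rewrite alt_tprodr ecov_alt; congr (_ * _); apply: eq_alt => W.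
rewrite /tprod big_split_ord /=; congr (_ * _); apply: eq_bigr => b _.
  by rewrite nth_cat sI ltn_ord mxE.
by rewrite nth_cat sI ltnNge leq_addr /= addKn mxE.
Qed.

(** A transposition of two adjacent columns of the minor. The prefix P lets the insertion sort act
    at any depth of the list. *)
Lemma ecov_swap k (P L : seq nat) a b (V : 'M[R]_(k, m.+1)) :
  (size P + (size L).+2)%N = k ->
  ecov (P ++ a :: b :: L) V = - ecov (P ++ b :: a :: L) V.
Proof.
move=> sk; have Pk : (size P < k)%N by lia.
have Pk1 : ((size P).+1 < k)%N by lia.
pose s := tperm (Ordinal Pk) (Ordinal Pk1).
rewrite /ecov (_ : colsub _ V = col_perm s
  (colsub (fun c : 'I_k => inord (nth 0%N (P ++ b :: a :: L) c)) V)).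
  rewrite col_permE det_mulmx det_perm odd_permV odd_tperm mulrC -[RHS]mulN1r.
  congr (_ * _).
  have -> : Ordinal Pk != Ordinal Pk1 by rewrite -val_eqE /=; lia.
  by rewrite expr1.
apply/matrixP => i c; rewrite !mxE; congr (V i (inord _)).
rewrite /s; case: tpermP => [->|->|/eqP c0 /eqP c1] /=.
- by rewrite !nth_cat !ltnn !subnn ltnNge leqnSn /= subSnn.
- by rewrite !nth_cat !ltnn !subnn ltnNge leqnSn /= subSnn.
rewrite !nth_cat; case: ltnP => // Pc.
move: c0 c1; rewrite -!val_eqE /= => c0 c1.
have -> : (c - size P = (c - size P - 2).+2)%N by lia.
by [].
Qed.

Lemma ecov_diag k (P L : seq nat) a (V : 'M[R]_(k, m.+1)) :
  (size P + (size L).+2)%N = k -> ecov (P ++ a :: a :: L) V = 0.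
Proof. by move=> /(@ecov_swap _ _ _ a a V); lra. Qed.

(** The sign c flips for each index passed and becomes 0 when a repeated index is met; the length is
    right in every case, so the result is still read as a k-covector. *)
Fixpoint insert (c : int) (a : nat) L : int * seq nat :=
  if L is b :: L' then
    if (a < b)%N then (c, a :: L) else if a == b then (0, a :: L)
    else let r := insert (- c) a L' in (r.1, b :: r.2)
  else (c, [:: a]).

Fixpoint signed_sort L : int * seq nat :=
  if L is a :: L' then let r := signed_sort L' in insert r.1 a r.2 else (1, [::]).

Lemma size_insert c a L : size (insert c a L).2 = (size L).+1.
Proof. by elim: L c => //= b L IH c; case: ifP => //; case: ifP => //= _ _; rewrite IH. Qed.

Lemma size_signed_sort L : size (signed_sort L).2 = size L.
Proof. by elim: L => //= a L <-; rewrite size_insert. Qed.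

Lemma ecov_insert k P c a L (V : 'M[R]_(k, m.+1)) :
  (size P + (size L).+1)%N = k ->
  (insert c a L).1%:~R * ecov (P ++ (insert c a L).2) V =
  c%:~R * ecov (P ++ a :: L) V.
Proof.
elim: L P c => //= b L IH P c sk; case: ifP => //= _.
case: eqP => [<-|_] /=; first by rewrite ecov_diag// mul0r mulr0.
rewrite -cat_rcons IH ?size_rcons; last by lia.
by rewrite cat_rcons [in RHS]ecov_swap// mulrN rmorphN mulNr.
Qed.

Lemma ecov_signed_sort k P L (V : 'M[R]_(k, m.+1)) : (size P + size L)%N = k ->
  (signed_sort L).1%:~R * ecov (P ++ (signed_sort L).2) V = ecov (P ++ L) V.
Proof.
elim: L P => [|a L IH] P /= sk; first by rewrite mul1r.
rewrite ecov_insert ?size_signed_sort// -!cat_rcons IH//.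
by rewrite size_rcons; lia.
Qed.

(* Integral combinations of the covectors [ecov I], as lists of
   (coefficient, I); equality of two of them is decided by computation. *)
Definition iform := seq (int * seq nat).

Definition ev k (F : iform) (V : 'M[R]_(k, m.+1)) : R :=
  \sum_(t <- F) t.1%:~R * ecov t.2 V.

Definition homog k (F : iform) := all (fun t => size t.2 == k) F.

Definition iscale (c : int) (F : iform) : iform := [seq (c * t.1, t.2) | t <- F].

Definition normal_form (F : iform) : iform :=
  [seq (t.1 * (signed_sort t.2).1, (signed_sort t.2).2) | t <- F].

Definition icoef (F : iform) I : int :=
  foldr (fun t x => if t.2 == I then t.1 + x else x) 0 F.

(** The lists of F - G are sorted, and the total coefficient of each list that occurs must vanish.
    The length tests make sorting preserve the value. *)
Definition iform_eq k F G :=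
  let H := normal_form (F ++ iscale (-1) G) in
  [&& homog k F, homog k G & all (fun t => icoef H t.2 == 0) H].

Lemma ev_cat k F G (V : 'M[R]_(k, m.+1)) : ev (F ++ G) V = ev F V + ev G V.
Proof. by rewrite /ev big_cat. Qed.

Lemma ev_iscale k c F (V : 'M[R]_(k, m.+1)) : ev (iscale c F) V = c%:~R * ev F V.
Proof.
rewrite /ev big_map mulr_sumr; apply: eq_bigr => t _.
by rewrite /= rmorphM mulrA.
Qed.

Lemma ev_normal_form k F (V : 'M[R]_(k, m.+1)) : homog k F ->
  ev (normal_form F) V = ev F V.
Proof.
move=> /allP hF; rewrite /ev big_map; apply: eq_big_seq => t /hF /eqP st /=.
by rewrite rmorphM -mulrA (@ecov_signed_sort _ [::]).
Qed.

Lemma icoefE F I : (icoef F I)%:~R = \sum_(t <- F | t.2 == I) t.1%:~R :> R.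
Proof.
elim: F => [|t F IH]; rewrite ?big_nil// big_cons /=.
by case: ifP => _; rewrite ?rmorphD /= IH.
Qed.

Lemma ev_eq0 k F (V : 'M[R]_(k, m.+1)) :
  all (fun t => icoef F t.2 == 0) F -> ev F V = 0.
Proof.
move=> /allP F0.
have -> : ev F V = \sum_(I <- undup (map snd F)) \sum_(t <- F | t.2 == I)
    t.1%:~R * ecov t.2 V.
  rewrite (exchange_big_dep predT)//= /ev; apply: eq_big_seq => t tF.
  under eq_bigl do rewrite eq_sym.
  rewrite -big_filter filter_pred1_uniq ?undup_uniq ?big_seq1//.
  by rewrite mem_undup map_f.
apply: big1_seq => I /=; rewrite mem_undup => /mapP[t tF ->].
under eq_bigr => u /eqP -> do over.
by rewrite -mulr_suml -icoefE (eqP (F0 _ tF)) mul0r.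
Qed.

Lemma ev_eq k F G (V : 'M[R]_(k, m.+1)) : iform_eq k F G -> ev F V = ev G V.
Proof.
move=> /and3P[hF hG /ev_eq0 -/(_ k V)].
rewrite ev_normal_form ?ev_cat ?ev_iscale => [/eqP|].
  by rewrite mulN1r subr_eq0 => /eqP.
rewrite /homog all_cat; apply/andP; split=> //.
by rewrite all_map; apply: sub_all hG.
Qed.

End CoordinateForms.

Lemma castmx_mul_row (R : pzRingType) p q n r (e : p = q) (M : 'M[R]_(p, n))
    (A : 'M[R]_(n, r)) :
  castmx (e, erefl n) M *m A = castmx (e, erefl r) (M *m A).
Proof. by case: q / e; rewrite !castmx_id. Qed.

(** * Pullback along a coframe, and the Hodge star of a monomial *)

Section Pullback.
Context {R : realType} {n : nat}.
Implicit Types (k l : nat).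

(** Vectors are rows, so the columns of A are covectors and [V *m A] lists the coordinates of the
    rows of V in that coframe: [pull A T] has in the coframe A the coefficients that T has in the
    standard one. *)
Definition pull (B : Type) k (A : 'M[R]_n) (T : 'M[R]_(k, n) -> B) :
  'M[R]_(k, n) -> B := fun V => T (V *m A).

Lemma row_permM_mul k (s : 'S_k) (V : 'M[R]_(k, n)) p (A : 'M[R]_(n, p)) :
  row_perm s (V *m A) = row_perm s V *m A.
Proof. by rewrite !row_permE mulmxA. Qed.

Lemma wedge_pull (B : fieldType) k l (A : 'M[R]_n) (S : 'M[R]_(k, n) -> B)
    (T : 'M[R]_(l, n) -> B) V :
  wedge_form (pull A S) (pull A T) V = wedge_form S T (V *m A).
Proof.
rewrite /wedge_form; congr (_ * _); apply: eq_bigr => s _; congr (_ * _).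
rewrite /tprod /pull row_permM_mul -[in RHS](vsubmxK (row_perm s V)).
by rewrite mul_col_mx col_mxKu col_mxKd.
Qed.

Lemma eq_wedge (B : fieldType) k l (S S' : 'M[R]_(k, n) -> B)
    (T T' : 'M[R]_(l, n) -> B) :
  S =1 S' -> T =1 T' -> wedge_form S T =1 wedge_form S' T'.
Proof.
move=> SS TT V; rewrite /wedge_form; congr (_ * _).
by apply: eq_bigr => s _; rewrite /tprod SS TT.
Qed.

Lemma wedgeZ (B : fieldType) k l c d (S : 'M[R]_(k, n) -> B)
    (T : 'M[R]_(l, n) -> B) V :
  wedge_form (fun W => c * S W) (fun W => d * T W) V = c * d * wedge_form S T V.
Proof.
rewrite !wedge_formE mulrCA; congr (_ * _); rewrite -altZ; apply: eq_alt => W.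
by rewrite /tprod mulrACA.
Qed.

Lemma wedge_sumsl (B : fieldType) k l (X : Type) (r : seq X) (c : X -> B)
    (S : X -> 'M[R]_(k, n) -> B) (T : 'M[R]_(l, n) -> B) V :
  wedge_form (fun W => \sum_(t <- r) c t * S t W) T V =
  \sum_(t <- r) c t * wedge_form (S t) T V.
Proof.
have E (a b c0 x y : B) : a * (b * (c0 * x * y)) = c0 * (a * (b * (x * y))).
  by ring.
rewrite /wedge_form mulr_sumr.
under eq_bigr do rewrite /tprod mulr_suml 2!mulr_sumr.
rewrite exchange_big; apply: eq_bigr => t _; rewrite /= !mulr_sumr.
by apply: eq_bigr => s _; rewrite /tprod E.
Qed.

Lemma wedge_sumsr (B : fieldType) k l (X : Type) (r : seq X) (c : X -> B)
    (S : 'M[R]_(k, n) -> B) (T : X -> 'M[R]_(l, n) -> B) V :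
  wedge_form S (fun W => \sum_(t <- r) c t * T t W) V =
  \sum_(t <- r) c t * wedge_form S (T t) V.
Proof.
have E (a b c0 x y : B) : a * (b * (x * (c0 * y))) = c0 * (a * (b * (x * y))).
  by ring.
rewrite /wedge_form mulr_sumr.
under eq_bigr do rewrite /tprod 3!mulr_sumr.
rewrite exchange_big; apply: eq_bigr => t _; rewrite /= !mulr_sumr.
by apply: eq_bigr => s _; rewrite /tprod E.
Qed.

Lemma hodge_star_sum k l (e : (k + l = n)%N) g vol (X : Type) (r : seq X)
    (c : X -> R) (T : X -> 'M[R]_(k, n) -> R) V :
  hodge_star e g vol (fun W => \sum_(t <- r) c t * T t W) V =
  \sum_(t <- r) c t * hodge_star e g vol (T t) V.
Proof.
rewrite /hodge_star mulr_sumr.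
under eq_bigr do rewrite mulr_suml mulr_sumr.
rewrite exchange_big; apply: eq_bigr => t _; rewrite /= !mulr_sumr.
by apply: eq_bigr => s _; rewrite -mulrA mulrCA.
Qed.

Lemma hodge_starZ k l (e : (k + l = n)%N) g vol c (T : 'M[R]_(k, n) -> R) V :
  hodge_star e g vol (fun W => c * T W) V = c * hodge_star e g vol T V.
Proof.
rewrite /hodge_star mulrCA; congr (_ * _); rewrite mulr_sumr.
by apply: eq_bigr => s _; rewrite mulrA.
Qed.

(** Multilinearity of the determinant in its first k rows. The sum runs over all functions f, not
    only injective ones, to match the index sum in [hodge_star]. *)
Lemma det_col_mx_expand k l (C : 'M[R]_(k, n)) (A : 'M[R]_n) (W : 'M[R]_(l, n))
    (e : (k + l = n)%N) :
  \det (castmx (e, erefl n) (col_mx (C *m A) W)) =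
  \sum_(f : {ffun 'I_k -> 'I_n}) (\prod_b C b (f b)) *
    \det (castmx (e, erefl n) (col_mx (rowsub f A) W)).
Proof.
case: n / e C A W => C A W; rewrite castmx_id /determinant.
under [RHS]eq_bigr do rewrite castmx_id mulr_sumr.
rewrite exchange_big /=; apply: eq_bigr => s _.
under [RHS]eq_bigr do rewrite mulrCA big_split_ord /=.
rewrite -mulr_sumr big_split_ord /=. congr (_ * _).
under [RHS]eq_bigr do rewrite mulrA -big_split /=.
under [in RHS]eq_bigr => f _.
  rewrite (eq_bigr (fun b : 'I_l => W b (s (rshift k b)))); last first.
    by move=> b _; rewrite col_mxEd.
  under eq_bigr do rewrite col_mxEu mxE.
  over.
rewrite -mulr_suml; congr (_ * _); last by apply: eq_bigr => b _; rewrite col_mxEd.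
under eq_bigr do rewrite col_mxEu mxE.
by rewrite bigA_distr_bigA.
Qed.

(** For an orthonormal coframe the star of e^h is the volume form with the frame vectors e_h
    inserted. The Gram matrix is A A^T, so raising indices and passing to the coframe leaves P, the
    inverse of A^T. *)
Lemma hodge_star_frame k l (e : (k + l = n)%N) g vol (A : 'M[R]_n)
    (h : 'I_k -> 'I_n) V :
  A \in unitmx -> (forall X Y, bilin g X Y = ((X *m A) *m (Y *m A)^T) 0 0) ->
  (forall V, vol V = \det (V *m A)) ->
  hodge_star e g vol (pull A (fun W => \det (colsub h W))) V =
  \det (castmx (e, erefl n) (col_mx (rowsub h 1%:M) (V *m A))).
Proof.
move=> uA gE volE; rewrite /hodge_star.
have -> : gram g 1%:M = A *m A^T.
  apply/matrixP=> a b; rewrite [LHS]mxE gE -!row_mul !mul1mx !mxE.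
  by apply: eq_bigr => c _; rewrite !mxE.
set P := invmx A^T; set D := \det _.
have GA : invmx (A *m A^T) *m A = P.
  have AP : A *m A^T *m P = A by rewrite -mulmxA mulmxV ?unitmx_tr ?mulmx1.
  by rewrite -[X in _ *m X = _]AP mulKmx// unitmx_mul unitmx_tr uA.
under eq_bigr => f _.
  rewrite volE /pull.
  have -> : rowsub f (invmx (A *m A^T)) *m A = rowsub f P.
    by rewrite -GA; apply/matrixP => a b; rewrite !mxE; apply: eq_bigr => c _; rewrite !mxE.
  have -> : castmx (e, erefl n) (col_mx (rowsub f 1%:M) V) *m A =
      castmx (e, erefl n) (col_mx (rowsub f A) (V *m A)).
    have -> : rowsub f A = rowsub f 1%:M *m A :> 'M[R]_(k, n).
      by rewrite mul_rowsub_mx mul1mx.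
    by rewrite castmx_mul_row mul_col_mx.
  rewrite {1}/determinant mulr_suml.
  over.
rewrite exchange_big /=.
(* For fixed s the sum over f is a multilinear expansion read backwards. Since P^T A = 1, the first
   k rows become the rows h of the identity permuted by s, whose sign cancels; the k! equal terms
   then cancel the factor 1/k!. *)
have S (s : 'S_k) : \sum_(f : {ffun 'I_k -> 'I_n})
   (-1) ^+ s * (\prod_i colsub h (rowsub f P) i (s i)) *
   \det (castmx (e, erefl n) (col_mx (rowsub f A) (V *m A))) = D.
  under eq_bigr do rewrite -mulrA.
  rewrite -mulr_sumr.
  have := det_col_mx_expand (\matrix_(b < k, j < n) P j (h (s b))) A (V *m A) e.
  under [X in _ = X -> _]eq_bigr => f _.
    under eq_bigr do rewrite mxE. over.
  under [X in _ -> _ * X = _]eq_bigr => f _.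
    under eq_bigr do rewrite !mxE. over.
  move=> <-.
  have -> : \matrix_(b, j) P j (h (s b)) *m A = row_perm s (rowsub h 1%:M).
    have PA : P^T *m A = 1%:M by rewrite /P -trmx_inv trmxK mulVmx.
    rewrite -[in RHS]PA; apply/matrixP => b j; rewrite !mxE.
    by apply: eq_bigr => c _; rewrite !mxE.
  rewrite /D {D}; move: (rowsub h 1%:M) (V *m A) => U W.
  case: n / e U W => U W; rewrite !castmx_id.
  have -> : col_mx (row_perm s U) W = row_perm (dsum_perm s 1) (col_mx U W).
    rewrite -[RHS]vsubmxK usubmx_dsum dsubmx_dsum row_perm1.
    by rewrite col_mxKu col_mxKd.
  by rewrite row_permE det_mulmx det_perm odd_dsum_perm odd_perm1 addbF mulrA
    -signr_addb addbb mul1r.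
under eq_bigr do rewrite S.
rewrite sumr_const card_Sn -[D *+ _]mulr_natl mulrA mulVf ?mul1r//.
Qed.

End Pullback.

(** * Computable wedge, contraction and Hodge star *)

Section IformOperations.
Context {R : realType} {m : nat}.
Implicit Types (k l : nat) (F G : iform).

Definition iwedge F G : iform :=
  [seq (t.1 * u.1, t.2 ++ u.2) | t <- F, u <- G].

Definition icontract (a : nat) F : iform :=
  flatten [seq [seq (if odd b then - t.1 else t.1, take b t.2 ++ drop b.+1 t.2)
    | b <- iota 0 (size t.2) & nth 0%N t.2 b == a] | t <- F].

Definition icompl (n : nat) (I : seq nat) := [seq x <- iota 0 n | x \notin I].

Definition istar n F : iform :=
  [seq (t.1 * (signed_sort (t.2 ++ icompl n t.2)).1, icompl n t.2) | t <- F].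

(** The conditions under which I followed by its complement is a permutation of all the indices,
    with sorting sign 1 or -1 (hence the test [r.1 * r.1 == 1]). *)
Definition istar_ok n k F :=
  all (fun t => let I := t.2 ++ icompl n t.2 in
    let r := signed_sort I in
    [&& size t.2 == k, size (icompl n t.2) == (n - k)%N, uniq I,
        all (ltn^~ n) I, r.1 * r.1 == 1 & r.2 == iota 0 n]) F.

Lemma wedge_ev k l F G V : homog k F ->
  wedge_form (@ev R m k F) (@ev R m l G) V = ev (iwedge F G) V.
Proof.
move=> /allP hF; rewrite /ev wedge_sumsl /iwedge big_allpairs_dep /=.
apply: eq_big_seq => t /hF /eqP st; rewrite wedge_sumsr mulr_sumr.
by apply: eq_bigr => u _; rewrite wedge_ecov// rmorphM mulrA.
Qed.

(** Laplace expansion of the minor along its first row, where the contracted vector stands. *)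
Lemma contract_ecov k I x (W : 'M[R]_(k, m.+1)) :
  size I = k.+1 -> Defs.contract x (ecov I) W =
  \sum_(b <- iota 0 (size I)) (-1) ^+ b * x 0 (inord (nth 0%N I b)) *
     ecov (take b I ++ drop b.+1 I) W.
Proof.
move=> sI; rewrite /Defs.contract /ecov (expand_det_row _ (0 : 'I_(1 + k))).
rewrite -[X in iota _ X]subn0 -/(index_iota 0 (size I)) big_mkord sI.
apply: eq_bigr => b _; rewrite /cofactor mulrCA mulrA.
congr (_ * _ * _).
  by rewrite !mxE; case: split_ordP => j /(congr1 val) //= _; rewrite (ord1 j).
congr (\det _); apply/matrixP => i c; rewrite !mxE.
case: split_ordP => [?/(congr1 val)/=|i'/(congr1 val)/=]; first by rewrite ord1.
rewrite /bump /= !add1n => -[/val_inj <-]; congr (W i (inord _)).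
have bI : (b < size I)%N by rewrite sI.
rewrite nth_cat size_take bI /bump; case: (ltnP c b) => cb /=.
  by rewrite ?leqNgt ?cb /= ?add0n nth_take.
by rewrite ?cb nth_drop [in RHS]addSn subnKC.
Qed.

Lemma contract_ev k F x (W : 'M[R]_(k, m.+1)) : homog k.+1 F ->
  all (fun t => all (ltn^~ m.+1) t.2) F ->
  Defs.contract x (ev F) W = \sum_(a < m.+1) x 0 a * ev (icontract a F) W.
Proof.
move=> /allP hF /allP bF; rewrite /Defs.contract /ev.
under [RHS]eq_bigr do rewrite big_flatten big_map mulr_sumr.
rewrite [RHS]exchange_big /=; apply: eq_big_seq => t tF.
have /eqP st := hF _ tF; have /allP bt := bF _ tF.
rewrite -[X in _ * X]/(Defs.contract x (ecov t.2) W) contract_ecov//.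
under [RHS]eq_bigr do rewrite big_map big_filter mulr_sumr.
rewrite [RHS](exchange_big_dep predT)//= mulr_sumr; apply: eq_big_seq => b.
rewrite mem_iota add0n => /andP[_ bs].
have btm : (nth 0%N t.2 b < m.+1)%N by apply: bt; rewrite mem_nth.
rewrite (big_pred1 (inord (nth 0%N t.2 b))) /=; last first.
  by move=> a; rewrite /= -[RHS]val_eqE /= inordK// eq_sym.
by rewrite -signr_odd; case: (odd b); rewrite ?expr0 ?expr1 ?rmorphN /=; ring.
Qed.

Lemma det_castmx_row n p (e : p = n) (M : 'M[R]_(p, n)) :
  \det (castmx (e, erefl n) M) = \det (colsub (cast_ord e) M).
Proof.
case: n / e M => M; rewrite castmx_id; congr determinant.
by apply/matrixP => i j; rewrite mxE; congr (M _ _); apply: val_inj.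
Qed.

Lemma det_ecov k l (e : (k + l = m.+1)%N) (M : 'M[R]_(k + l, m.+1)) :
  \det (castmx (e, erefl m.+1) M) = ecov (iota 0 m.+1) M.
Proof.
rewrite det_castmx_row /ecov; congr determinant.
apply/matrixP => i j; rewrite !mxE; congr (M _ _); apply: val_inj.
have jm : (j < m.+1)%N by rewrite -[X in (_ < X)%N]e ltn_ord.
by rewrite nth_iota//= inordK.
Qed.

Lemma hodge_star_ev k l (e : (k + l = m.+1)%N) g vol (A : 'M[R]_m.+1) F V :
  A \in unitmx -> (forall X Y, bilin g X Y = ((X *m A) *m (Y *m A)^T) 0 0) ->
  (forall V, vol V = \det (V *m A)) -> istar_ok m.+1 k F ->
  hodge_star e g vol (pull A (ev F)) V = ev (istar m.+1 F) (V *m A).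
Proof.
move=> uA gE volE /allP Fok.
rewrite [LHS](hodge_star_sum e g vol F (fun t => t.1%:~R)
  (fun t => pull A (ecov t.2))).
rewrite /ev big_map; apply: eq_big_seq => t /Fok /and5P[/eqP sI /eqP sJ uI bI /andP[s1 srt]].
rewrite rmorphM -mulrA; congr (_ * _).
rewrite /ecov hodge_star_frame// det_ecov.
move: (V *m A) => W; set I := t.2; set J := icompl _ _.
set s := (signed_sort (I ++ J)).1.
have sIJ : (0 + size (I ++ J))%N = (k + l)%N.
  by rewrite add0n size_cat sI sJ -e addKn.
set M := col_mx _ _.
have := @ecov_signed_sort R m _ [::] _ M sIJ.
rewrite /= (eqP srt) => IJ.
have -> : ecov (iota 0 m.+1) M = s%:~R * ecov (I ++ J) M.
  by rewrite -IJ mulrA -rmorphM /= (eqP s1) mul1r.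
congr (_ * _); rewrite /ecov.
(* With the columns ordered as I followed by its complement J, the inserted frame vectors form an
   identity block and a zero block, so only the minor of W on J survives. *)
have -> : colsub (fun b : 'I_(k + l) => inord (nth 0%N (I ++ J) b)) M =
    block_mx 1%:M 0 (colsub (fun b : 'I_k => inord (nth 0%N I b)) W)
      (colsub (fun b : 'I_l => inord (nth 0%N J b)) W).
  have key (b : 'I_k) (c : 'I_(k + l)) :
      (inord (nth 0%N I b) == inord (nth 0%N (I ++ J) c) :> 'I_m.+1) = (b == c :> nat).
    have bE : nth 0%N I b = nth 0%N (I ++ J) b by rewrite nth_cat sI ltn_ord.
    have bnd (d : nat) : (d < k + l)%N -> (nth 0%N (I ++ J) d < m.+1)%N.
      by move=> dkl; apply: (allP bI); rewrite mem_nth// -[size _]add0n sIJ.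
    rewrite -val_eqE /= bE !inordK ?bnd ?ltn_ord ?(ltn_addr _ (ltn_ord b))//.
    by rewrite nth_uniq// -[size _]add0n sIJ ?ltn_ord ?(ltn_addr _ (ltn_ord b)).
  apply/matrixP => i j; rewrite !mxE.
  case: (split_ordP i) => i' _; rewrite ?mxE.
    rewrite key; case: (split_ordP j) => j' ->; rewrite ?mxE//=.
    by rewrite [_ == _]ltn_eqF// (leq_trans (ltn_ord i'))// leq_addr.
  case: (split_ordP j) => j' ->; rewrite !mxE /= nth_cat sI.
    by rewrite ltn_ord.
  by rewrite ltnNge leq_addr /= addKn.
by rewrite det_lblock det1 mul1r.
Qed.

End IformOperations.

(** * The model SU(3)- and G2-forms in dimension 7, with index 0 for eta *)

Definition i_eta : iform := [:: (1, [:: 0%N])].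
Definition i_om : iform := [:: (1, [:: 1; 2]%N); (1, [:: 3; 4]%N); (1, [:: 5; 6]%N)].
Definition i_om2 : iform :=
  [:: (1, [:: 1; 2; 3; 4]%N); (1, [:: 1; 2; 5; 6]%N); (1, [:: 3; 4; 5; 6]%N)].
(* Real and imaginary parts of dz1 /\ dz2 /\ dz3, where
   dz1 = e1 + i e2, dz2 = e3 + i e4, dz3 = e5 + i e6 (indices from 0 to 6). *)
Definition i_re : iform := [:: (1, [:: 1; 3; 5]%N); (-1, [:: 1; 4; 6]%N);
  (-1, [:: 2; 3; 6]%N); (-1, [:: 2; 4; 5]%N)].
Definition i_im : iform := [:: (1, [:: 1; 3; 6]%N); (1, [:: 1; 4; 5]%N);
  (1, [:: 2; 3; 5]%N); (-1, [:: 2; 4; 6]%N)].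
Definition i_phi : iform := iwedge i_eta i_om ++ i_re.
Definition i_psi : iform := i_om2 ++ iscale (-1) (iwedge i_eta i_im).

Lemma i_om_om : iform_eq 4 (iwedge i_om i_om) (iscale 2 i_om2).
Proof. by vm_compute. Qed.

Lemma i_om_cube :
  iform_eq 6 (iwedge (iwedge i_om i_om) i_om) [:: (6, [:: 1; 2; 3; 4; 5; 6]%N)].
Proof. by vm_compute. Qed.

(** The product would have type (4,1) + (1,4) in three complex dimensions. Concretely, each monomial
    of [i_im] takes one index from each of the pairs 12, 34, 56, so a pair from [i_om] always
    repeats an index. *)
Lemma i_om_im : iform_eq 5 (iwedge i_om i_im) [::].
Proof. by vm_compute. Qed.

Lemma i_re_im : iform_eq 6 (iwedge i_re i_im) [:: (4, [:: 1; 2; 3; 4; 5; 6]%N)].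
Proof. by vm_compute. Qed.

Lemma i_im_re : iform_eq 6 (iwedge i_im i_re) [:: (-4, [:: 1; 2; 3; 4; 5; 6]%N)].
Proof. by vm_compute. Qed.

Lemma i_re_re : iform_eq 6 (iwedge i_re i_re) [::].
Proof. by vm_compute. Qed.

Lemma i_im_im : iform_eq 6 (iwedge i_im i_im) [::].
Proof. by vm_compute. Qed.

Lemma i_star_phi : istar_ok 7 3 i_phi && iform_eq 4 (istar 7 i_phi) i_psi.
Proof. by vm_compute. Qed.

Lemma i_star_psi : istar_ok 7 4 i_psi && iform_eq 3 (istar 7 i_psi) i_phi.
Proof. by vm_compute. Qed.

Lemma i_star_om2 : istar_ok 7 4 i_om2 &&
  iform_eq 3 (istar 7 i_om2) (iwedge i_eta i_om).
Proof. by vm_compute. Qed.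

(** The identity defining the G2 metric, on pairs of basis vectors: the standard basis is
    orthonormal for the model form. Bilinearity extends it in [ev_metric]. *)
Lemma i_metric : all (fun a => all (fun b =>
    homog 4 (iwedge (icontract a i_phi) (icontract b i_phi)) &&
    iform_eq 7 (iwedge (iwedge (icontract a i_phi) (icontract b i_phi)) i_phi)
      [:: (if a == b then 6 else 0, iota 0 7)]) (iota 0 7)) (iota 0 7).
Proof. by vm_compute. Qed.

Section G2Model.
Context {R : realType}.
Implicit Type A : 'M[R]_7.

Lemma g2_modelE (V : 'M[R]_(3, 7)) : g2_model V = ev i_phi V.
Proof.
have E i j k : e3 i j k V = ecov [:: i.-1; j.-1; k.-1]%N V.
  rewrite /e3 /ecov; congr determinant; apply/matrixP => a b; rewrite !mxE.
  by case: b => [[|[|[|]]] ?].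
by rewrite /g2_model !E /ev !big_cons big_nil /=; ring.
Qed.

Lemma ev_top c (V : 'M[R]_7) : ev [:: (c, iota 0 7)] V = c%:~R * \det V.
Proof.
rewrite /ev big_seq1 /ecov; congr (_ * \det _).
apply/matrixP => i j; rewrite mxE; congr (V i _); apply: val_inj.
by rewrite nth_iota//= inordK ?add0n.
Qed.

Lemma ev_metric (x y : 'rV[R]_7) (W : 'M[R]_7) :
  wedge_form (wedge_form (Defs.contract x (@ev R 6 3 i_phi))
    (Defs.contract y (@ev R 6 3 i_phi))) (@ev R 6 3 i_phi) W = 6%:R * (x *m y^T) 0 0 * \det W.
Proof.
have C (z : 'rV[R]_7) : Defs.contract z (@ev R 6 3 i_phi) =1
    (fun U => \sum_(a < 7) z 0 a * ev (icontract a i_phi) U).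
  by move=> U; rewrite contract_ev.
have hC (a : 'I_7) : homog 2 (icontract a i_phi).
  by case: a => [[|[|[|[|[|[|[|]]]]]]] ?].
have CC : wedge_form (Defs.contract x (@ev R 6 3 i_phi)) (Defs.contract y (@ev R 6 3 i_phi)) =1
    (fun U => \sum_(p : 'I_7 * 'I_7) (x 0 p.1 * y 0 p.2) *
       ev (iwedge (icontract p.1 i_phi) (icontract p.2 i_phi)) U).
  move=> U; rewrite (eq_wedge (C x) (C y)) wedge_sumsl.
  under eq_bigr do rewrite wedge_sumsr mulr_sumr.
  rewrite pair_big; apply: eq_bigr => p _.
  by rewrite mulrA wedge_ev.
rewrite (eq_wedge CC (fun=> erefl)) wedge_sumsl.
rewrite mxE mulr_sumr mulr_suml.
rewrite -(pair_big predT predT (fun a b => (x 0 a * y 0 b) *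
   wedge_form (@ev R 6 4 (iwedge (icontract a i_phi) (icontract b i_phi)))
     (@ev R 6 3 i_phi) W)) /=.
have mt (a b : 'I_7) : wedge_form (@ev R 6 4 (iwedge (icontract a i_phi)
    (icontract b i_phi))) (@ev R 6 3 i_phi) W = (if a == b then 6 else 0) * \det W.
  have mem (c : 'I_7) : val c \in iota 0 7 by rewrite mem_iota /=.
  have /allP/(_ _ (mem a))/allP/(_ _ (mem b))/andP[h4 h7] := i_metric.
  rewrite (@wedge_ev R 6 4 3)// (@ev_eq R 6 7 _ _ W h7) ev_top val_eqE.
  by case: ifP.
apply: eq_bigr => a _.
rewrite (bigD1 a)//= big1 ?addr0 => [|b ba].
  by rewrite mt eqxx !mxE; ring.
by rewrite mt eq_sym (negbTE ba) mul0r mulr0.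
Qed.

End G2Model.

(** * Unitary frames of a contact Calabi-Yau structure *)

Section Multilinear.
Context {R : realType} {n : nat}.

Lemma row0_col_mx k (X : 'rV[R]_n) (W : 'M[R]_(k, n)) :
  row (lshift k 0) (col_mx X W) = X.
Proof. by rewrite rowKu row_id. Qed.

Lemma row'0_col_mx k (X : 'rV[R]_n) (W : 'M[R]_(k, n)) :
  row' (lshift k 0) (col_mx X W) = W.
Proof.
apply/matrixP => i j; rewrite !mxE.
case: split_ordP => [?/(congr1 val)/=|i'/(congr1 val)/=]; first by rewrite ord1.
by rewrite /bump /= !add1n => -[/val_inj <-].
Qed.

Lemma multilinear_head k (T : 'M[R]_(1 + k, n) -> R) a b X Y W :
  multilinear T ->
  T (col_mx (a *: X + b *: Y) W) = a * T (col_mx X W) + b * T (col_mx Y W).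
Proof. by move=> Tm; apply: (Tm (lshift k 0)); rewrite ?row0_col_mx ?row'0_col_mx. Qed.

Lemma alternating_perm k (T : 'M[R]_(k, n) -> R) (a b : 'I_k) V :
  Defs.alternating T -> a != b -> T (row_perm (tperm a b) V) = - T V.
Proof.
move=> [Tm T0] ab.
(* T vanishes when both rows a and b are replaced by their sum. *)
pose U (X Y : 'rV[R]_n) : 'M[R]_(k, n) := \matrix_(i, j)
  (if i == a then X 0 j else if i == b then Y 0 j else V i j).
have Ua X Y : row a (U X Y) = X by apply/rowP => j; rewrite !mxE eqxx.
have Ub X Y : row b (U X Y) = Y.
  by apply/rowP => j; rewrite !mxE eq_sym (negbTE ab) eqxx.
have U'a X X' Y : row' a (U X Y) = row' a (U X' Y).
  by apply: row'_eqP => c ca; apply/rowP => j; rewrite !mxE (negbTE ca).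
have U'b X Y Y' : row' b (U X Y) = row' b (U X Y').
  by apply: row'_eqP => c cb; apply/rowP => j; rewrite !mxE (negbTE cb).
have Ta X X' Y : T (U (X + X') Y) = T (U X Y) + T (U X' Y).
  rewrite (Tm a _ (U X Y) (U X' Y) 1 1) ?mul1r ?Ua ?scale1r//; exact: U'a.
have Tb X Y Y' : T (U X (Y + Y')) = T (U X Y) + T (U X Y').
  rewrite (Tm b _ (U X Y) (U X Y') 1 1) ?mul1r ?Ub ?scale1r//; exact: U'b.
have TU X : T (U X X) = 0 by apply: (T0 _ a b); rewrite ?Ua ?Ub.
have := TU (row a V + row b V); rewrite Ta !Tb !TU add0r addr0.
have -> : U (row a V) (row b V) = V.
  by apply/matrixP => i j; rewrite !mxE; case: eqP => [->//|_]; case: eqP => [->|].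
have -> : U (row b V) (row a V) = row_perm (tperm a b) V.
  by apply/matrixP => i j; rewrite !mxE; case: tpermP => [->|->|/eqP/negbTE-> /eqP/negbTE->];
    rewrite ?eqxx// eq_sym (negbTE ab).
by move/eqP; rewrite addrC addr_eq0 => /eqP.
Qed.

Lemma alternating_permE k (T : 'M[R]_(k, n) -> R) (s : 'S_k) V :
  Defs.alternating T -> T (row_perm s V) = (-1) ^+ s * T V.
Proof.
move=> Ta; have [ts -> dts] := prod_tpermP s.
elim: ts dts V => [|t ts IH] /= dts V.
  by rewrite big_nil row_perm1 odd_perm1 mul1r.
case/andP: dts => d dts; rewrite big_cons row_permM.
rewrite alternating_perm ?IH//.
by rewrite odd_permM odd_tperm d signr_addb expr1 mulN1r mulNr.
Qed.

Lemma alternating_pull k (A : 'M[R]_n) (T : 'M[R]_(k, n) -> R) :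
  Defs.alternating T -> Defs.alternating (pull A T).
Proof.
move=> [Tm T0]; split=> [a U V W b c e e1 e2|V a b ab Vab].
  have rM (X : 'M[R]_(k, n)) : row' a (X *m A) = row' a X *m A.
    by apply/matrixP => i j; rewrite !mxE; apply: eq_bigr => l _; rewrite !mxE.
  apply: (Tm a); rewrite ?rM ?e1 ?e2// !row_mul e mulmxDl.
  by rewrite !scalemxAl.
by apply: (T0 _ a b) => //; rewrite !row_mul Vab.
Qed.

Lemma alternating_det_colsub k (h : 'I_k -> 'I_n) :
  Defs.alternating (fun V : 'M[R]_(k, n) => \det (colsub h V)).
Proof.
split=> [a U V W b c e e1 e2|V a b ab Vab].
  have row'_colsub (X : 'M[R]_(k, n)) : row' a (colsub h X) = colsub h (row' a X).
    by apply/matrixP => i j; rewrite !mxE.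
  apply: (determinant_multilinear (i0 := a)).
  - have /rowP h1 := e; apply/rowP => j; have := h1 (h j).
    by rewrite !mxE.
  - by rewrite !row'_colsub e1.
  by rewrite !row'_colsub e2.
apply: (determinant_alternate ab) => j; rewrite !mxE.
by have /rowP/(_ (h j)) := Vab; rewrite !mxE.
Qed.

Lemma alternatingZD k a b (S T : 'M[R]_(k, n) -> R) :
  Defs.alternating S -> Defs.alternating T -> Defs.alternating (fun V => a * S V + b * T V).
Proof.
move=> [Sm S0] [Tm T0]; split=> [i U V W c d e e1 e2|V i j ij Vij].
  by rewrite (Sm i U V W c d)// (Tm i U V W c d)//; ring.
by rewrite (S0 V i j)// (T0 V i j)// !mulr0 addr0.
Qed.

Lemma eq_alternating k (S T : 'M[R]_(k, n) -> R) :
  S =1 T -> Defs.alternating T -> Defs.alternating S.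
Proof. by move=> /funext->. Qed.

End Multilinear.

Lemma alternating_ev (R : realType) m k F : Defs.alternating (@ev R m k F).
Proof.
elim: F => [|t F IH].
  by split=> [? ? ? ? ? ? ? ? ?|? ? ? ? ?]; rewrite /ev !big_nil ?mulr0 ?addr0.
apply: (eq_alternating (T := fun V => t.1%:~R * ecov t.2 V + 1 * ev F V)).
  by move=> V; rewrite /ev big_cons mul1r.
by apply: alternatingZD => //; apply: alternating_det_colsub.
Qed.

Section InnerProduct.
Context {R : realType} {n : nat}.
Variable g : 'M[R]_(2, n) -> R.
Hypothesis gI : inner_product g.

Lemma bilinC X Y : bilin g X Y = bilin g Y X.
Proof. by case: gI. Qed.

Lemma bilinDZl a b X Y Z :
  bilin g (a *: X + b *: Y) Z = a * bilin g X Z + b * bilin g Y Z.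
Proof. by case: gI => gm _ _; rewrite /bilin multilinear_head. Qed.

Lemma bilinDl X Y Z : bilin g (X + Y) Z = bilin g X Z + bilin g Y Z.
Proof. by have := bilinDZl 1 1 X Y Z; rewrite !scale1r !mul1r. Qed.

Lemma bilinZl a X Z : bilin g (a *: X) Z = a * bilin g X Z.
Proof. by have := bilinDZl a 0 X 0 Z; rewrite !scale0r !mul0r !addr0. Qed.

Lemma bilinNl X Z : bilin g (- X) Z = - bilin g X Z.
Proof. by rewrite -scaleN1r bilinZl mulN1r. Qed.

Lemma bilin0l Z : bilin g 0 Z = 0.
Proof. by have := bilinZl 0 0 Z; rewrite scale0r mul0r. Qed.

Lemma bilinDr X Y Z : bilin g Z (X + Y) = bilin g Z X + bilin g Z Y.
Proof. by rewrite ![bilin g Z _]bilinC bilinDl. Qed.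

Lemma bilinZr a X Z : bilin g Z (a *: X) = a * bilin g Z X.
Proof. by rewrite ![bilin g Z _]bilinC bilinZl. Qed.

Lemma bilinNr X Z : bilin g Z (- X) = - bilin g Z X.
Proof. by rewrite ![bilin g Z _]bilinC bilinNl. Qed.

Lemma bilin_suml (I : Type) (r : seq I) P (F : I -> 'rV[R]_n) Z :
  bilin g (\sum_(i <- r | P i) F i) Z = \sum_(i <- r | P i) bilin g (F i) Z.
Proof. by apply: (big_morph (bilin g ^~ Z)) => [X Y|]; rewrite ?bilinDl ?bilin0l. Qed.

Lemma bilinE X Y : bilin g X Y = (X *m gram g 1%:M *m Y^T) 0 0.
Proof.
rewrite {1}[X]row_sum_delta bilin_suml mxE.
under eq_bigr do rewrite bilinZl bilinC {1}[Y]row_sum_delta bilin_suml mulr_sumr.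
rewrite exchange_big /=; apply: eq_bigr => j _; rewrite !mxE mulr_suml.
apply: eq_bigr => i _; rewrite bilinZl mxE !rowE !mulmx1 bilinC; ring.
Qed.

Lemma gramE m (E : 'M[R]_(m, n)) : gram g E = E *m gram g 1%:M *m E^T.
Proof.
apply/matrixP => a b; rewrite [LHS]mxE bilinE -!row_mul tr_row.
by rewrite [LHS]mxE !colE mulmxA -colE [LHS]mxE.
Qed.

(** Orthogonality to s amounts to fewer than n linear equations, so the kernel contains a nonzero
    vector, which positivity allows to be normalised. *)
Lemma exists_unit_orthogonal (s : seq 'rV[R]_n) : (size s < n)%N ->
  exists2 X, bilin g X X = 1 & forall Y, Y \in s -> bilin g X Y = 0.
Proof.
move=> sn; pose W : 'M[R]_(size s, n) := \matrix_(i < size s) nth 0 s i.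
pose K := kermx (gram g 1%:M *m W^T).
have /rowV0Pn[X XK X0] : K != 0.
  rewrite -mxrank_eq0 mxrank_ker -lt0n subn_gt0.
  by rewrite (leq_ltn_trans (rank_leq_col _)).
have XW Y : Y \in s -> bilin g X Y = 0.
  move=> /(nthP 0)[i si <-]; rewrite bilinE.
  have /sub_kermxP := XK; rewrite mulmxA => /matrixP/(_ 0 (Ordinal si)).
  by rewrite mxE [RHS]mxE => <-; rewrite !mxE; apply: eq_bigr => j _; rewrite !mxE.
have XX : 0 < bilin g X X by case: gI => _ _; apply.
exists ((Num.sqrt (bilin g X X))^-1 *: X) => [|Y /XW h].
  rewrite bilinZl bilinZr mulrA -expr2 exprVn sqr_sqrtr ?ltW// mulVf//.
  by rewrite gt_eqF.
by rewrite bilinZl h mulr0.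
Qed.

End InnerProduct.

(** * Complex volume forms in three complex coordinates, split into real and imaginary parts *)

Section HolomorphicVolume.
Context {R : realType} {V : lmodType R}.
(* f + i h is a 3-form which is C-linear for the complex structure J off the
   line spanned by xi. *)
Variables (f h : V -> V -> V -> R) (xi : V) (J : V -> V) (eta : V -> R).

Definition form3 (q : V -> V -> V -> R) :=
  [/\ forall x y z w, q (x + y) z w = q x z w + q y z w,
      forall a x z w, q (a *: x) z w = a * q x z w,
      forall x y z, q x y z = - q y x z,
      forall x y z, q x y z = - q x z y &
      forall y z, q xi y z = 0].

Hypotheses (ff : form3 f) (hf : form3 h).
Hypotheses (etaP : forall x, eta (x - eta x *: xi) = 0).
Hypothesis typef : forall x y z, eta x = 0 -> eta y = 0 -> eta z = 0 ->
  f (J x) y z = - h x y z.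
Hypothesis typeh : forall x y z, eta x = 0 -> eta y = 0 -> eta z = 0 ->
  h (J x) y z = f x y z.

(** The type hypotheses speak only of vectors in ker eta; as xi is in the kernel of q, the
    xi-components of the other arguments can be removed before these hypotheses are applied. *)
Lemma form3_proj q : form3 q -> forall x y z,
  q x y z = q x (y - eta y *: xi) (z - eta z *: xi).
Proof.
move=> [qD qZ q12 q23 q0] x y z.
have qP u v w : q (u - eta u *: xi) v w = q u v w.
  by rewrite qD -scaleNr qZ q0 mulr0 addr0.
by rewrite q12 -qP -q12 q23 [in LHS]q12 -qP -q12 -q23.
Qed.

Variables (X0 X1 X2 : V).
Hypotheses (e0 : eta X0 = 0) (e1 : eta X1 = 0) (e2 : eta X2 = 0).

Variables (c p0 q0 p1 q1 p2 q2 : V -> R).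
Hypothesis expand : forall x, x = c x *: xi + (p0 x *: X0 + (q0 x *: J X0 +
  (p1 x *: X1 + (q1 x *: J X1 + (p2 x *: X2 + q2 x *: J X2))))).

Lemma form3_head1 y z x :
  f x y z = p0 x * f X0 y z - q0 x * h X0 y z + p1 x * f X1 y z - q1 x * h X1 y z
    + p2 x * f X2 y z - q2 x * h X2 y z.
Proof.
have [qD qZ q12 q23 qxi] := ff.
have JX X : eta X = 0 -> f (J X) y z = - h X y z.
  by move=> eX; rewrite (form3_proj ff) typef// -(form3_proj hf).
by rewrite {1}(expand x) !qD !qZ qxi !JX//; ring.
Qed.

Lemma form3_head2 y z x :
  h x y z = p0 x * h X0 y z + q0 x * f X0 y z + p1 x * h X1 y z + q1 x * f X1 y z
    + p2 x * h X2 y z + q2 x * f X2 y z.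
Proof.
have [qD qZ q12 q23 qxi] := hf.
have JX X : eta X = 0 -> h (J X) y z = f X y z.
  by move=> eX; rewrite (form3_proj hf) typeh// -(form3_proj ff).
by rewrite {1}(expand x) !qD !qZ qxi !JX//; ring.
Qed.

Definition det3 (a b d a' b' d' a'' b'' d'' : R) : R :=
  a * (b' * d'' - d' * b'') - b * (a' * d'' - d' * a'') + d * (a' * b'' - b' * a'').

(** [re3] and [im3] are the real and imaginary parts of the complex 3 x 3 determinant in the
    coordinates z_j = p_j + i q_j. *)
Definition re3 x y z : R :=
  det3 (p0 x) (p1 x) (p2 x) (p0 y) (p1 y) (p2 y) (p0 z) (p1 z) (p2 z)
  - det3 (p0 x) (q1 x) (q2 x) (p0 y) (q1 y) (q2 y) (p0 z) (q1 z) (q2 z)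
  - det3 (q0 x) (p1 x) (q2 x) (q0 y) (p1 y) (q2 y) (q0 z) (p1 z) (q2 z)
  - det3 (q0 x) (q1 x) (p2 x) (q0 y) (q1 y) (p2 y) (q0 z) (q1 z) (p2 z).

Definition im3 x y z : R :=
  det3 (p0 x) (p1 x) (q2 x) (p0 y) (p1 y) (q2 y) (p0 z) (p1 z) (q2 z)
  + det3 (p0 x) (q1 x) (p2 x) (p0 y) (q1 y) (p2 y) (p0 z) (q1 z) (p2 z)
  + det3 (q0 x) (p1 x) (p2 x) (q0 y) (p1 y) (p2 y) (q0 z) (p1 z) (p2 z)
  - det3 (q0 x) (q1 x) (q2 x) (q0 y) (q1 y) (q2 y) (q0 z) (q1 z) (q2 z).

(** A C-linear alternating 3-form on a space of complex dimension 3 is its value on a basis times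
    the determinant: f + i h = (f + i h)(X0, X1, X2) (re3 + i im3). *)
Lemma form3_re_im x y z :
  f x y z = f X0 X1 X2 * re3 x y z - h X0 X1 X2 * im3 x y z /\
  h x y z = h X0 X1 X2 * re3 x y z + f X0 X1 X2 * im3 x y z.
Proof.
have [_ _ f12 f23 _] := ff; have [_ _ h12 h23 _] := hf.
have f2 u v w : f u v w = - (p0 v * f X0 u w - q0 v * h X0 u w + p1 v * f X1 u w
    - q1 v * h X1 u w + p2 v * f X2 u w - q2 v * h X2 u w).
  by rewrite f12 form3_head1.
have h2 u v w : h u v w = - (p0 v * h X0 u w + q0 v * f X0 u w + p1 v * h X1 u w
    + q1 v * f X1 u w + p2 v * h X2 u w + q2 v * f X2 u w).
  by rewrite h12 form3_head2.
have f3 u v w : f u v w = p0 w * f X0 u v - q0 w * h X0 u v + p1 w * f X1 u v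
    - q1 w * h X1 u v + p2 w * f X2 u v - q2 w * h X2 u v.
  by rewrite f23 f12 opprK form3_head1.
have h3 u v w : h u v w = p0 w * h X0 u v + q0 w * f X0 u v + p1 w * h X1 u v
    + q1 w * f X1 u v + p2 w * h X2 u v + q2 w * f X2 u v.
  by rewrite h23 h12 opprK form3_head2.
have z12 u w : (f u u w = 0) * (h u u w = 0).
  by have := f12 u u w; have := h12 u u w; split; lra.
have z23 u w : (f w u u = 0) * (h w u u = 0).
  by have := f23 w u u; have := h23 w u u; split; lra.
have z13 u w : (f u w u = 0) * (h u w u = 0).
  by rewrite f12 h12 !z23 oppr0.
have perm := (f12 X1 X0 X2, f23 X0 X2 X1, f12 X2 X1 X0, f23 X1 X2 X0, f12 X2 X0 X1,
  h12 X1 X0 X2, h23 X0 X2 X1, h12 X2 X1 X0, h23 X1 X2 X0, h12 X2 X0 X1).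
rewrite /re3 /im3 /det3; split.
  rewrite form3_head1 !(f2 _ y) !(h2 _ y) !(f3 _ _ z) !(h3 _ _ z).
  by rewrite !(z12, z13, z23, perm); ring.
rewrite form3_head2 !(f2 _ y) !(h2 _ y) !(f3 _ _ z) !(h3 _ _ z).
by rewrite !(z12, z13, z23, perm); ring.
Qed.

End HolomorphicVolume.

(** Entries indexed by natural numbers make differently built ordinals of equal value syntactically
    equal, so that [ring] can identify them. *)
Lemma matrix_nat (R : Type) m n (M : 'M[R]_(m.+1, n.+1)) :
  exists N : nat -> nat -> R, forall i j, M i j = N i j.
Proof. by exists (fun i j => M (inord i) (inord j)) => i j; rewrite !inord_val. Qed.

Lemma det_mx22 (R : comRingType) (M : 'M[R]_2) :
  \det M = M 0 0 * M 1 1 - M 0 1 * M 1 0.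
Proof.
rewrite (expand_det_row _ 0) !big_ord_recl big_ord0 /cofactor !det_mx11 !mxE.
have [N ME] := matrix_nat M; rewrite !ME /=.
by rewrite expr0 expr1; ring.
Qed.

Lemma det_mx33 (R : realType) (M : 'M[R]_3) :
  \det M = det3 (M 0 0) (M 0 1) (M 0 2) (M 1 0) (M 1 1) (M 1 2) (M 2 0) (M 2 1) (M 2 2).
Proof.
rewrite (expand_det_row _ 0) !big_ord_recl big_ord0 /cofactor !det_mx22 !mxE.
have [N ME] := matrix_nat M; rewrite !ME /= /bump /= /det3.
by rewrite expr0 expr1 expr2; ring.
Qed.

Section PointwiseFrame.
Context {R : realType}.

Definition su3_frame (A : 'M[R]_7) (eta : 'M[R]_(1, 7) -> R)
    (om g : 'M[R]_(2, 7) -> R) (re im : 'M[R]_(3, 7) -> R) :=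
  [/\ A \in unitmx,
      forall X Y, bilin g X Y = (X *m A *m (Y *m A)^T) 0 0,
      eta =1 pull A (ev i_eta), om =1 pull A (ev i_om) &
      re =1 pull A (ev i_re) /\ im =1 pull A (ev i_im)].

Lemma ecov1 a (X : 'rV[R]_7) : ecov [:: a] X = X 0 (inord a).
Proof. by rewrite /ecov det_mx11 mxE. Qed.

Lemma ecov2 a b (V : 'M[R]_(2, 7)) : ecov [:: a; b] V =
  V 0 (inord a) * V 1 (inord b) - V 0 (inord b) * V 1 (inord a).
Proof. by rewrite /ecov det_mx22 !mxE. Qed.

Lemma ecov3 a b c (V : 'M[R]_(3, 7)) : ecov [:: a; b; c] V =
  det3 (V 0 (inord a)) (V 0 (inord b)) (V 0 (inord c))
       (V 1 (inord a)) (V 1 (inord b)) (V 1 (inord c))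
       (V 2 (inord a)) (V 2 (inord b)) (V 2 (inord c)).
Proof. by rewrite /ecov det_mx33 !mxE. Qed.

Lemma row_col_mx2 (V : 'M[R]_(2, 7)) : V = col_mx (row 0 V) (row 1 V) :> 'M[R]_(1 + 1, 7).
Proof.
apply/matrixP => i j; rewrite mxE; case: split_ordP => k ->;
  by rewrite mxE (ord1 k); congr (V _ _); apply: val_inj.
Qed.

Definition triple (x y z : 'rV[R]_7) : 'M[R]_(3, 7) :=
  \matrix_(i < 3, j < 7) (nth 0 [:: x; y; z] i) 0 j.

Lemma col_mx_triple (x y z : 'rV[R]_7) :
  col_mx x (col_mx y z) = triple x y z :> 'M[R]_(1 + (1 + 1), 7).
Proof.
apply/matrixP => i j; rewrite !mxE; case: split_ordP => k ->.
  by rewrite (ord1 k).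
by rewrite mxE; case: split_ordP => k' ->; rewrite (ord1 k').
Qed.

Lemma triple_row (V : 'M[R]_(3, 7)) : V = triple (row 0 V) (row 1 V) (row 2 V).
Proof.
apply/matrixP => i j; rewrite !mxE.
by case: i => [[|[|[|]]] ?] //=; rewrite mxE; congr (V _ _); apply: val_inj.
Qed.

Lemma alternating_form3 (q : 'M[R]_(3, 7) -> R) (xi : 'rV[R]_7) :
  Defs.alternating q -> (forall W, Defs.contract xi q W = 0) ->
  form3 xi (fun x y z => q (triple x y z)).
Proof.
move=> qa qxi; have [qm _] := qa; split.
- move=> x y z w; have := multilinear_head 1 1 x y (col_mx z w : 'M[R]_(1+1, 7)) qm.
  by rewrite !scale1r !mul1r !col_mx_triple.
- move=> a x z w.
  have := multilinear_head a 0 x 0 (col_mx z w : 'M[R]_(1+1, 7)) qm.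
  by rewrite scale0r addr0 mul0r addr0 !col_mx_triple.
- move=> x y z; rewrite -(@alternating_perm _ _ _ _ 0 1 _ qa)//; congr q.
  apply/matrixP => i j; rewrite !mxE; case: tpermP => [->|->|]//.
  by case: i => [[|[|[|]]] ?] //= n0 n1;
    solve [case: n0; exact: val_inj | case: n1; exact: val_inj].
- move=> x y z; rewrite -(@alternating_perm _ _ _ _ 1 2 _ qa)//; congr q.
  apply/matrixP => i j; rewrite !mxE; case: tpermP => [->|->|]//.
  by case: i => [[|[|[|]]] ?] //= n0 n1;
    solve [case: n0; exact: val_inj | case: n1; exact: val_inj].
- move=> y z; have := qxi (col_mx y z : 'M[R]_(1+1, 7)).
  by rewrite /Defs.contract col_mx_triple.
Qed.
End PointwiseFrame.

Section CCYFrame.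
Context {R : realType} {M : manifold R 7} (C : contactCY M).
Context (i : atlas M) (u : 'rV[R]_7).
Hypothesis iu : chart_img i u.

Let g := sas_g C i u.
Let eta := ccy_eta C i u.
Let xi := sas_xi C i u.
Let Phi := sas_Phi C i u.
Let om := ccy_omega C i u.
Let re := fRe (ccy_Upsilon C) i u.
Let im := fIm (ccy_Upsilon C) i u.
Let gI : inner_product g.
Proof. by case: (sas_metric C) => _; apply. Qed.

Let etaDZ a b X Y : eta (a *: X + b *: Y) = a * eta X + b * eta Y.
Proof.
have [_ /(_ i u iu)[em _]] := sas_eta_form C.
by apply: (em 0); rewrite ?row_id//; apply/matrixP => -[].
Qed.
Let etaD X Y : eta (X + Y) = eta X + eta Y.
Proof. by have := etaDZ 1 1 X Y; rewrite !scale1r !mul1r. Qed.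
Let etaZ a X : eta (a *: X) = a * eta X.
Proof. by have := etaDZ a 0 X 0; rewrite scale0r !mul0r !addr0. Qed.
Let eta_xi : eta xi = 1.
Proof. by have [] := sas_reeb C iu. Qed.
Let xi_neq0 : xi != 0.
Proof.
apply/eqP => xi0; have := eta_xi; rewrite xi0 -(scale0r 0) etaZ mul0r => /eqP.
by rewrite eq_sym oner_eq0.
Qed.
Let Phi2 X : X *m Phi *m Phi = - X + eta X *: xi.
Proof. exact: sas_Phi_sqr. Qed.
Let gPhi X Y : bilin g (X *m Phi) (Y *m Phi) = bilin g X Y - eta X * eta Y.
Proof. exact: sas_compatible. Qed.
Let omE X Y : bilin om X Y = bilin g (X *m Phi) Y.
Proof. exact: sas_deta. Qed.

(** Its squared length is d eta(xi, Phi xi), which vanishes by the Reeb condition. *)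
Let xi_Phi : xi *m Phi = 0.
Proof.
apply/eqP; apply: contraT => /(let: And3 _ _ p := gI in p _).
have [_ reeb] := sas_reeb C iu.
by rewrite -omE [bilin _ _ _]reeb ltxx.
Qed.

(** Computing Phi^3 X as Phi^2 (Phi X) and as Phi (Phi^2 X) gives two values that differ by eta(Phi
    X) xi. *)
Let eta_Phi X : eta (X *m Phi) = 0.
Proof.
have := Phi2 (X *m Phi); rewrite (Phi2 X) mulmxDl -scalemxAl xi_Phi scaler0 addr0 mulNmx.
move/eqP; rewrite -subr_eq0 opprD addrA subrr sub0r oppr_eq0 scaler_eq0.
by rewrite (negbTE xi_neq0) orbF => /eqP.
Qed.

Let g_xi X : bilin g X xi = eta X.
Proof.
by have := gPhi X xi; rewrite xi_Phi (bilinC gI) (bilin0l gI) eta_xi mulr1 => /eqP;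
  rewrite eq_sym subr_eq0 => /eqP.
Qed.

Let gPhil X Y : bilin g (X *m Phi) Y = - bilin g X (Y *m Phi).
Proof.
have := gPhi (X *m Phi) Y; rewrite Phi2 eta_Phi mul0r subr0 => <-.
by rewrite (bilinDl gI) (bilinNl gI) (bilinZl gI) (bilinC gI xi) g_xi eta_Phi mulr0 addr0.
Qed.

Let re_alt : Defs.alternating re.
Proof. by have [_ ra] := ccy_Re_form C; apply: ra. Qed.
Let im_alt : Defs.alternating im.
Proof. by have [_ ra] := ccy_Im_form C; apply: ra. Qed.

Definition unitary (X0 X1 X2 : 'rV[R]_7) :=
  let X j := nth 0 [:: X0; X1; X2] j in
  forall j k, (j < 3)%N -> (k < 3)%N ->
   [/\ eta (X j) = 0, bilin g (X j) (X k) = (j == k)%:R & bilin g (X j) (X k *m Phi) = 0].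

Definition frame_rows (X0 X1 X2 : 'rV[R]_7) : 'M[R]_7 :=
  \matrix_(a, b) (nth 0 [:: xi; X0; X0 *m Phi; X1; X1 *m Phi; X2; X2 *m Phi] a) 0 b.

(** Hermitian Gram-Schmidt: each new vector is orthogonal to xi, to the previous ones and to their
    images under Phi, which is at most five conditions in dimension 7. Orthogonality of X and Phi X
    is automatic, as Phi is skew. *)
Lemma exists_unitary : exists X0 X1 X2, unitary X0 X1 X2.
Proof.
have [X0 g00 h0] := exists_unit_orthogonal gI (isT : size [:: xi] < 7)%N.
have [X1 g11 h1] := exists_unit_orthogonal gI (isT : size [:: xi; X0; X0 *m Phi] < 7)%N.
have [X2 g22 h2] := exists_unit_orthogonal gI
  (isT : size [:: xi; X0; X0 *m Phi; X1; X1 *m Phi] < 7)%N.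
exists X0, X1, X2.
have e0 : eta X0 = 0 by rewrite -g_xi h0 ?inE ?eqxx.
have e1 : eta X1 = 0 by rewrite -g_xi h1 ?inE ?eqxx.
have e2 : eta X2 = 0 by rewrite -g_xi h2 ?inE ?eqxx.
have g10 : bilin g X1 X0 = 0 by rewrite h1 ?inE ?eqxx ?orbT.
have g20 : bilin g X2 X0 = 0 by rewrite h2 ?inE ?eqxx ?orbT.
have g21 : bilin g X2 X1 = 0 by rewrite h2 ?inE ?eqxx ?orbT.
have k10 : bilin g X1 (X0 *m Phi) = 0 by rewrite h1 ?inE ?eqxx ?orbT.
have k20 : bilin g X2 (X0 *m Phi) = 0 by rewrite h2 ?inE ?eqxx ?orbT.
have k21 : bilin g X2 (X1 *m Phi) = 0 by rewrite h2 ?inE ?eqxx ?orbT.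
have kd X : bilin g X (X *m Phi) = 0.
  by have := gPhil X X; rewrite (bilinC gI); lra.
have ks X Y : bilin g X (Y *m Phi) = 0 -> bilin g Y (X *m Phi) = 0.
  by rewrite (bilinC gI) gPhil => /eqP; rewrite oppr_eq0 => /eqP.
have g01 : bilin g X0 X1 = 0 by rewrite (bilinC gI).
have g02 : bilin g X0 X2 = 0 by rewrite (bilinC gI).
have g12 : bilin g X1 X2 = 0 by rewrite (bilinC gI).
have k01 := ks _ _ k10; have k02 := ks _ _ k20; have k12 := ks _ _ k21.
by rewrite /unitary /=; case=> [|[|[|?]]] [|[|[|?]]] //= _ _; split; rewrite ?kd.
Qed.

Lemma unitary_gram X0 X1 X2 : unitary X0 X1 X2 -> gram g (frame_rows X0 X1 X2) = 1%:M.
Proof.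
move=> un; have [e0 _ _] := un 0%N 0%N isT isT.
have [e1 _ _] := un 1%N 0%N isT isT; have [e2 _ _] := un 2%N 0%N isT isT.
have gxi X : bilin g xi X = eta X by rewrite (bilinC gI) g_xi.
have nth_row (a : 'I_7) : row a (frame_rows X0 X1 X2) =
  nth 0 [:: xi; X0; X0 *m Phi; X1; X1 *m Phi; X2; X2 *m Phi] a.
  by apply/rowP => b; rewrite !mxE.
have gg j k (lj : (j < 3)%N) (lk : (k < 3)%N) : bilin g (nth 0 [:: X0; X1; X2] j)
   (nth 0 [:: X0; X1; X2] k) = (j == k)%:R by have [_ -> _] := un j k lj lk.
have kk j k (lj : (j < 3)%N) (lk : (k < 3)%N) : bilin g (nth 0 [:: X0; X1; X2] j)
   (nth 0 [:: X0; X1; X2] k *m Phi) = 0 by have [_ _ ->] := un j k lj lk.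
apply/matrixP => a b; rewrite [LHS]mxE [RHS]mxE !nth_row -val_eqE /=.
case: a => [[|[|[|[|[|[|[|]]]]]]] ?] //; case: b => [[|[|[|[|[|[|[|]]]]]]] ?] //=;
  rewrite ?gxi ?g_xi ?eta_xi ?eta_Phi ?gPhi ?eta_Phi ?e0 ?e1 ?e2 ?mul0r ?subr0//.
all: try (rewrite gPhil; apply/eqP; rewrite oppr_eq0; apply/eqP).
all: first [exact: (gg 0 0)%N | exact: (gg 0 1)%N | exact: (gg 0 2)%N |
 exact: (gg 1 0)%N | exact: (gg 1 1)%N | exact: (gg 1 2)%N |
 exact: (gg 2 0)%N | exact: (gg 2 1)%N | exact: (gg 2 2)%N |
 exact: (kk 0 0)%N | exact: (kk 0 1)%N | exact: (kk 0 2)%N |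
 exact: (kk 1 0)%N | exact: (kk 1 1)%N | exact: (kk 1 2)%N |
 exact: (kk 2 0)%N | exact: (kk 2 1)%N | exact: (kk 2 2)%N].
Qed.

Section UnitaryFrame.
Variables X0 X1 X2 : 'rV[R]_7.
Hypothesis un : unitary X0 X1 X2.
Let B := frame_rows X0 X1 X2.
Let A := invmx B.

Let BGB : B *m gram g 1%:M *m B^T = 1%:M.
Proof. by rewrite -(gramE gI) unitary_gram. Qed.

Let uB : B \in unitmx.
Proof. by have := BGB; rewrite -mulmxA => /mulmx1_unit[]. Qed.

Let row_B (a : 'I_7) : row a B =
  nth 0 [:: xi; X0; X0 *m Phi; X1; X1 *m Phi; X2; X2 *m Phi] a.
Proof. by apply/rowP => b; rewrite !mxE. Qed.

Lemma unitary_metric X Y : bilin g X Y = (X *m A *m (Y *m A)^T) 0 0.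
Proof.
rewrite (bilinE gI) -{1}(mulmxKV uB X) -{1}(mulmxKV uB Y) -/A.
by rewrite trmx_mul -!mulmxA [B *m (_ *m _)]mulmxA [in X in _ *m (_ *m X)]mulmxA
  BGB mul1mx.
Qed.

Let coordE X a : (X *m A) 0 a = bilin g X (row a B).
Proof.
rewrite unitary_metric -row_mul mulmxV// [RHS]mxE (bigD1 a)//= big1 => [|b ba].
  by rewrite 3![X in _ * X + _]mxE eqxx mulr1 addr0.
by rewrite 3![X in _ * X]mxE eq_sym (negbTE ba) mulr0.
Qed.

Let expand X : X = eta X *: xi + ((X *m A) 0 (inord 1) *: X0
  + ((X *m A) 0 (inord 2) *: (X0 *m Phi) + ((X *m A) 0 (inord 3) *: X1
  + ((X *m A) 0 (inord 4) *: (X1 *m Phi) + ((X *m A) 0 (inord 5) *: X2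
  + (X *m A) 0 (inord 6) *: (X2 *m Phi)))))).
Proof.
rewrite -{1}(mulmxKV uB X) -/A mulmx_sum_row !big_ord_recl big_ord0 addr0 !row_B /=.
rewrite [in X in X *: _ + _]coordE row_B /= g_xi.
by do ![congr (_ + _) || congr (_ *: _)]; congr ((X *m A) 0 _); apply: val_inj;
  rewrite /= inordK.
Qed.

Lemma unitary_eta : eta =1 pull A (ev i_eta).
Proof.
move=> X; rewrite /pull /ev big_seq1 /= ecov1 mul1r coordE row_B inordK//= g_xi.
Qed.

Lemma unitary_omega : om =1 pull A (ev i_om).
Proof.
move=> V; rewrite [in LHS](row_col_mx2 V) -/(bilin om _ _) omE unitary_metric.
rewrite mxE !big_ord_recl big_ord0 addr0 ![(_ ^T)%R _ _]mxE !coordE !gPhil !row_B /=.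
rewrite xi_Phi !Phi2 (bilinC gI _ 0) (bilin0l gI).
have [e0 _ _] := @un 0%N 0%N isT isT; have [e1 _ _] := @un 1%N 0%N isT isT.
have [e2 _ _] := @un 2%N 0%N isT isT; rewrite /= in e0 e1 e2.
rewrite e0 e1 e2 !scale0r !addr0 !(bilinNr gI).
rewrite /pull /ev !big_cons big_nil /= !ecov2.
have r k a : (V *m A) k a = bilin g (row k V) (row a B).
  by rewrite -coordE -row_mul [RHS]mxE.
rewrite !r !row_B !inordK//=. ring.
Qed.

Let a0 := re (triple X0 X1 X2).
Let b0 := im (triple X0 X1 X2).

(** Upsilon = (a0 + i b0) dz1 /\ dz2 /\ dz3, from the complex determinant formula with J = Phi and
    the coordinates of the unitary frame. *)
Lemma unitary_Upsilon V :
  re V = a0 * ev i_re (V *m A) - b0 * ev i_im (V *m A) /\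
  im V = b0 * ev i_re (V *m A) + a0 * ev i_im (V *m A).
Proof.
have type3 X y z : eta X = 0 -> eta y = 0 -> eta z = 0 ->
  re (triple (X *m Phi) y z) = - im (triple X y z) /\
  im (triple (X *m Phi) y z) = re (triple X y z).
  move=> eX ey ez; have := ccy_type iu (W := (col_mx y z : 'M[R]_(1 + 1, 7))) eX.
  rewrite /Defs.contract !col_mx_triple => h.
  rewrite /re /im /fRe /fIm h.
    by case: (ccy_Upsilon C i u _) => x x' /=; split; ring.
  move=> b; case: (split_ordP (b : 'I_(1 + 1))) => c ->; rewrite (ord1 c).
    by rewrite -[RHS]ey; congr (sas_eta C i u _); exact: row0_col_mx.
  rewrite -[RHS]ez; congr (sas_eta C i u _).
  by apply: etrans (rowKd _ _ _) _; rewrite row_id.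
have [e0 _ _] := @un 0%N 0%N isT isT; have [e1 _ _] := @un 1%N 0%N isT isT.
have [e2 _ _] := @un 2%N 0%N isT isT; rewrite /= in e0 e1 e2.
have trans := ccy_transverse C iu.
have ref : form3 xi (fun x y z => re (triple x y z)).
  by apply: alternating_form3 => // W; rewrite /Defs.contract /re /fRe [ccy_Upsilon _ _ _ _]trans.
have imf : form3 xi (fun x y z => im (triple x y z)).
  by apply: alternating_form3 => // W; rewrite /Defs.contract /im /fIm [ccy_Upsilon _ _ _ _]trans.
have etaP x : eta (x - eta x *: xi) = 0.
  by rewrite -scaleNr etaD etaZ eta_xi mulr1 subrr.
have := form3_re_im ref imf etaP (J := fun x => x *m Phi)
  (fun x y z ex ey ez => (type3 x y z ex ey ez).1)
  (fun x y z ex ey ez => (type3 x y z ex ey ez).2) e0 e1 e2 expand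
  (row 0 V) (row 1 V) (row 2 V).
rewrite -triple_row => -[-> ->]; rewrite -/a0 -/b0.
have r k a : (row k V *m A) 0 a = (V *m A) k a by rewrite -row_mul [LHS]mxE.
rewrite /re3 /im3 !r /ev !big_cons big_nil /= !ecov3; split; ring.
Qed.

End UnitaryFrame.
(** Multiplication of X0 by the unit complex number a + i b, with Phi in the role of i. *)
Lemma unitary_rotate a b X0 X1 X2 : a ^+ 2 + b ^+ 2 = 1 ->
  unitary X0 X1 X2 -> unitary (a *: X0 + b *: (X0 *m Phi)) X1 X2.
Proof.
move=> ab un.
have [e0 g00 k00] := un 0%N 0%N isT isT; have [_ g01 k01] := un 0%N 1%N isT isT.
have [_ g02 k02] := un 0%N 2%N isT isT; have [_ g10 k10] := un 1%N 0%N isT isT.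
have [_ g20 k20] := un 2%N 0%N isT isT.
have [e1 _ _] := un 1%N 1%N isT isT; have [e2 _ _] := un 2%N 2%N isT isT.
rewrite /= in e0 g00 k00 g01 k01 g02 k02 g10 k10 g20 k20 e1 e2.
have ed : eta (a *: X0 + b *: (X0 *m Phi)) = 0 by rewrite etaDZ e0 eta_Phi !mulr0 addr0.
have PhiE : (a *: X0 + b *: (X0 *m Phi)) *m Phi = a *: (X0 *m Phi) - b *: X0.
  by rewrite mulmxDl -!scalemxAl Phi2 e0 scale0r addr0 scalerN.
have simp := (bilinDl gI, bilinDr gI, bilinZl gI, bilinZr gI, bilinNl gI, bilinNr gI).
set Z := _ + _ in ed PhiE *.
have gZ X : eta X = 0 -> bilin g X0 X = 0 -> bilin g X0 (X *m Phi) = 0 ->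
    bilin g Z X = 0 /\ bilin g Z (X *m Phi) = 0.
  by move=> eX gX kX; rewrite /Z !simp gPhi gPhil gX kX e0; split; ring.
have [gZ1 kZ1] := gZ _ e1 g01 k01; have [gZ2 kZ2] := gZ _ e2 g02 k02.
have gX X : bilin g X Z = bilin g Z X by rewrite (bilinC gI).
have kX X : bilin g X (Z *m Phi) = - bilin g Z (X *m Phi).
  by rewrite -(bilinC gI) gPhil.
have gZZ : bilin g Z Z = 1.
  by rewrite /Z !simp gPhi gPhil g00 k00 e0 -[RHS]ab; ring.
have kZZ : bilin g Z (Z *m Phi) = 0 by have := kX Z; lra.
have [_ g11 k11] := un 1%N 1%N isT isT; have [_ g12 k12] := un 1%N 2%N isT isT.
have [_ g21 k21] := un 2%N 1%N isT isT; have [_ g22 k22] := un 2%N 2%N isT isT.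
by rewrite /unitary /=; case=> [|[|[|?]]] [|[|[|?]]] //= _ _; split;
  rewrite ?gX ?kX ?kZ1 ?kZ2 ?oppr0.
Qed.

End CCYFrame.

Section ComplexForms.
Import complex.

Lemma ImZ (R : realType) (c : R) (z : complex.complex R) :
  complex.Im (complex.real_complex R c * z) = c * complex.Im z.
Proof. by case: z => x y /=; ring. Qed.

Lemma ImD (R : realType) (y z : complex.complex R) :
  complex.Im (y + z) = complex.Im y + complex.Im z.
Proof. by case: z y => x y [x' y']. Qed.

Lemma Im_wedge (R : realType) n k l (al : 'M[R]_(k, n) -> complex.complex R)
    (be : 'M[R]_(l, n) -> complex.complex R) V :
  complex.Im (wedge_form al (fun W => complex.conjc (be W)) V) =
  wedge_form (fun W => complex.Im (al W)) (fun W => complex.Re (be W)) V -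
  wedge_form (fun W => complex.Re (al W)) (fun W => complex.Im (be W)) V.
Proof.
rewrite /wedge_form -(rmorph_nat (complex.real_complex R)) -fmorphV ImZ -mulrBr.
congr (_ * _); rewrite -sumrB (big_morph _ (@ImD R) (erefl _)).
apply: eq_bigr => s _; rewrite -(rmorph_sign (complex.real_complex R)) ImZ -mulrBr.
congr (_ * _); rewrite /tprod.
by case: (al _) => x y; case: (be _) => x' y' /=; ring.
Qed.

End ComplexForms.

Section CCYUnitFrame.
Import complex.
Context {R : realType} {M : manifold R 7} (C : contactCY M).
Context (i : atlas M) (u : 'rV[R]_7).
Hypothesis iu : chart_img i u.

(** The volume normalisation is evaluated on the six horizontal frame vectors. There omega^3 / 3! is
    1, while Re /\ Im and Im /\ Re of Upsilon are 4 |z|^2 and -4 |z|^2 with z = a + i b, so the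
    factor i/8 leaves |z|^2 on the other side. *)
Lemma unitary_modulus X0 X1 X2 : unitary C i u X0 X1 X2 ->
  fRe (ccy_Upsilon C) i u (triple X0 X1 X2) ^+ 2 +
  fIm (ccy_Upsilon C) i u (triple X0 X1 X2) ^+ 2 = 1.
Proof.
move=> un; set a := fRe _ _ _ _; set b := fIm _ _ _ _.
set B := frame_rows C i u X0 X1 X2; set A := invmx B.
have uB : B \in unitmx.
  have := unitary_gram iu un; rewrite gramE; last by case: (sas_metric C) => _; apply.
  by rewrite -mulmxA => /mulmx1_unit[].
pose V : 'M[R]_(6, 7) := rowsub (lift ord0) B.
have vol1 : @ecov R 6 6 [:: 1; 2; 3; 4; 5; 6]%N (V *m A) = 1.
  rewrite -[RHS](@det1 R 6) /ecov mul_rowsub_mx mulmxV//; congr determinant.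
  apply/matrixP => j k; rewrite !mxE; congr (_%:R).
  rewrite -!val_eqE /= inordK; last by case: k => [[|[|[|[|[|[|]]]]]] ?].
  by case: k => [[|[|[|[|[|[|]]]]]] ?].
have top c (F : iform) : iform_eq 6 F [:: (c, [:: 1; 2; 3; 4; 5; 6]%N)] ->
    @ev R 6 6 F (V *m A) = c%:~R.
  by move=> /(@ev_eq _ _ _ _ _ (V *m A)) ->; rewrite /ev big_seq1 /= vol1 mulr1.
have omV : wedge_form (wedge_form (ccy_omega C i u) (ccy_omega C i u))
    (ccy_omega C i u) V = 6%:R.
  have E := unitary_omega iu un.
  rewrite (eq_wedge (T' := pull A (ev i_om)) (S' := pull A (ev (iwedge i_om i_om)))).
  - by rewrite wedge_pull wedge_ev// (top _ _ i_om_cube).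
  - by move=> W; rewrite (eq_wedge E E) wedge_pull wedge_ev.
  - exact: E.
have YE := unitary_Upsilon iu un.
have reE : fRe (ccy_Upsilon C) i u =1 pull A (fun W =>
    \sum_(t <- [:: (a, i_re); (- b, i_im)]) t.1 * ev t.2 W).
  move=> W; rewrite (YE W).1 /pull !big_cons big_nil /= addr0 mulNr.
  by [].
have imE : fIm (ccy_Upsilon C) i u =1 pull A (fun W =>
    \sum_(t <- [:: (b, i_re); (a, i_im)]) t.1 * ev t.2 W).
  by move=> W; rewrite (YE W).2 /pull !big_cons big_nil /= addr0.
have nul F : iform_eq 6 F [::] -> @ev R 6 6 F (V *m A) = 0.
  by move=> /(@ev_eq _ _ _ _ _ (V *m A)) ->; rewrite /ev big_nil.
have w := (nul _ i_re_re, nul _ i_im_im, top _ _ i_re_im, top _ _ i_im_re).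
have reim : wedge_form (fRe (ccy_Upsilon C) i u) (fIm (ccy_Upsilon C) i u) V =
    4%:R * (a ^+ 2 + b ^+ 2).
  rewrite (eq_wedge reE imE) wedge_pull wedge_sumsl !big_cons big_nil /=.
  rewrite !wedge_sumsr !big_cons !big_nil /= !(@wedge_ev _ _ 3 3)// !w; ring.
have imre : wedge_form (fIm (ccy_Upsilon C) i u) (fRe (ccy_Upsilon C) i u) V =
    - (4%:R * (a ^+ 2 + b ^+ 2)).
  rewrite (eq_wedge imE reE) wedge_pull wedge_sumsl !big_cons big_nil /=.
  rewrite !wedge_sumsr !big_cons !big_nil /= !(@wedge_ev _ _ 3 3)// !w; ring.
have := @ccy_volume _ _ C i u iu V.
rewrite /fC /fwedge /fconj /= => /(congr1 (@complex.Re R)) /=.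
have Re_i8 (z : R[i]) : complex.Re ('i%C / 8%:R * z) = - (complex.Im z / 8%:R).
  have -> : (8%:R : R[i])^-1 = real_complex R 8%:R^-1.
    by rewrite fmorphV rmorph_nat.
  by case: z => x y /=; ring.
rewrite Re_i8 Im_wedge reim imre.
have -> : (3`!%:R^-1 *: ((ccy_omega C ∧ ccy_omega C ∧ ccy_omega C)%form)) i u V
   = 3`!%:R^-1 * 6%:R by rewrite -omV.
rewrite (_ : 3`! = 6%N)//; lra.
Qed.

Lemma exists_su3_frame : exists A : 'M[R]_7,
  su3_frame A (ccy_eta C i u) (ccy_omega C i u) (sas_g C i u)
    (fRe (ccy_Upsilon C) i u) (fIm (ccy_Upsilon C) i u).
Proof.
have [Y0 [X1 [X2 unY]]] := exists_unitary C iu.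
have ab := unitary_modulus unY.
set a := fRe _ _ _ _ in ab; set b := fIm _ _ _ _ in ab.
(* Rotation by the conjugate of the value a + i b of Upsilon: by C-linearity the new value is (a - i
   b)(a + i b) = 1. *)
have ab' : a ^+ 2 + (- b) ^+ 2 = 1 by rewrite sqrrN.
have un := unitary_rotate iu ab' unY.
set X0 := _ + _ in un.
set A := invmx (frame_rows C i u X0 X1 X2).
have gI : inner_product (sas_g C i u) by case: (sas_metric C) => _; apply.
have uA : A \in unitmx.
  have := unitary_gram iu un; rewrite gramE// -mulmxA => /mulmx1_unit[uB _].
  by rewrite unitmx_inv.
have YE := unitary_Upsilon iu unY.
have [reX imX] : fRe (ccy_Upsilon C) i u (triple X0 X1 X2) = 1 /\
    fIm (ccy_Upsilon C) i u (triple X0 X1 X2) = 0.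
  have [-> ->] := YE (triple X0 X1 X2); rewrite -/a -/b.
  set B := frame_rows C i u Y0 X1 X2.
  have uB : B \in unitmx.
    by have := unitary_gram iu unY; rewrite gramE// -mulmxA => /mulmx1_unit[].
  have rB (k : 'I_7) l : (row k B *m invmx B) 0 l = (k == l)%:R.
    by rewrite -row_mul mulmxV// !mxE.
  have Ba : Y0 = row (inord 1) B by apply/rowP => l; rewrite !mxE inordK.
  have Bb : Y0 *m sas_Phi C i u = row (inord 2) B by apply/rowP => l; rewrite [RHS]mxE [RHS]mxE inordK.
  have Bc : X1 = row (inord 3) B by apply/rowP => l; rewrite !mxE inordK.
  have Bd : X2 = row (inord 5) B by apply/rowP => l; rewrite !mxE inordK.
  have T : triple X0 X1 X2 *m invmx B = triple (a *: delta_mx 0 (inord 1)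
      + (- b) *: delta_mx 0 (inord 2)) (delta_mx 0 (inord 3)) (delta_mx 0 (inord 5)).
    apply/row_matrixP => k; rewrite row_mul.
    have rt x y z (l : 'I_3) : row l (triple x y z) = nth 0 [:: x; y; z] l.
      by apply/rowP => ?; rewrite !mxE.
    have rB' (l : 'I_7) : row l B *m invmx B = delta_mx 0 l.
      by apply/rowP => m; rewrite rB !mxE eq_sym.
    rewrite !rt; case: k => [[|[|[|]]] ?] //=; rewrite ?Bc ?Bd ?rB'//.
    by rewrite /X0 Bb Ba mulmxDl -!scalemxAl !rB'.
  rewrite T /ev !big_cons big_nil /= !ecov3 !mxE /= -!val_eqE /= !inordK//= /det3.
  split; last by ring.
  rewrite -[RHS]ab; ring.
exists A; split=> //.
- exact: unitary_metric.
- exact: unitary_eta.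
- exact: unitary_omega.
split=> V; have [h1 h2] := unitary_Upsilon iu un V.
  by rewrite h1 reX imX mul1r mul0r subr0.
by rewrite h2 reX imX mul1r mul0r add0r.
Qed.

End CCYUnitFrame.

(** * Smooth functions and the exterior derivative *)

Section SmoothFunctions.
Context {R : realType} {V : normedModType R}.
Implicit Types (U : set V) (k : nat).

(** The differential is a chosen linear map, so it is enough to exhibit the zero map, whose
    remainder vanishes near x. This makes differentiability local, as needed for fields known only
    on chart images. *)
Lemma near0_differentiable (W : normedModType R) (h : V -> W) x :
  (\forall y \near x, h y = 0) -> differentiable h x.
Proof.
move=> h0; have hx : h x = 0 := nbhs_singleton h0.
apply/diffP => /=.
apply: (@getPex _ (fun (df : {linear V -> W}) => continuous df /\
  forall y, h y = h (lim (nbhs x)) + df (y - lim (nbhs x))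
                  +o_(y \near x) (y - lim (nbhs x)))).
exists (\0%R : {linear V -> W}); split; first by move=> y; exact: cvg_cst.
move=> y; rewrite littleoE; last first.
  move=> _/posnumP[e]; near=> z.
  rewrite /= lim_id//= hx addr0 subr0.
  rewrite [X in `|X|](_ : _ = 0) ?normr0 ?mulr_ge0//.
  by near: z.
by rewrite /= addrC subrK.
Unshelve. all: by end_near. Qed.

Lemma near_eq_differentiable (W : normedModType R) (f g : V -> W) x :
  (\forall y \near x, f y = g y) -> differentiable f x -> differentiable g x.
Proof.
move=> fg df; have -> : g = f + (g - f) by rewrite addrC subrK.
apply: differentiableD df _; apply: near0_differentiable.
by apply: filterS fg => y; rewrite !fctE => ->; rewrite subrr.
Qed.

Lemma eq_Ck_on k (W : normedModType R) U (f g : V -> W) : open U ->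
  (forall x, U x -> f x = g x) -> Ck_on k U f -> Ck_on k U g.
Proof.
move=> oU; elim: k f g => [|k IH] f g fg /=.
  move=> cf x Ux; rewrite /prop_for /continuous_at -fg//.
  apply: cvg_trans (cf x Ux); apply: near_eq_cvg.
  by apply: filterS (open_nbhs_nbhs (conj oU Ux)) => y Uy; rewrite fg.
have nfg x : U x -> \forall y \near x, f y = g y.
  by move=> Ux; apply: filterS (open_nbhs_nbhs (conj oU Ux)).
move=> [df Df]; split=> [x Ux|v]; first exact: near_eq_differentiable (nfg x Ux) (df x Ux).
by apply: IH (Df v) => x Ux; apply: near_eq_derive; exact: nfg.
Qed.

Lemma Ck_onW k (W : normedModType R) U (f : V -> W) : Ck_on k.+1 U f -> Ck_on k U f.
Proof.
elim: k f => [|k IH] f /= [df Df].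
  by move=> x Ux; apply: differentiable_continuous; exact: df.
by split=> // v; apply: IH.
Qed.

Lemma Ck_on_cst k (W : normedModType R) U (c : W) : open U -> Ck_on k U (cst c : V -> W).
Proof.
move=> oU; elim: k c => [|k IH] c /=; first by move=> x _; exact: cvg_cst.
split=> [x _|v]; first exact: differentiable_cst.
by apply: (eq_Ck_on oU _ (IH 0)) => x _; rewrite derive_cst.
Qed.

Lemma Ck_onD k (W : normedModType R) U (f g : V -> W) : open U ->
  Ck_on k U f -> Ck_on k U g -> Ck_on k U (fun x => f x + g x).
Proof.
move=> oU; elim: k f g => [|k IH] f g /=.
  by move=> cf cg x Ux; apply: continuousD; [exact: cf|exact: cg].
move=> [df Df] [dg Dg]; split=> [x Ux|v].
  by apply: differentiableD; [exact: df|exact: dg].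
apply: (eq_Ck_on oU _ (IH _ _ (Df v) (Dg v))) => x Ux.
by rewrite deriveD//; apply: diff_derivable; [exact: df|exact: dg].
Qed.

Lemma Ck_onM k U (f g : V -> R^o) : open U ->
  Ck_on k U f -> Ck_on k U g -> Ck_on k U (fun x => f x * g x : R^o).
Proof.
move=> oU; elim: k f g => [|k IH] f g.
  by move=> cf cg x Ux; apply: continuousM; [exact: cf|exact: cg].
move=> Cf Cg; have [df Df] := Cf; have [dg Dg] := Cg; split=> [x Ux|v].
  by apply: differentiableM; [exact: df|exact: dg].
have := Ck_onD oU (IH _ _ (Ck_onW Cf) (Dg v)) (IH _ _ (Ck_onW Cg) (Df v)).
apply: eq_Ck_on => // x Ux.
by rewrite deriveM//; apply: diff_derivable; [exact: df|exact: dg].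
Qed.

Lemma smooth_onD (W : normedModType R) U (f g : V -> W) : open U ->
  smooth_on U f -> smooth_on U g -> smooth_on U (fun x => f x + g x).
Proof. by move=> oU sf sg k; apply: Ck_onD. Qed.

Lemma smooth_onM U (f g : V -> R^o) : open U ->
  smooth_on U f -> smooth_on U g -> smooth_on U (fun x => f x * g x : R^o).
Proof. by move=> oU sf sg k; apply: Ck_onM. Qed.

Lemma smooth_on_cst (W : normedModType R) U (c : W) : open U ->
  smooth_on U (fun=> c).
Proof. by move=> oU k; apply: Ck_on_cst. Qed.

Lemma smooth_on_sum (I : Type) (r : seq I) U (f : I -> V -> R^o) : open U ->
  (forall i, smooth_on U (f i)) ->
  smooth_on U (fun x => \sum_(i <- r) f i x : R^o).
Proof.
move=> oU sf; elim: r => [|i r IH].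
  by move=> k; apply: (eq_Ck_on oU _ (Ck_on_cst k 0 oU)) => x _; rewrite big_nil.
move=> k; apply: (eq_Ck_on oU _ (smooth_onD oU (sf i) IH k)) => x _.
by rewrite big_cons.
Qed.

Lemma smooth_onZ U (c : R) (f : V -> R^o) : open U ->
  smooth_on U f -> smooth_on U (fun x => c * f x : R^o).
Proof. by move=> oU; apply: smooth_onM => //; apply: smooth_on_cst. Qed.

Lemma smooth_on_derive (W : normedModType R) U (f : V -> W) v :
  smooth_on U f -> smooth_on U (fun x => 'D_v f x).
Proof. by move=> sf k; have [_] := sf k.+1; apply. Qed.

Lemma smooth_on_differentiable (W : normedModType R) U (f : V -> W) x :
  smooth_on U f -> U x -> differentiable f x.
Proof. by move=> /(_ 1%N) [+ _]; apply. Qed.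

Lemma smooth_on_continuous (W : normedModType R) U (f : V -> W) x :
  smooth_on U f -> U x -> {for x, continuous f}.
Proof. by move=> /(_ 0%N); apply. Qed.

End SmoothFunctions.

(** * Symmetry of second derivatives *)

Section Schwarz.
Context {R : realType} {V : normedModType R}.
Implicit Types (U : set V).

Lemma line_is_derive (f : V -> R^o) x v (s : R) : derivable f (x + s *: v) v ->
  is_derive (s : R^o) (1 : R^o) (fun s : R^o => f (x + s *: v)) ('D_v f (x + s *: v)).
Proof.
move=> df.
have E : (fun h : R => h^-1 *: (((fun s : R^o => f (x + s *: v)) \o
      shift (s : R^o)) (h *: (1 : R^o)) - f (x + s *: v))) =
   (fun h : R => h^-1 *: ((f \o shift (x + s *: v)) (h *: v) - f (x + s *: v))).
  apply/funext => h /=; congr (_ *: (f _ - _)).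
  by rewrite [h *: _]mulr1 scalerDl addrCA.
by split; rewrite /derivable /derive E.
Qed.

Lemma shift_is_derive (f : V -> R^o) (c x z : V) : derivable f (x + c) z ->
  is_derive x z (fun y => f (y + c)) ('D_z f (x + c)).
Proof.
move=> df.
have E : (fun t : R => t^-1 *: (((fun y => f (y + c)) \o shift x) (t *: z) - f (x + c))) =
    (fun t : R => t^-1 *: ((f \o shift (x + c)) (t *: z) - f (x + c))).
  by apply/funext => t /=; rewrite addrA.
by split; rewrite /derivable /derive E.
Qed.

Lemma MVT_line (f : V -> R^o) x v (h : R) : 0 < h ->
  (forall s, 0 <= s <= h -> derivable f (x + s *: v) v) ->
  exists2 s, 0 <= s <= h & f (x + h *: v) - f x = 'D_v f (x + s *: v) * h.
Proof.
move=> h0 df.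
have dF (s : R) : 0 <= s <= h -> is_derive (s : R^o) (1 : R^o)
    (fun s : R^o => f (x + s *: v)) ('D_v f (x + s *: v)).
  by move=> /df; exact: line_is_derive.
have [||s sh ] := @MVT_segment R (fun s => f (x + s *: v))
    (fun s => 'D_v f (x + s *: v)) 0 h (ltW h0).
- by move=> s; rewrite in_itv /= => /andP[/ltW s0 /ltW sh]; apply: dF; rewrite s0.
- apply: derivable_within_continuous => s; rewrite in_itv /= => sh.
  by have [] := dF s sh.
by rewrite scale0r addr0 subr0 => E; exists s.
Qed.

(** The second difference is the increment along v of F(x) = f(x + h w) - f(x); the mean value
    theorem is applied to F along v, then to the derivative of f along w. *)
Lemma mixed_difference (f : V -> R^o) U u v w (h : R) : 0 < h -> smooth_on U f ->
  (forall s t, 0 <= s <= h -> 0 <= t <= h -> U (u + s *: v + t *: w)) ->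
  exists s t, [/\ 0 <= s <= h, 0 <= t <= h &
   f (u + h *: v + h *: w) - f (u + h *: v) - (f (u + h *: w) - f u) =
   'D_w (fun x => 'D_v f x) (u + s *: v + t *: w) * h * h].
Proof.
move=> h0 sf Uh; have hh : 0 <= h <= h by rewrite lexx ltW.
have h00 : 0 <= (0 : R) <= h by rewrite lexx ltW.
have df s t : 0 <= s <= h -> 0 <= t <= h -> derivable f (u + s *: v + t *: w) v.
  by move=> sh th; apply/diff_derivable/(smooth_on_differentiable sf)/Uh.
pose F x : R^o := f (x + h *: w) - f x.
have dE x z : derivable f (x + h *: w) z -> derivable f x z ->
    is_derive x z F ('D_z f (x + h *: w) - 'D_z f x).
  move=> d1 d2; apply: is_deriveB; last exact: derivableP.
  exact: (shift_is_derive d1).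
have dF s : 0 <= s <= h -> is_derive (u + s *: v) v F
    ('D_v f (u + s *: v + h *: w) - 'D_v f (u + s *: v)).
  move=> sh; apply: dE; first exact: df.
  by have := df s 0 sh h00; rewrite scale0r addr0.
have [s sh] := MVT_line (f := F) h0 (fun s sh => @ex_derive _ _ _ _ _ _ _ (dF s sh)).
rewrite (@derive_val _ _ _ _ _ _ _ (dF s sh)) {1 2}/F => E.
have sD := smooth_on_derive v sf.
have [t th E'] := MVT_line (f := fun x => 'D_v f x) (x := u + s *: v) (v := w) h0
  (fun t th => diff_derivable (smooth_on_differentiable sD (Uh s t sh th))).
by exists s, t; split=> //; rewrite E E'.
Qed.

Theorem derive_sym (f : V -> R^o) U u v w : open U -> smooth_on U f -> U u ->
  'D_v (fun x => 'D_w f x) u = 'D_w (fun x => 'D_v f x) u.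
Proof.
move=> oU sf Uu; apply/eqP; rewrite -subr_eq0 -normr_le0; apply/ler_addgt0Pl => e e0; rewrite addr0.
pose A x := 'D_v (fun y => 'D_w f y) x; pose B x := 'D_w (fun y => 'D_v f y) x.
have cA : A x @[x --> u] --> A u.
  by apply: (smooth_on_continuous (smooth_on_derive v (smooth_on_derive w sf))).
have cB : B x @[x --> u] --> B u.
  by apply: (smooth_on_continuous (smooth_on_derive w (smooth_on_derive v sf))).
have e2 : 0 < e / 2 by rewrite divr_gt0.
have nA : \forall x \near u, `|A u - A x| < e / 2.
  by move/cvgrPdist_lt : cA; apply.
have nB : \forall x \near u, `|B u - B x| < e / 2.
  by move/cvgrPdist_lt : cB; apply.
have /nbhs_ballP[r /= r0 ur] :
    nbhs u (U `&` ([set x | `|A u - A x| < e / 2] `&` [set x | `|B u - B x| < e / 2])).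
  exact: filterI (open_nbhs_nbhs (conj oU Uu)) (filterI nA nB).
(* The whole parallelogram spanned by h v and h w at u stays in the ball of radius r; the 1 keeps
   the denominator positive when v = w = 0. *)
pose h := r / (`|v| + `|w| + 1).
have d0 : 0 < `|v| + `|w| + 1 by rewrite ltr_wpDl// addr_ge0.
have h0 : 0 < h by rewrite divr_gt0.
have box s t : 0 <= s <= h -> 0 <= t <= h -> ball u r (u + s *: v + t *: w).
  move=> /andP[s0 sh] /andP[t0 th]; rewrite -ball_normE /= -addrA opprD addrA subrr.
  rewrite sub0r normrN (le_lt_trans (ler_normD _ _))// !normrZ !ger0_norm//.
  rewrite (@le_lt_trans _ _ (h * (`|v| + `|w|)))//.
    by rewrite mulrDr lerD// ler_wpM2r.
  by rewrite /h mulrAC ltr_pdivrMr// ltr_pM2l// ltrDl.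
have [|s [t [sh th E]]] := @mixed_difference f U u v w h h0 sf.
  by move=> s t sh th; have [] := ur _ (box s t sh th).
have [|s' [t' [sh' th' E']]] := @mixed_difference f U u w v h h0 sf.
  by move=> s' t' sh' th'; rewrite addrAC; have [] := ur _ (box t' s' th' sh').
(* The second difference is symmetric in v and w, so A and B agree at two possibly different points
   near u, and continuity carries this to u. *)
have AB : A (u + s' *: w + t' *: v) = B (u + s *: v + t *: w).
  apply: (mulIf (lt0r_neq0 h0)); apply: (mulIf (lt0r_neq0 h0)).
  have swap (a b c d : R) : a - b - (c - d) = a - c - (b - d) by ring.
  rewrite -[LHS]E' -[RHS]E [u + h *: w + h *: v]addrAC; exact: swap.
have [_ [a1 _]] := ur _ (box t' s' th' sh'); rewrite /= [u + _ + _]addrAC AB in a1.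
have [_ [_ /= b1]] := ur _ (box s t sh th).
rewrite -/(A u) -/(B u).
move: (A u) (B u) (B _) a1 b1 {AB E E'} => x y z xz yz.
rewrite (le_trans (ler_distD z _ _))// [`|z - y|]distrC.
by rewrite (splitr e) lerD// ltW.
Qed.

End Schwarz.

(** * The exterior derivative as an antisymmetrised derivative *)

Section ExteriorDerivative.
Context {R : realType} {n : nat}.
Notation E := 'rV[R]_n.
Implicit Types (k l : nat) (U : set E).

(** The permutation behaviour of an alternating form, which passes directly from T to [dform T]. *)
Definition antisym k (T : 'M[R]_(k, n) -> R) :=
  forall (s : 'S_k) W, T (row_perm s W) = (-1) ^+ s * T W.

Lemma alternating_antisym k (T : 'M[R]_(k, n) -> R) :
  Defs.alternating T -> antisym T.
Proof. by move=> Ta s W; apply: alternating_permE. Qed.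

Lemma sum_perm_lift (A : nmodType) k (F : 'S_k.+1 -> A) :
  \sum_s F s = \sum_a \sum_s F (lift_perm ord0 a s).
Proof.
rewrite pair_big; apply: (reindex (fun p => lift_perm ord0 p.1 p.2)).
apply: onW_bij; apply: inj_card_bij => [[a s] [b t] /= st|].
  have ab : a = b by rewrite -(lift_perm_id ord0 a s) st lift_perm_id.
  rewrite ab in st *; congr pair; apply/permP => c.
  by apply: (@lift_inj _ b); rewrite -!(lift_perm_lift ord0) st.
by rewrite card_prod card_ord !card_Sn factS.
Qed.

(** A permutation is the image a of 0 together with a permutation s of the rest. Its sign is (-1)^a
    times that of s, the latter cancels against the antisymmetry of P, and k! equal terms remain for
    each a. *)
Lemma alt_head k (P : E -> 'M[R]_(k, n) -> R) (V : 'M[R]_(1 + k, n)) :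
  (forall x, antisym (P x)) ->
  alt (fun W : 'M[R]_(1 + k, n) => P (usubmx W) (dsubmx W)) V =
  k`!%:R * \sum_(a < k.+1) (-1) ^+ a * P (row a V) (row' a V).
Proof.
move=> Pa; rewrite /alt sum_perm_lift mulr_sumr; apply: eq_bigr => a _.
under eq_bigr => s _.
  rewrite odd_lift_perm /= [usubmx _](_ : _ = row a V); last first.
    apply/rowP => j; rewrite !mxE; congr (V _ j).
    by rewrite -[RHS](lift_perm_id ord0 a s); congr (lift_perm _ _ _ _); apply: val_inj.
  rewrite [dsubmx _](_ : _ = row_perm s (row' a V)); last first.
    apply/matrixP => b j; rewrite !mxE; congr (V _ j).
    by rewrite -(lift_perm_lift ord0); congr (lift_perm _ _ _ _); apply: val_inj.
  rewrite Pa mulrA signr_addb -mulrA -[_ * (_ * P _ _)]mulrA.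
  rewrite [X in _ * X]mulrA -signr_addb addbb mul1r signr_odd.
  over.
by rewrite sumr_const card_Sn mulr_natl.
Qed.

Definition dform k (T : E -> 'M[R]_(k, n) -> R) : E -> 'M[R]_(k.+1, n) -> R :=
  fun u V => \sum_(a < k.+1)
    (-1) ^+ a * 'D_(row a V) (fun w => T w (row' a V) : R^o) u.

(* d T is the antisymmetrisation of pder T up to k!, see dform_alt; this turns
   d d = 0 into the symmetry of second derivatives. *)
Definition pder k (T : E -> 'M[R]_(k, n) -> R) : E -> 'M[R]_(1 + k, n) -> R :=
  fun u W => 'D_(usubmx W) (fun w => T w (dsubmx W) : R^o) u.

Lemma derive_near U (f g : E -> R^o) u v : open U -> U u ->
  (forall x, U x -> f x = g x) -> 'D_v f u = 'D_v g u.
Proof.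
move=> oU Uu fg; apply: near_eq_derive.
by apply: filterS (open_nbhs_nbhs (conj oU Uu)).
Qed.

Lemma eq_dform k U (S T : E -> 'M[R]_(k, n) -> R) u V : open U -> U u ->
  (forall x, U x -> S x =1 T x) -> dform S u V = dform T u V.
Proof.
move=> oU Uu ST; apply: eq_bigr => a _; congr (_ * _).
by apply: (derive_near _ oU Uu) => x Ux; rewrite ST.
Qed.

Lemma derive_lincomb (I : Type) (r : seq I) (c : I -> R) (f : I -> E -> R^o) u v :
  (forall i, differentiable (f i) u) ->
  'D_v (fun x => \sum_(i <- r) c i * f i x : R^o) u = \sum_(i <- r) c i * 'D_v (f i) u.
Proof.
move=> df.
suff [] : is_derive u v (fun x => \sum_(i <- r) c i * f i x : R^o)
  (\sum_(i <- r) c i * 'D_v (f i) u) by [].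
elim: r => [|i r IH].
  by under eq_fun do rewrite big_nil; rewrite big_nil; exact: is_derive_cst.
under eq_fun do rewrite big_cons; rewrite big_cons.
apply: (@is_deriveD _ _ _ (fun x => c i * f i x : R^o)) => //.
by apply: (@is_deriveZ _ _ _ (f i)); apply/derivableP/diff_derivable.
Qed.

(** Differentiating the antisymmetry of T along any direction keeps it, so [alt_head] applies to the
    partial derivatives. *)
Lemma dform_alt k U (T : E -> 'M[R]_(k, n) -> R) u V : open U -> U u ->
  (forall x, U x -> antisym (T x)) ->
  (forall W, differentiable (fun x => T x W : R^o) u) ->
  k`!%:R * dform T u V = alt (pder T u) V.
Proof.
move=> oU Uu Ta dT.
rewrite -(alt_head (P := fun x W => 'D_x (fun w => T w W : R^o) u))// => x s W.
rewrite -(derive_near (f := fun w => (-1) ^+ s * T w W) _ oU Uu); last first.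
  by move=> w Uw; rewrite Ta.
have := @derive_lincomb unit [:: tt] (fun=> (-1) ^+ s) (fun=> fun w => T w W : R^o) u x (fun=> dT W).
by under eq_fun do rewrite big_seq1; rewrite big_seq1.
Qed.

(** P antisymmetrises Q in all arguments but the first; the outer [alt] absorbs these permutations
    and leaves k! copies. *)
Lemma alt_tail k (c : R) (P Q : 'M[R]_(1 + k, n) -> R) V :
  (forall W, P W = c * \sum_(s : 'S_k) (-1) ^+ s *
     Q (row_perm (dsum_perm (1%g : 'S_1) s) W)) ->
  alt P V = c * k`!%:R * alt Q V.
Proof.
move=> pE; rewrite (eq_alt pE) altZ alt_sum -mulrA; congr (_ * _).
under eq_bigr do
  rewrite alt_row_perm odd_dsum_perm odd_perm1 addFb mulrA -signr_addb addbb mul1r.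
by rewrite sumr_const card_Sn mulr_natl.
Qed.

Lemma natrF_neq0 k : k`!%:R != 0 :> R.
Proof. by rewrite pnatr_eq0 -lt0n fact_gt0. Qed.

Lemma dform_antisym k U (T : E -> 'M[R]_(k, n) -> R) u : open U -> U u ->
  (forall x, U x -> antisym (T x)) ->
  (forall W, differentiable (fun x => T x W : R^o) u) -> antisym (dform T u).
Proof.
move=> oU Uu Ta dT s W; apply: (mulfI (natrF_neq0 k)).
by rewrite mulrCA !(dform_alt _ oU Uu)// alt_perm.
Qed.

Lemma smooth_dform k U (T : E -> 'M[R]_(k, n) -> R) V : open U ->
  (forall W, smooth_on U (fun x => T x W : R^o)) ->
  smooth_on U (fun x => dform T x V : R^o).
Proof.
move=> oU sT; apply: smooth_on_sum => // a; apply: smooth_onZ => //.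
exact: smooth_on_derive.
Qed.

Definition swap01 k : 'S_(1 + (1 + k)) := tperm (0 : 'I_k.+2) (1 : 'I_k.+2).

Lemma odd_swap01 k : swap01 k = true :> bool.
Proof. by rewrite odd_tperm. Qed.

Lemma swap01_u k (W : 'M[R]_(1 + (1 + k), n)) :
  usubmx (row_perm (swap01 k) W) = usubmx (dsubmx W).
Proof.
apply/rowP => j; rewrite !mxE; congr (W _ j); rewrite /swap01.
have -> : lshift (1 + k) 0 = ((0 : 'I_k.+2) : 'I_(1 + (1 + k))) by apply: val_inj.
by rewrite tpermL; apply: val_inj.
Qed.

Lemma swap01_du k (W : 'M[R]_(1 + (1 + k), n)) :
  usubmx (dsubmx (row_perm (swap01 k) W)) = usubmx W.
Proof.
apply/rowP => j; rewrite !mxE; congr (W _ j); rewrite /swap01.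
have -> : rshift 1 (lshift k 0) = ((1 : 'I_k.+2) : 'I_(1 + (1 + k))) by apply: val_inj.
by rewrite tpermR; apply: val_inj.
Qed.

Lemma swap01_dd k (W : 'M[R]_(1 + (1 + k), n)) :
  dsubmx (dsubmx (row_perm (swap01 k) W)) = dsubmx (dsubmx W).
Proof.
apply/matrixP => b j; rewrite !mxE; congr (W _ j); rewrite /swap01.
by rewrite tpermD// -val_eqE.
Qed.

Lemma alt_swap01_eq0 k (Q : 'M[R]_(1 + (1 + k), n) -> R) V :
  (forall W, Q (row_perm (swap01 k) W) = Q W) -> alt Q V = 0.
Proof.
move=> QE; have := alt_row_perm Q (swap01 k) V; rewrite (eq_alt QE) odd_swap01.
rewrite expr1 mulN1r => /eqP.
by rewrite -subr_eq0 opprK -mulr2n mulrn_eq0 => /eqP.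
Qed.

Theorem dformK k U (T : E -> 'M[R]_(k, n) -> R) u V : open U -> U u ->
  (forall x, U x -> antisym (T x)) ->
  (forall W, smooth_on U (fun x => T x W : R^o)) -> dform (dform T) u V = 0.
Proof.
move=> oU Uu Ta sT.
have dT W x : U x -> differentiable (fun x => T x W : R^o) x.
  exact: smooth_on_differentiable.
apply: (mulfI (natrF_neq0 k.+1)); rewrite mulr0 (dform_alt _ oU Uu); first last.
- by move=> W; apply: smooth_on_differentiable Uu; exact: (smooth_dform _ oU).
- by move=> x Ux; apply: (dform_antisym oU Ux) => // W; exact: dT.
pose Q X Y (Z : 'M[R]_(k, n)) := 'D_X (fun x => 'D_Y (fun y => T y Z : R^o) x : R^o) u.
pose QW (W : 'M[R]_(1 + (1 + k), n)) := Q (usubmx W) (usubmx (dsubmx W)) (dsubmx (dsubmx W)).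
have QC X Y Z : Q X Y Z = Q Y X Z by exact: (derive_sym _ _ oU).
have QW0 : alt QW V = 0.
  by apply: alt_swap01_eq0 => W; rewrite /QW swap01_u swap01_du swap01_dd QC.
(* The factor 1/k! comes from writing the inner [dform T] as [alt (pder T)] over k!; what remains is
   the full antisymmetrisation of the second derivatives, zero by their symmetry. *)
rewrite (@alt_tail _ k`!%:R^-1 _ QW) ?QW0 ?mulr0// => W.
rewrite /pder (derive_near (g := fun w => \sum_(s : 'S_(1 + k)) (k`!%:R^-1 * (-1) ^+ s) *
   pder T w (row_perm s (dsubmx W))) _ oU Uu); last first.
  move=> x Ux; apply: (mulfI (natrF_neq0 k)); rewrite (dform_alt _ oU Ux)//; last first.
    by move=> Z; exact: dT.
  rewrite /alt mulr_sumr; apply: eq_bigr => s _.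
  by rewrite !mulrA divff ?mul1r// natrF_neq0.
rewrite derive_lincomb ?mulr_sumr; last first.
  by move=> s; apply: smooth_on_differentiable Uu; apply: smooth_on_derive.
apply: eq_bigr => s _.
rewrite /QW usubmx_dsum dsubmx_dsum row_perm1 -mulrA.
by [].
Qed.

(** By the product rule the direction of differentiation either goes to S or has to be carried past
    the argument of S to reach T; the transposition [swap01] does the latter and yields the minus
    sign. *)
Lemma dform_wedge l U (S : E -> 'M[R]_(1, n) -> R) (T : E -> 'M[R]_(l, n) -> R) u
    (V : 'M[R]_(2 + l, n)) : open U -> U u ->
  (forall W, smooth_on U (fun x => S x W : R^o)) ->
  (forall x, U x -> antisym (T x)) ->
  (forall W, smooth_on U (fun x => T x W : R^o)) ->
  dform (fun x => wedge_form (S x) (T x)) u V =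
  wedge_form (dform S u) (T u) V - wedge_form (S u) (dform T u) V.
Proof.
move=> oU Uu sS Ta sT.
have dS W : differentiable (fun x => S x W : R^o) u.
  exact: smooth_on_differentiable (sS W) Uu.
have dT W : differentiable (fun x => T x W : R^o) u.
  exact: smooth_on_differentiable (sT W) Uu.
have Sa x : U x -> antisym (S x).
  move=> _ s W; have -> : s = 1%g by apply/permP => i; rewrite !ord1.
  by rewrite row_perm1 odd_perm1 mul1r.
have dM W : differentiable (fun x => tprod (S x) (T x) W : R^o) u.
  by apply: differentiableM.
pose Q (W : 'M[R]_(1 + (1 + l), n)) :=
  'D_(usubmx W) (fun x => tprod (S x) (T x) (dsubmx W) : R^o) u.
have QE W : Q W = tprod (pder S u) (T u) (W : 'M[R]_((1 + 1) + l, n)) +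
    tprod (S u) (pder T u) (row_perm (swap01 l) W).
  rewrite /Q /tprod /pder swap01_u swap01_du swap01_dd.
  rewrite deriveM; [|exact: diff_derivable..].
  (* The row counts (1 + 1) + l and 1 + (1 + l) are convertible; only the grouping of the rows into
     blocks differs. *)
  have -> : dsubmx (W : 'M[R]_((1 + 1) + l, n)) = dsubmx (dsubmx W).
    by apply/matrixP => b j; rewrite !mxE; congr (W _ j); apply: val_inj.
  have -> : usubmx (usubmx (W : 'M[R]_((1 + 1) + l, n))) = usubmx W.
    by apply/matrixP => b j; rewrite !mxE; congr (W _ j); apply: val_inj.
  have -> : dsubmx (usubmx (W : 'M[R]_((1 + 1) + l, n))) = usubmx (dsubmx W).
    by apply/matrixP => b j; rewrite !mxE; congr (W _ j); apply: val_inj.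
  by rewrite addrC; congr (_ + _); rewrite mulrC.
have -> : wedge_form (dform S u) (T u) V = l`!%:R^-1 * alt (tprod (pder S u) (T u)) V.
  rewrite wedge_formE.
  have dSE W : dform S u W = alt (pder S u) W.
    have := dform_alt W oU Uu Sa dS.
    by rewrite (_ : 1`! = 1%N)// mulr1n mul1r.
  have -> : alt (tprod (dform S u) (T u)) V = alt (tprod (alt (pder S u)) (T u)) V.
    by apply: eq_alt => W; rewrite /tprod dSE.
  rewrite alt_tprodl -[(1 + 1)`!]/2%N natrM invfM mulrACA.
  by rewrite mulVf ?mul1r.
have -> : wedge_form (S u) (dform T u) V = l`!%:R^-1 * alt (tprod (S u) (pder T u)) V.
  rewrite wedge_formE.
  have -> : alt (tprod (S u) (dform T u)) V =
      l`!%:R^-1 * alt (tprod (S u) (alt (pder T u))) V.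
    rewrite -altZ; apply: eq_alt => W; rewrite /tprod.
    rewrite -(dform_alt (dsubmx W) oU Uu Ta dT).
    by rewrite [RHS]mulrCA mulKf// natrF_neq0.
  rewrite (alt_tprodr (S u) (pder T u)) -[(1 + l)`!]/(l.+1`!) mul1n mulrCA.
  by rewrite mulKf// natrF_neq0.
apply: (mulfI (natrF_neq0 (1 + l))); rewrite (dform_alt _ oU Uu); first last.
- move=> W; rewrite /wedge_form.
  apply: smooth_on_differentiable Uu; apply: smooth_onZ => //.
  apply: smooth_on_sum => // s; apply: smooth_onZ => //; exact: smooth_onM.
- by move=> x Ux s W; rewrite !wedge_formE alt_perm mulrCA.
rewrite (@alt_tail _ l`!%:R^-1 _ Q).
  rewrite (eq_alt QE) altD (alt_row_perm (tprod (S u) (pder T u)) (swap01 l)).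
  by rewrite odd_swap01 expr1 mulN1r -mulrBr [RHS]mulrCA mulrA.
move=> W; rewrite /pder /wedge_form mul1n.
under eq_fun do rewrite mulr_sumr.
under eq_fun do under eq_bigr do rewrite mulrA.
rewrite derive_lincomb// mulr_sumr; apply: eq_bigr => s _; rewrite -mulrA.
by rewrite /Q usubmx_dsum dsubmx_dsum row_perm1.
Qed.

End ExteriorDerivative.

Lemma is_derive_affine (R : realType) (c t : R) :
  is_derive t 1 (fun s : R => 1 + c * s) c.
Proof.
have -> : (fun s : R => 1 + c * s) = (cst 1 + c *: id :> (R -> R)) by [].
have d1 : is_derive t 1 (c *: id : R -> R) (c *: (1 : R^o)).
  exact: (is_deriveZ c (is_derive_id t 1)).
have d2 : is_derive t 1 (cst 1 : R -> R) 0 by exact: is_derive_cst.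
have := is_deriveD d2 d1.
by rewrite add0r [c *: (1 : R^o)]mulr1.
Qed.

(** * The scaling function p *)

Section FlowParameter.
Context {R : realType}.
Variable eps : R.
Hypothesis eps_gt0 : 0 < eps.
Notation p := (ccy_p eps).
Notation T0 := (- (10%:R * eps ^+ 2)^-1).

Lemma time_gt0 (t : R) : (T0 < t) = (0 < 1 + 10%:R * eps ^+ 2 * t).
Proof.
have e0 : 0 < 10%:R * eps ^+ 2 by rewrite mulr_gt0// exprn_gt0.
rewrite -(ltr_pM2l e0) mulrN divff ?gt_eqF//.
by rewrite -subr_gt0 opprK addrC.
Qed.

Lemma p_gt0 t : T0 < t -> 0 < p t.
Proof. by rewrite time_gt0 => h; rewrite powR_gt0. Qed.

Lemma p0 : p 0 = 1.
Proof. by rewrite /ccy_p mulr0 addr0 powR1. Qed.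

Lemma p_expr10 t : T0 < t -> p t ^+ 10 = 1 + 10%:R * eps ^+ 2 * t.
Proof.
rewrite time_gt0 => /ltW h.
by rewrite -powR_mulrn ?powR_ge0// -powRrM mulVf// powRr1.
Qed.

Lemma is_derive_p t : T0 < t -> is_derive t 1 p (eps ^+ 2 * p t ^- 9).
Proof.
move=> t0; have q0 := t0; rewrite time_gt0 in q0.
have pt0 := p_gt0 t0.
have dq := is_derive_affine (10%:R * eps ^+ 2) t.
have dc := @is_derive1_comp R (fun a : R => a `^ 10%:R^-1) (fun s => 1 + 10%:R * eps ^+ 2 * s)
  t _ _ (@is_derive1_powR R (10%:R^-1) _ q0) dq.
apply: is_derive_eq dc _.
(* With q = 1 + 10 eps^2 t = p^10, the power q^(1/10 - 1) becomes p / p^10. *)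
rewrite powRB; last by rewrite (gt_eqF q0) implybT.
rewrite (powRr1 (ltW q0)) -/(p t) -(p_expr10 t0).
by field; rewrite gt_eqF.
Qed.

Lemma p_cvg0 : p t @[t --> T0^'+] --> (0 : R).
Proof.
have e0 : 0 < 10%:R * eps ^+ 2 by rewrite mulr_gt0// exprn_gt0.
apply: (cvg_comp (fun t => 1 + 10%:R * eps ^+ 2 * t) (fun a : R => a `^ 10%:R^-1));
  last exact: powR_cvg0.
move=> A [e /= e_gt0 eA]; near=> t.
have tT : 0 < 1 + 10%:R * eps ^+ 2 * t.
  by rewrite -time_gt0; near: t; exact: nbhs_right_gt.
apply: eA => //=; rewrite sub0r normrN ger0_norm ?ltW//.
rewrite -ltrBDl -ltr_pdivlMl//.
near: t; apply: nbhs_right_lt.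
by rewrite mulrBr mulr1 ltrDr mulr_gt0// invr_gt0.
Unshelve. all: by end_near. Qed.

End FlowParameter.

(** * The flow and its singularity *)

Section NaturalFields.
Context {R : realType} {n : nat} {M : manifold R n}.
Implicit Types k l : nat.

(** Smoothness and the transformation law only; the pointwise algebra of each field is read off from
    a coframe. *)
Definition natural_field k (T : tfield M R k) :=
  (forall i V, smooth_on (chart_img i) (fun u => T i u V : R^o)) /\
  forall i j u, overlap i j u -> forall V,
    T i u V = T j (transition i j u) (V *m jacobian (transition i j) u).

Lemma open_chart_img (i : atlas M) : open (chart_img i).
Proof. exact: chart_img_open. Qed.

Arguments open_chart_img : clear implicits.

Lemma overlap_img (i j : atlas M) u : overlap i j u ->
  chart_img i u /\ chart_img j (transition i j u).
Proof.
move=> [x [xi xj] <-]; split; first by exists x.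
by exists x => //; rewrite /transition chartK.
Qed.

Lemma diff_form_natural k (T : tfield M R k) : diff_form T -> natural_field T.
Proof. by move=> [[_ sT tT] _]. Qed.

Lemma natural_diff_form k (T : tfield M R k) : natural_field T ->
  (forall i u, chart_img i u -> Defs.alternating (T i u)) -> diff_form T.
Proof. by move=> [sT tT] aT; split=> //; split=> // i u /aT[]. Qed.

Lemma natural_fieldD k (S T : tfield M R k) : natural_field S -> natural_field T ->
  natural_field (S + T).
Proof.
move=> [sS tS] [sT tT]; split=> [i V|i j u ij V].
  have -> : (fun u => (S + T) i u V : R^o) = (fun u => S i u V + T i u V : R^o) by [].
  exact: (smooth_onD (open_chart_img i) (sS i V) (sT i V)).
by have := congr2 +%R (tS i j u ij V) (tT i j u ij V).
Qed.

Lemma natural_fieldZ k c (T : tfield M R k) : natural_field T ->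
  natural_field (c *: T).
Proof.
move=> [sT tT]; split=> [i V|i j u ij V].
  have -> : (fun u => (c *: T) i u V : R^o) = (fun u => c * T i u V : R^o) by [].
  exact: (smooth_onZ c (open_chart_img i) (sT i V)).
by have := congr1 ( *%R c) (tT i j u ij V).
Qed.

Lemma natural_fieldB k (S T : tfield M R k) : natural_field S -> natural_field T ->
  natural_field (S - T).
Proof.
move=> nS nT; rewrite -[- T]scaleN1r.
by apply: natural_fieldD => //; apply: natural_fieldZ.
Qed.

Lemma natural_wedge k l (S : tfield M R k) (T : tfield M R l) :
  natural_field S -> natural_field T -> natural_field (fwedge S T).
Proof.
move=> [sS tS] [sT tT]; split=> [i V|i j u ij V].
  have oi := open_chart_img i; apply: smooth_onZ => //.
  apply: smooth_on_sum => // s; apply: smooth_onZ => //.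
  exact: smooth_onM.
rewrite /fwedge -wedge_pull; apply: eq_wedge => W; rewrite /pull; [exact: tS|exact: tT].
Qed.

Lemma natural_tprod k l (S : tfield M R k) (T : tfield M R l) :
  natural_field S -> natural_field T -> natural_field (ftprod S T).
Proof.
move=> [sS tS] [sT tT]; split=> [i V|i j u ij V].
  by have oi := open_chart_img i; apply: smooth_onM.
rewrite /ftprod /tprod (tS i j u ij) (tT i j u ij).
rewrite -[V in RHS]vsubmxK mul_col_mx; congr (S j _ _ * T j _ _).
  by rewrite col_mxKu.
by rewrite col_mxKd.
Qed.

Lemma extd_dform k (T : tfield M R k) i u V : extd T i u V = dform (T i) u V.
Proof. by []. Qed.

Lemma eq_extd k (S T : tfield M R k) : eq_field S T -> eq_field (extd S) (extd T).
Proof.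
move=> ST i u iu V; rewrite !extd_dform.
by apply: (eq_dform _ (open_chart_img i) iu) => x ix W; apply: ST.
Qed.

Lemma extd_lin k c d (S T : tfield M R k) i u V : chart_img i u ->
  natural_field S -> natural_field T ->
  extd (c *: S + d *: T) i u V = c * extd S i u V + d * extd T i u V.
Proof.
move=> iu [sS _] [sT _]; rewrite /extd !mulr_sumr -big_split /=.
apply: eq_bigr => a _.
have dS := smooth_on_differentiable (sS i (row' a V)) iu.
have dT := smooth_on_differentiable (sT i (row' a V)) iu.
have -> : 'D_(row a V) (fun w => (c *: S + d *: T) i w (row' a V) : R^o) u =
    c * 'D_(row a V) (fun w => S i w (row' a V) : R^o) u +
    d * 'D_(row a V) (fun w => T i w (row' a V) : R^o) u.
  have := @derive_lincomb R n bool [:: true; false] (fun b => if b then c else d)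
    (fun b w => if b then S i w (row' a V) else T i w (row' a V)) u (row a V).
  under eq_fun do rewrite !big_cons big_nil addr0.
  by rewrite !big_cons big_nil addr0; apply=> -[].
by rewrite mulrDr !(mulrCA (_ ^+ _)).
Qed.

End NaturalFields.

Arguments open_chart_img {R n} M i.

(** * G2-structures described by an orthonormal coframe *)

Section FrameGeometry.
Context {R : realType}.

Lemma mul_tr_sym n (x y : 'rV[R]_n) : (x *m y^T) 0 0 = (y *m x^T) 0 0.
Proof. by rewrite !mxE; apply: eq_bigr => i _; rewrite !mxE mulrC. Qed.

Lemma frame_multilinear n (A : 'M[R]_n) (g : 'M[R]_(2, n) -> R) :
  (forall X Y, bilin g X Y = (X *m A *m (Y *m A)^T) 0 0) -> multilinear g.
Proof.
move=> gE; have gV V : g V = (row 0 V *m A *m (row 1 V *m A)^T) 0 0.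
  rewrite -gE /bilin; congr g; apply/matrixP => i j; rewrite [RHS]mxE.
  by case: split_ordP => k ->; rewrite mxE (ord1 k); congr (V _ _); apply: val_inj.
have BC (X Y : 'rV[R]_n) : (X *m A *m (Y *m A)^T) 0 0 = (Y *m A *m (X *m A)^T) 0 0.
  exact: mul_tr_sym.
have BD b c (X Y Z : 'rV[R]_n) : ((b *: X + c *: Y) *m A *m (Z *m A)^T) 0 0 =
    b * (X *m A *m (Z *m A)^T) 0 0 + c * (Y *m A *m (Z *m A)^T) 0 0.
  by rewrite !mulmxDl -!scalemxAl !mxE.
move=> a U V W b c e e1 e2; rewrite !gV.
have [a0|a1] : a = 0 \/ a = 1 by case: a {e e1 e2} => [[|[|]] ?] //; [left|right]; apply: val_inj.
  rewrite a0 in e e1 e2; rewrite e BD.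
  by rewrite (row'_row_eq (b := 1) e1)// (row'_row_eq (b := 1) e2).
rewrite a1 in e e1 e2; rewrite e BC BD.
by rewrite (row'_row_eq (b := 0) e1)// (row'_row_eq (b := 0) e2)// !(BC (row 0 U)).
Qed.

Lemma frame_inner_product n (A : 'M[R]_n) (g : 'M[R]_(2, n) -> R) : A \in unitmx ->
  (forall X Y, bilin g X Y = (X *m A *m (Y *m A)^T) 0 0) -> inner_product g.
Proof.
move=> uA gE; split; first exact: frame_multilinear gE.
  by move=> X Y; rewrite !gE mul_tr_sym.
move=> X X0; rewrite gE; have : X *m A != 0.
  by apply: contraNneq X0 => XA; rewrite -(mulmxK uA X) XA mul0mx.
move: (X *m A) => Y Y0; rewrite mxE.
under eq_bigr do rewrite mxE -expr2.
rewrite lt_def sumr_ge0 ?andbT; last by move=> i _; exact: sqr_ge0.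
rewrite psumr_eq0; last by move=> i _; exact: sqr_ge0.
apply: contra Y0 => /allP h; apply/eqP/rowP => i; rewrite mxE.
by have /implyP/(_ isT) := h i (mem_index_enum i); rewrite sqrf_eq0 => /eqP.
Qed.

Lemma frame_volume n (A : 'M[R]_n) (g : 'M[R]_(2, n) -> R) vol :
  (forall X Y, bilin g X Y = (X *m A *m (Y *m A)^T) 0 0) ->
  (forall V, vol V = \det (V *m A)) -> volume_form g vol.
Proof.
move=> gE volE; split.
  apply: (eq_alternating (T := pull A (fun W => \det (colsub id W)))).
    by move=> V; rewrite volE /pull; congr determinant; apply/matrixP => i j; rewrite [RHS]mxE.
  exact/alternating_pull/alternating_det_colsub.
move=> E; rewrite volE.
have -> : gram g E = (E *m A) *m (E *m A)^T.
  apply/matrixP => a b; rewrite [LHS]mxE gE -!row_mul !mxE.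
  by apply: eq_bigr => c _; rewrite !mxE.
by rewrite [RHS]det_mulmx det_tr expr2.
Qed.

Lemma bilin_frameE (A : 'M[R]_7) (X Y : 'rV[R]_7) (P : 'M[R]_(3, 7) -> R) V :
  P =1 pull A (ev i_phi) ->
  wedge_form (wedge_form (Defs.contract X P) (Defs.contract Y P)) P V =
  6%:R * (X *m A *m (Y *m A)^T) 0 0 * \det (V *m A).
Proof.
move=> PE; rewrite -ev_metric -(wedge_pull A _ _ V); apply: eq_wedge; last exact: PE.
move=> W; rewrite [RHS]/pull -wedge_pull; apply: eq_wedge => Z;
  by rewrite /Defs.contract PE /pull -mul_col_mx.
Qed.

Lemma g2_frame (A : 'M[R]_7) (P : 'M[R]_(3, 7) -> R) g vol : A \in unitmx ->
  P =1 pull A (ev i_phi) ->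
  (forall X Y, bilin g X Y = (X *m A *m (Y *m A)^T) 0 0) ->
  (forall V, vol V = \det (V *m A)) -> g2_form P /\ g2_metric P g vol.
Proof.
move=> uA PE gE volE; split; first by exists A => // V; rewrite PE g2_modelE.
split; first exact: frame_inner_product gE.
  exact: frame_volume.
by move=> X Y V; rewrite gE volE (bilin_frameE _ _ _ PE).
Qed.

Lemma eq_hodge_star n k l (e : (k + l = n)%N) g vol (S T : 'M[R]_(k, n) -> R) :
  S =1 T -> hodge_star e g vol S =1 hodge_star e g vol T.
Proof.
by move=> ST V; rewrite /hodge_star; congr (_ * _); apply: eq_bigr => f _; rewrite ST.
Qed.

Lemma hodge_star_volZ n k l (e : (k + l = n)%N) g c vol vol' (T : 'M[R]_(k, n) -> R) V :
  (forall W, vol W = c * vol' W) ->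
  hodge_star e g vol T V = c * hodge_star e g vol' T V.
Proof.
move=> volE; rewrite /hodge_star [RHS]mulrCA; congr (_ * _); rewrite mulr_sumr.
by apply: eq_bigr => f _; rewrite volE mulrCA.
Qed.

Lemma star_frame k l (e : (k + l = 7)%N) (A : 'M[R]_7) (P : 'M[R]_(k, 7) -> R) F G g vol V :
  A \in unitmx -> (forall X Y, bilin g X Y = (X *m A *m (Y *m A)^T) 0 0) ->
  (forall V, vol V = \det (V *m A)) -> P =1 pull A (ev F) ->
  istar_ok 7 k F && iform_eq l (istar 7 F) G ->
  hodge_star e g vol P V = ev G (V *m A).
Proof.
move=> uA gE volE PE /andP[ok FG].
by rewrite (eq_hodge_star e g vol PE) (hodge_star_ev _ _ uA gE volE ok) (ev_eq _ FG).
Qed.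

Lemma ecov_zero_column k I (W : 'M[R]_(k, 7)) x : size I = k -> x \in I ->
  (forall a, W a (inord x) = 0) -> ecov I W = 0.
Proof.
move=> sI xI W0; have ik : (index x I < k)%N by rewrite -sI index_mem.
rewrite /ecov (expand_det_col _ (Ordinal ik)) big1// => a _.
by rewrite mxE /= nth_index// W0 mul0r.
Qed.

(* If al j != 0, take the 4-plane spanned by the e_k - (al k / al j) e_j, with k
   in the complement K of a line through j in the Fano plane: K is the only
   index of psi contained in K and j. *)
Lemma psi_hyperplane (al : 'rV[R]_7) : al != 0 ->
  exists2 W : 'M[R]_(4, 7), W *m al^T = 0 & @ev R 6 4 i_psi W != 0.
Proof.
move=> /eqP al0; have [j aj] : exists j, al 0 j != 0.
  apply/existsP; apply: contra_notT al0; rewrite negb_exists => /forallP h.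
  by apply/rowP => j; rewrite mxE; apply/eqP; have := h j; rewrite negbK.
have [K [sK Kj Kpsi]] : exists K : seq nat, [/\ size K = 4%N, [&& uniq K,
    all (ltn^~ 7%N) K & val j \notin K] &
  [seq t <- i_psi | all (mem (val j :: K)) t.2] = [:: (1, K)]].
  case: j {aj} => [[|[|[|[|[|[|[|]]]]]]] ?] //.
  - by exists [:: 3; 4; 5; 6]%N.
  - by exists [:: 3; 4; 5; 6]%N.
  - by exists [:: 3; 4; 5; 6]%N.
  - by exists [:: 1; 2; 5; 6]%N.
  - by exists [:: 1; 2; 5; 6]%N.
  - by exists [:: 1; 2; 3; 4]%N.
  - by exists [:: 1; 2; 3; 4]%N.
have [uK bK jK] := and3P Kj.
pose k a : 'I_7 := inord (nth 0%N K a).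
have kK (a : 'I_4) : k a = nth 0%N K a :> nat.
  by rewrite inordK//; apply: (allP bK); rewrite mem_nth// sK.
pose W : 'M[R]_(4, 7) := \matrix_(a, x)
  ((x == k a)%:R - al 0 (k a) / al 0 j * (x == j)%:R).
exists W.
  apply/matrixP => a b; rewrite !mxE.
  under eq_bigr do rewrite !mxE mulrBl.
  rewrite sumrB (bigD1 (k a))//= eqxx mul1r big1 => [|x /negbTE->]; last by rewrite mul0r.
  rewrite (bigD1 j)//= eqxx mulr1 big1 => [|x /negbTE->]; last by rewrite mulr0 mul0r.
  by rewrite (ord1 b) divfK// !addr0 subrr.
have -> : @ev R 6 4 i_psi W = 1; last exact: oner_neq0.
(* The columns of W outside K and j vanish, so only monomials with all indices in K and j can
   contribute; on the columns K the matrix W is the identity. *)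
have -> : @ev R 6 4 i_psi W = \sum_(t <- [seq t <- i_psi | all (mem (val j :: K)) t.2])
    t.1%:~R * ecov t.2 W.
  rewrite big_filter /ev (bigID (fun t => all (mem (val j :: K)) t.2)) /= [X in _ + X]big1_seq ?addr0//.
  move=> t /andP[/allPn[x xt xjK] ti]; rewrite (@ecov_zero_column _ _ _ x) ?mulr0//.
    by apply/eqP; move: t ti {xt}; apply/allP.
  have x7 : (x < 7)%N.
    have /allP/(_ _ ti)/allP/(_ _ xt) : all (fun t => all (ltn^~ 7%N) t.2) i_psi by [].
    by [].
  move: xjK; rewrite inE negb_or => /andP[xj xK] a; rewrite mxE -!val_eqE /= kK inordK//.
  rewrite (negbTE xj) mulr0 subr0; case: eqP => // xk.
  by case/negP: xK; rewrite xk; apply: mem_nth; rewrite sK.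
rewrite Kpsi big_seq1 /= mul1r /ecov -[RHS](@det1 R 4); congr determinant.
apply/matrixP => a b; rewrite !mxE -!val_eqE /=.
have -> : nat_of_ord (inord (nth 0%N K b) : 'I_7) = nth 0%N K b by exact: kK.
rewrite kK nth_uniq ?sK ?ltn_ord// eq_sym.
have -> : (nth 0%N K b == val j) = false.
  by apply: contraNF jK => /eqP <-; rewrite mem_nth// sK.
by rewrite mulr0 subr0.
Qed.

End FrameGeometry.

(** * Rescaled coframes *)

Section ScaledFrame.
Context {R : realType}.

Definition scale_mx (a b : R) : 'M[R]_7 :=
  diag_mx (\row_(j < 7) if j == 0 then a else b).

Lemma scale_mx_unit a b : a != 0 -> b != 0 -> scale_mx a b \in unitmx.
Proof.
move=> a0 b0; rewrite unitmxE det_diag unitfE prodf_seq_neq0.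
by apply/allP => j _; rewrite mxE; case: ifP.
Qed.

Lemma det_scale_mx a b : \det (scale_mx a b) = a * b ^+ 6.
Proof.
rewrite det_diag big_ord_recl mxE /=; congr (_ * _).
by rewrite (eq_bigr (fun=> b)) ?prodr_const ?card_ord// => j _; rewrite mxE.
Qed.

(** Bidegree: c factors e0 and k horizontal factors, so [scale_mx a b] multiplies such a form by a^c
    b^k. *)
Definition homog_at (c k : nat) (F : iform) := all (fun t =>
  [&& size t.2 == (c + k)%N, count_mem 0%N t.2 == c & all (ltn^~ 7%N) t.2]) F.

Lemma ecov_scale a b k I (W : 'M[R]_(k, 7)) : size I = k -> all (ltn^~ 7%N) I ->
  ecov I (W *m scale_mx a b) =
  (\prod_(x <- I) if x == 0%N then a else b) * ecov I W.
Proof.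
move=> sI /allP bI; rewrite /ecov.
have -> : colsub (fun c : 'I_k => inord (nth 0%N I c)) (W *m scale_mx a b) =
  colsub (fun c : 'I_k => inord (nth 0%N I c)) W *m
    diag_mx (\row_c if nth 0%N I c == 0%N then a else b).
  apply/matrixP => i c; rewrite !mul_mx_diag !mxE; congr (_ * _).
  by rewrite -val_eqE /= inordK//; apply: bI; rewrite mem_nth ?sI.
rewrite det_mulmx mulrC det_diag; congr (_ * _).
by rewrite (big_nth 0%N) big_mkord sI; apply: eq_bigr => c _; rewrite mxE.
Qed.

Lemma ev_scale a b c k l F (W : 'M[R]_(l, 7)) : homog_at c k F -> l = (c + k)%N ->
  ev F (W *m scale_mx a b) = a ^+ c * b ^+ k * ev F W.
Proof.
move=> /allP hF lE; rewrite /ev mulr_sumr; apply: eq_big_seq => t /hF.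
move=> /and3P[/eqP st /eqP ct bt]; rewrite ecov_scale ?st// mulrCA; congr (_ * (_ * _)).
rewrite (bigID (fun x => x == 0%N)) /=; congr (_ * _).
  rewrite (eq_bigr (fun=> a)) => [|x ->]//.
  by rewrite big_const_seq -[count _ _]/(count_mem 0%N t.2) ct -Monoid.iteropE.
rewrite (eq_bigr (fun=> b)) => [|x /negbTE->]//.
rewrite big_const_seq -Monoid.iteropE; congr (b ^+ _).
apply/eqP; rewrite -(eqn_add2l c) -{1}ct -[X in _ == X]st.
by rewrite -(count_predC (pred1 0%N)).
Qed.

Lemma ecov1_row (X : 'rV[R]_7) : ev i_eta X = X 0 0.
Proof.
by rewrite /ev big_seq1 ecov1 mul1r; congr (X 0 _); apply: val_inj; rewrite /= inordK.
Qed.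

(** Splitting off the coordinate 0 shows the shape of the flow metric, a^2 eta^2 + b^2 (g -
    eta^2). *)
Lemma mul_scale_mx a b (x y : 'rV[R]_7) :
  (x *m scale_mx a b *m (y *m scale_mx a b)^T) 0 0 =
  a ^+ 2 * (x 0 0 * y 0 0) + b ^+ 2 * ((x *m y^T) 0 0 - x 0 0 * y 0 0).
Proof.
rewrite !mxE !mul_mx_diag big_ord_recl [X in b ^+ 2 * (X - _)]big_ord_recl !mxE /=.
rewrite addrC [X in _ * (X - _)]addrC addrK mulr_sumr addrC; congr (_ + _).
  by rewrite !expr2; ring.
by apply: eq_bigr => j _; rewrite !mxE /=; ring.
Qed.

End ScaledFrame.

Section CCYFields.
Context {R : realType} {M : manifold R 7} (C : contactCY M).

Lemma natural_eta : natural_field (ccy_eta C).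
Proof. exact: diff_form_natural (sas_eta_form C). Qed.

Lemma natural_re : natural_field (fRe (ccy_Upsilon C)).
Proof. exact: diff_form_natural (ccy_Re_form C). Qed.

Lemma natural_im : natural_field (fIm (ccy_Upsilon C)).
Proof. exact: diff_form_natural (ccy_Im_form C). Qed.

Lemma natural_g : natural_field (sas_g C).
Proof. by have [[_ sT tT] _] := sas_metric C. Qed.

(* By sas_deta, d eta transforms like the 2-tensor g(Phi ., .). *)
Lemma natural_omega : natural_field (ccy_omega C).
Proof.
have [sE _] := natural_eta; split=> [i V|i j u ij V].
  exact: (smooth_dform V (open_chart_img M i) (sE i)).
have [iu ju] := overlap_img ij.
have omE k w (X Y : 'rV[R]_7) : chart_img k w -> ccy_omega C k w (col_mx X Y : 'M[R]_(1 + 1, 7)) =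
    bilin (sas_g C k w) (X *m sas_Phi C k w) Y by move=> kw; exact: sas_deta.
have [_ tg] := natural_g; have [_ tPhi] := sas_Phi_field C.
set J := jacobian (transition i j) u; set w := transition i j u.
transitivity (bilin (sas_g C i u) (row 0 V *m sas_Phi C i u) (row 1 V)).
  by rewrite -omE//; congr (ccy_omega C i u _); exact: row_col_mx2.
transitivity (bilin (sas_g C j w) (row 0 V *m sas_Phi C i u *m J) (row 1 V *m J)).
  rewrite /bilin (tg i j u ij) -/J -/w; congr (sas_g C j _ _).
  exact: (@mul_col_mx _ 1 1 7 7).
rewrite -[row 0 V *m _ *m J]mulmxA (tPhi i j u ij) mulmxA -omE//.
congr (ccy_omega C j _ _).
exact: etrans (esym (@mul_col_mx _ 1 1 7 7 _ _ J)) (congr1 (mulmx^~ J) (esym (row_col_mx2 V))).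
Qed.

Notation eta := (ccy_eta C).
Notation omega := (ccy_omega C).
Notation re := (fRe (ccy_Upsilon C)).
Notation im := (fIm (ccy_Upsilon C)).

Lemma alternating_frame k F (T : tfield M R k) i u (A : 'M[R]_7) :
  T i u =1 pull A (ev F) -> Defs.alternating (T i u).
Proof. by move=> /eq_alternating; apply; apply/alternating_pull/alternating_ev. Qed.

Lemma wedge_frame k l F G H (S : 'M[R]_(k, 7) -> R) (T : 'M[R]_(l, 7) -> R) A :
  S =1 pull A (ev F) -> T =1 pull A (ev G) -> homog k F ->
  iform_eq (k + l) (iwedge F G) H -> wedge_form S T =1 pull A (ev H).
Proof.
move=> SE TE hF E V; rewrite (eq_wedge SE TE) wedge_pull wedge_ev//.
exact: (ev_eq _ E).
Qed.


End CCYFields.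

Section Flow.
Context {R : realType} {M : manifold R 7} (C : contactCY M) (eps : R).
Hypothesis eps_gt0 : 0 < eps.
Local Open Scope form_scope.

Notation eta := (ccy_eta C).
Notation omega := (ccy_omega C).
Notation re := (fRe (ccy_Upsilon C)).
Notation im := (fIm (ccy_Upsilon C)).
Notation sol := (ccy_family C eps).
Notation p := (ccy_p eps).
Notation T0 := (- (10%:R * eps ^+ 2)^-1).

Lemma i_vol : iform_eq 7 (iwedge i_eta [:: (6, [:: 1; 2; 3; 4; 5; 6]%N)])
  [:: (6, iota 0 7)].
Proof. by vm_compute. Qed.

Lemma i_eta_om : iform_eq 3 (iwedge i_eta i_om) (iwedge i_eta i_om).
Proof. by vm_compute. Qed.

Lemma i_eta_im : iform_eq 4 (iwedge i_eta i_im) (iwedge i_eta i_im).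
Proof. by vm_compute. Qed.

Section Frame.
Variables (i : atlas M) (u : 'rV[R]_7) (A : 'M[R]_7).
Hypothesis fA : su3_frame A (eta i u) (omega i u) (sas_g C i u) (re i u) (im i u).

Lemma eta_omega_frame : (eta ∧ omega) i u =1 pull A (ev (iwedge i_eta i_om)).
Proof. by case: fA => _ _ eE oE _; apply: wedge_frame eE oE _ i_eta_om. Qed.

Lemma omega_omega_frame :
  (omega ∧ omega) i u =1 pull A (fun W => 2 * @ev R 6 4 i_om2 W).
Proof.
case: fA => _ _ _ oE _ V; rewrite /fwedge (wedge_frame oE oE _ i_om_om)//.
by rewrite /pull ev_iscale.
Qed.

Lemma eta_im_frame : (eta ∧ im) i u =1 pull A (ev (iwedge i_eta i_im)).
Proof. by case: fA => _ _ eE _ [_ iE]; apply: wedge_frame eE iE _ i_eta_im. Qed.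

Lemma omega_im_frame V : (omega ∧ im) i u V = 0.
Proof.
case: fA => _ _ _ oE [_ iE]; rewrite /fwedge (wedge_frame oE iE _ i_om_im)//.
by rewrite /pull /ev big_nil.
Qed.

Lemma volume_frame V : (eta ∧ ccy_volD C) i u V = \det (V *m A).
Proof.
case: fA => _ _ eE oE _.
have o2 := wedge_frame oE oE isT i_om_om.
have o2' : wedge_form (omega i u) (omega i u) =1 pull A (ev (iwedge i_om i_om)).
  by move=> W; rewrite (eq_wedge oE oE) wedge_pull wedge_ev.
have o3 := wedge_frame o2' oE isT i_om_cube.
have e6 := wedge_frame eE o3 isT i_vol.
have E : (eta ∧ ccy_volD C) i u V =
   1 * 3`!%:R^-1 * wedge_form (eta i u) (wedge_form (wedge_form (omega i u) (omega i u)) (omega i u)) V.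
  by rewrite -wedgeZ; apply: eq_wedge => W //; rewrite mul1r.
rewrite E [wedge_form _ _ _]e6 /pull ev_top mul1r mulrA.
by rewrite (_ : 3`! = 6%N)// mulVf ?mul1r.
Qed.

Variable t : R.
Hypothesis tT : T0 < t.
Let pt_gt0 : 0 < p t := p_gt0 eps_gt0 tT.
Let pn0 : p t != 0. Proof. by rewrite gt_eqF. Qed.
Let en0 : eps != 0. Proof. by rewrite gt_eqF. Qed.

(* The coframe (eps p^-3 e0, p e1, .., p e6), orthonormal for g_t. *)
Definition flow_mx : 'M[R]_7 := A *m scale_mx (eps * p t ^- 3) (p t).

Lemma flow_mx_unit : flow_mx \in unitmx.
Proof.
case: fA => uA _ _ _ _; rewrite unitmx_mul uA scale_mx_unit//.
by rewrite mulf_neq0// invr_neq0// expf_neq0.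
Qed.

Lemma flow_eta_omega V : (eta ∧ omega) i u V =
  eps^-1 * p t * @ev R 6 3 (iwedge i_eta i_om) (V *m flow_mx).
Proof.
rewrite eta_omega_frame /pull mulmxA (@ev_scale _ _ _ 1 2)//.
by move: (ev _ _) => x; field; rewrite pn0 en0.
Qed.

Lemma flow_omega_omega V : (omega ∧ omega) i u V =
  2 * p t ^- 4 * @ev R 6 4 i_om2 (V *m flow_mx).
Proof.
rewrite omega_omega_frame /pull mulmxA (@ev_scale _ _ _ 0 4)//.
by move: (ev _ _) => x; field; rewrite pn0.
Qed.

(** The bidegrees (1,2) and (0,3) give the coefficients eps p^-3 p^2 = eps p^-1 and p^3. Likewise
    psi gets p^4 and eps p^-3 p^3 = eps, and the volume form eps p^-3 p^6. *)
Lemma flow_phi : g2phi (sol t) i u =1 pull flow_mx (ev i_phi).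
Proof.
move=> V; rewrite /pull ev_cat.
have -> : g2phi (sol t) i u V = eps * (p t)^-1 * (eta ∧ omega) i u V + p t ^+ 3 * re i u V by [].
rewrite flow_eta_omega; congr (_ + _).
  by move: (ev _ _) => x; field; rewrite pn0 en0.
case: fA => _ _ _ _ [-> _]; rewrite /pull mulmxA (@ev_scale _ _ _ 0 3)//.
by rewrite mul1r.
Qed.

Lemma flow_psi : g2psi (sol t) i u =1 pull flow_mx (ev i_psi).
Proof.
move=> V; rewrite /pull ev_cat ev_iscale.
have -> : g2psi (sol t) i u V = 2%:R^-1 * p t ^+ 4 * (omega ∧ omega) i u V
  - eps * (eta ∧ im) i u V by [].
rewrite flow_omega_omega eta_im_frame /pull mulmxA; congr (_ + _).
  by move: (ev _ _) => x; field; rewrite pn0.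
rewrite (@ev_scale _ _ _ 1 3)//.
by move: (ev _ _) => x; rewrite rmorphN1; field; rewrite pn0.
Qed.

Lemma flow_metric X Y :
  bilin (g2g (sol t) i u) X Y = (X *m flow_mx *m (Y *m flow_mx)^T) 0 0.
Proof.
case: fA => _ gE eE _ _; rewrite !mulmxA mul_scale_mx -!ecov1_row -gE.
have -> : bilin (g2g (sol t) i u) X Y = eps ^+ 2 * p t ^- 6 * bilin ((eta ⊗ eta) i u) X Y
    + p t ^+ 2 * (bilin (sas_g C i u) X Y - bilin ((eta ⊗ eta) i u) X Y) by [].
have -> : bilin ((eta ⊗ eta) i u) X Y = eta i u X * eta i u Y.
  by rewrite /bilin /ftprod /tprod col_mxKu col_mxKd.
rewrite !eE /pull; congr (_ * _ + _).
by field; rewrite pn0.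
Qed.

Lemma flow_volume V : g2vol (sol t) i u V = \det (V *m flow_mx).
Proof.
have -> : g2vol (sol t) i u V = eps * p t ^+ 3 * (eta ∧ ccy_volD C) i u V by [].
rewrite volume_frame mulmxA [RHS]det_mulmx det_scale_mx.
by move: (\det _) => x; field; rewrite pn0.
Qed.

End Frame.
End Flow.

(** * The coflow equation *)

Section MainTheorem.
Context {R : realType} {M : manifold R 7} (C : contactCY M) (eps : R).
Hypothesis eps_gt0 : 0 < eps.
Local Open Scope form_scope.

Notation eta := (ccy_eta C).
Notation omega := (ccy_omega C).
Notation re := (fRe (ccy_Upsilon C)).
Notation im := (fIm (ccy_Upsilon C)).
Notation sol := (ccy_family C eps).
Notation p := (ccy_p eps).
Notation T0 := (- (10%:R * eps ^+ 2)^-1).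

Lemma natural_eta_omega : natural_field (eta ∧ omega).
Proof. exact: natural_wedge (natural_eta C) (natural_omega C). Qed.

Lemma natural_omega_omega : natural_field (omega ∧ omega).
Proof. exact: natural_wedge (natural_omega C) (natural_omega C). Qed.

Lemma natural_eta_im : natural_field (eta ∧ im).
Proof. exact: natural_wedge (natural_eta C) (natural_im C). Qed.

Lemma natural_phi t : natural_field (g2phi (sol t)).
Proof.
apply: natural_fieldD; apply: natural_fieldZ; [exact: natural_eta_omega|].
exact: natural_re.
Qed.

Lemma natural_psi t : natural_field (g2psi (sol t)).
Proof.
apply: natural_fieldB; apply: natural_fieldZ; [exact: natural_omega_omega|].
exact: natural_eta_im.
Qed.

Lemma flow_g2_structure t : T0 < t -> g2_structure (sol t).
Proof.
move=> tT.
have fr i u : chart_img i u -> exists2 A, A \in unitmx &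
    [/\ g2phi (sol t) i u =1 pull A (ev i_phi), g2psi (sol t) i u =1 pull A (ev i_psi),
    (forall X Y, bilin (g2g (sol t) i u) X Y = (X *m A *m (Y *m A)^T) 0 0) &
    (forall V, g2vol (sol t) i u V = \det (V *m A))].
  move=> /(exists_su3_frame C)[A fA]; exists (flow_mx eps A t).
    exact: (flow_mx_unit eps_gt0 fA tT).
  split; first exact: (flow_phi eps_gt0 fA tT).
  - exact: (flow_psi eps_gt0 fA tT).
  - exact: (flow_metric eps_gt0 fA tT).
  - exact: (flow_volume eps_gt0 fA tT).
have nE := natural_eta C; have nO := natural_omega C.
split.
- split.
  + apply: natural_diff_form (natural_phi t) _ => i u /fr[A _ [h _ _ _]].
    exact: alternating_frame h.
  + apply: natural_diff_form (natural_psi t) _ => i u /fr[A _ [_ h _ _]].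
    exact: alternating_frame h.
  + have [sg tg] : natural_field (g2g (sol t)).
      have nEE := natural_tprod nE nE.
      apply: natural_fieldD; apply: natural_fieldZ => //.
      exact: natural_fieldB (natural_g C) nEE.
    split=> [|i u /fr[A uA [_ _ h _]]]; last exact: frame_inner_product uA h.
    by split=> // i u /fr[A _ [_ _ h _]]; exact: frame_multilinear h.
  + apply: natural_diff_form => [|i u /fr[A uA [_ _ gE vE]]].
      apply: natural_fieldZ; apply: (natural_wedge nE); apply: natural_fieldZ.
      exact: natural_wedge (natural_wedge nO nO) nO.
    by have [] := frame_volume gE vE.
- by move=> i u /fr[A uA [fE _ gE vE]]; have [] := g2_frame uA fE gE vE.
- by move=> i u /fr[A uA [fE _ gE vE]]; have [] := g2_frame uA fE gE vE.
- move=> i u /fr[A uA [fE sE gE vE]] V; rewrite sE /fstar.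
  by rewrite (star_frame _ _ uA gE vE fE i_star_phi).
Qed.

Lemma diff_form_eta_omega : diff_form (eta ∧ omega).
Proof.
apply: natural_diff_form natural_eta_omega _ => i u /(exists_su3_frame C)[A fA].
exact: alternating_frame (eta_omega_frame fA).
Qed.

Lemma diff_form_omega : diff_form omega.
Proof.
apply: natural_diff_form (natural_omega C) _ => i u /(exists_su3_frame C)[A [_ _ _ oE _]].
exact: alternating_frame oE.
Qed.

Lemma extd_extd k (T : tfield M R k) : diff_form T -> extd (extd T) ≡ 0.
Proof.
move=> [[_ sT _] aT] i u iu V.
apply: (dformK _ (open_chart_img M i) iu); last exact: sT.
by move=> x ix; apply/alternating_antisym/aT.
Qed.

Lemma extd_eta_wedge k (T : tfield M R k) : diff_form T -> extd T ≡ 0 ->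
  extd (eta ∧ T) ≡ (omega ∧ T).
Proof.
move=> [[_ sT _] aT] T0 i u iu V; have [sE _] := natural_eta C.
have := @dform_wedge R 7 k (chart_img i) (eta i) (T i) u V (open_chart_img M i) iu
   (sE i) (fun x ix => alternating_antisym (aT i x ix)) (sT i).
have -> : wedge_form (eta i u) (dform (T i) u) V = 0.
  rewrite /wedge_form big1 ?mulr0// => s _; rewrite /tprod.
  by rewrite -extd_dform (T0 i u iu) !mulr0.
by rewrite subr0.
Qed.

Lemma extd_eta_omega : extd (eta ∧ omega) ≡ (omega ∧ omega).
Proof.
apply: extd_eta_wedge; first exact: diff_form_omega.
exact: extd_extd (sas_eta_form C).
Qed.

(** The product rule is available for a 1-form on the left only; here closedness follows from d d =
    0, as omega /\ omega is d(eta /\ omega). *)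
Lemma extd_omega_omega : extd (omega ∧ omega) ≡ 0.
Proof.
move=> i u iu V; rewrite -(eq_extd extd_eta_omega iu).
exact: extd_extd diff_form_eta_omega i u iu V.
Qed.

Lemma extd_eta_im : extd (eta ∧ im) ≡ 0.
Proof.
move=> i u iu V; have [_ im0] := ccy_closed C.
rewrite (extd_eta_wedge (ccy_Im_form C) im0 iu).
by have [A fA] := exists_su3_frame C iu; rewrite (omega_im_frame fA).
Qed.

Lemma flow_coclosed t : coclosed (sol t).
Proof.
move=> i u iu V.
have -> : g2psi (sol t) = (2%:R^-1 * p t ^+ 4) *: (omega ∧ omega) + (- eps) *: (eta ∧ im).
  by rewrite scaleNr.
rewrite extd_lin//; [|exact: natural_omega_omega|exact: natural_eta_im].
by rewrite extd_omega_omega// extd_eta_im// !mulr0 addr0.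
Qed.

Lemma extd_phi t : extd (g2phi (sol t)) ≡ (eps * (p t)^-1) *: (omega ∧ omega).
Proof.
move=> i u iu V; have [re0 _] := ccy_closed C.
rewrite extd_lin//; [|exact: natural_eta_omega|exact: natural_re].
by rewrite extd_eta_omega// re0// mulr0 addr0.
Qed.

(** Here * psi = phi and d phi = eps p^-1 omega /\ omega. In the flow coframe omega /\ omega is 2
    p^-4 times [i_om2], whose star [iwedge i_eta i_om] pulls back to eps p^-1 eta /\ omega; the
    product of the factors is 2 eps^2 p^-6. *)
Lemma codiff_psi t : T0 < t ->
  codiff (erefl : (4 + 3 = 7)%N) (g2g (sol t)) (g2vol (sol t)) (g2psi (sol t)) ≡
  (2 * eps ^+ 2 * p t ^- 6) *: (eta ∧ omega).
Proof.
move=> tT i u iu V.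
have star_psi : fstar (erefl : (4 + 3 = 7)%N) (g2g (sol t)) (g2vol (sol t))
    (g2psi (sol t)) ≡ g2phi (sol t).
  move=> j w jw W; have [A fA] := exists_su3_frame C jw.
  rewrite /fstar (star_frame _ _ (flow_mx_unit eps_gt0 fA tT) (flow_metric eps_gt0 fA tT)
    (flow_volume eps_gt0 fA tT) (flow_psi eps_gt0 fA tT) i_star_psi).
  by rewrite (flow_phi eps_gt0 fA tT).
have [A fA] := exists_su3_frame C iu.
have pn0 : p t != 0 by rewrite gt_eqF// p_gt0.
have en0 : eps != 0 by rewrite gt_eqF.
have sgn : (-1 : R) ^+ (7 * 3.+2 + 1) = 1 by rewrite -signr_odd.
have -> : codiff (erefl : (4 + 3 = 7)%N) (g2g (sol t)) (g2vol (sol t)) (g2psi (sol t)) i u V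
  = (-1) ^+ (7 * 3.+2 + 1) * hodge_star (codiff_dim (erefl : (3.+1 + 3 = 7)%N))
     (g2g (sol t) i u) (g2vol (sol t) i u)
     (extd (fstar (erefl : (4 + 3 = 7)%N) (g2g (sol t)) (g2vol (sol t)) (g2psi (sol t))) i u) V
  by [].
rewrite sgn mul1r.
rewrite (eq_hodge_star _ _ _ (T := fun W => eps * (p t)^-1 * (2 * p t ^- 4) *
   pull (flow_mx eps A t) (ev i_om2) W)); last first.
  move=> W; rewrite (eq_extd star_psi iu) (extd_phi t iu).
  by rewrite -mulrA -[_ * pull _ _ _](flow_omega_omega eps_gt0 fA tT).
rewrite hodge_starZ (star_frame _ _ (flow_mx_unit eps_gt0 fA tT) (flow_metric eps_gt0 fA tT)
    (flow_volume eps_gt0 fA tT) (fun=> erefl) i_star_om2).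
have -> : ((2 * eps ^+ 2 * p t ^- 6) *: (eta ∧ omega)) i u V =
  2 * eps ^+ 2 * p t ^- 6 * (eta ∧ omega) i u V by [].
rewrite (flow_eta_omega eps_gt0 fA tT).
by move: (ev _ _) => x; field; rewrite pn0 en0.
Qed.

Lemma flow_laplacian t : T0 < t ->
  g2_laplacian (sol t) (g2psi (sol t)) ≡ (2 * eps ^+ 2 * p t ^- 6) *: (omega ∧ omega).
Proof.
move=> tT i u iu V.
have star0 k l (e : (k + l = 7)%N) (S : tfield M R k) : S ≡ 0 ->
    fstar e (g2g (sol t)) (g2vol (sol t)) S ≡ 0.
  move=> S0 j w jw W; rewrite /fstar /hodge_star big1 ?mulr0// => f _.
  by rewrite (S0 j w jw) mul0r.
have extd0 k (S : tfield M R k) : S ≡ 0 -> extd S ≡ 0.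
  move=> S0 j w jw W; rewrite (eq_extd S0 jw) extd_dform /dform big1// => a _.
  by rewrite (_ : (fun=> _) = cst 0)// derive_cst mulr0.
have -> : g2_laplacian (sol t) (g2psi (sol t)) i u V =
   extd (codiff (erefl : (4 + 3 = 7)%N) (g2g (sol t)) (g2vol (sol t)) (g2psi (sol t))) i u V
   + codiff (laplacian_dim (erefl : (4 + 3 = 7)%N)) (g2g (sol t)) (g2vol (sol t))
      (extd (g2psi (sol t))) i u V by [].
rewrite (eq_extd (codiff_psi tT) iu).
have -> : codiff (laplacian_dim (erefl : (4 + 3 = 7)%N)) (g2g (sol t)) (g2vol (sol t))
      (extd (g2psi (sol t))) i u V = 0.
  have := star0 _ _ (codiff_dim (laplacian_dim (erefl : (4 + 3 = 7)%N))) _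
    (extd0 _ _ (star0 _ _ (laplacian_dim (erefl : (4 + 3 = 7)%N)) _ (flow_coclosed t))) i u iu V.
  by move=> /(congr1 (fun x => (-1) ^+ (7 * 4.+2 + 1) * x)); rewrite mulr0.
(* A zero multiple of eta /\ omega is added so that the two-term linearity lemma covers a single
   scaled form. *)
rewrite addr0 -[_ *: _ in LHS]addr0 -[0 in LHS](scale0r (eta ∧ omega)) extd_lin//.
- by rewrite mul0r addr0 extd_eta_omega.
- exact: natural_eta_omega.
- exact: natural_eta_omega.
Qed.

End MainTheorem.

(** * The backward singularity *)

Section Singularity.
Context {R : realType} {M : manifold R 7} (C : contactCY M) (eps : R).
Hypothesis eps_gt0 : 0 < eps.
Local Open Scope form_scope.

Notation eta := (ccy_eta C).
Notation omega := (ccy_omega C).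
Notation re := (fRe (ccy_Upsilon C)).
Notation im := (fIm (ccy_Upsilon C)).
Notation sol := (ccy_family C eps).
Notation p := (ccy_p eps).
Notation T0 := (- (10%:R * eps ^+ 2)^-1).

Lemma psi_is_derive t i u V : T0 < t -> chart_img i u ->
  is_derive t 1 (fun s => g2psi (sol s) i u V : R^o)
    (g2_laplacian (sol t) (g2psi (sol t)) i u V).
Proof.
move=> tT iu; rewrite (flow_laplacian C eps_gt0 tT iu).
have -> : ((2 * eps ^+ 2 * p t ^- 6) *: (omega ∧ omega)) i u V =
  2 * eps ^+ 2 * p t ^- 6 * (omega ∧ omega) i u V by [].
have -> : (fun s => g2psi (sol s) i u V : R^o) = (fun s : R =>
   2%:R^-1 * p s ^+ 4 * (omega ∧ omega) i u V - eps * (eta ∧ im) i u V) by [].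
move: ((omega ∧ omega) i u V) (eps * _) => x y.
have dp := is_derive_p eps_gt0 tT.
have pn0 : p t != 0 by rewrite gt_eqF// p_gt0.
have -> : (fun s : R => 2%:R^-1 * p s ^+ 4 * x - y) =
    (2%:R^-1 * x) *: (p ^+ 4 : R -> R) + cst (- y) :> (R -> R).
  by apply/funext => s; rewrite !fctE /=; rewrite mulrAC.
have d4 := is_deriveX 4 dp.
have := is_deriveD (is_deriveZ (2%:R^-1 * x) d4) (is_derive_cst (- y) t 1).
move=> h; apply: is_derive_eq h _.
rewrite addr0 /GRing.scale /=.
by field; rewrite pn0.
Qed.

Lemma volume_degenerates : degenerates_at sol T0.
Proof.
move=> i u iu V.
have -> : (fun t => g2vol (sol t) i u V : R^o) = (fun t : R =>
   eps * p t ^+ 3 * (eta ∧ ccy_volD C) i u V) by [].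
move: ((eta ∧ ccy_volD C) i u V) => x.
have pc := p_cvg0 eps_gt0.
have p3 : p t ^+ 3 @[t --> T0^'+] --> (0 : R).
  have -> : (fun t => p t ^+ 3) = (fun t => p t * p t * p t).
    by apply/funext => t; rewrite !exprS expr0 mulr1 mulrA.
  have := cvgM (cvgM pc pc) pc; rewrite !mulr0; exact.
rewrite -[0 i u V]/(0 : R) -[X in _ --> X](mul0r x) -[X in X * x](mulr0 eps).
apply: cvgMl; apply: cvgMr.
exact: p3.
Qed.

Lemma eta_wedge_horizontal i u (V : 'M[R]_(4, 7)) :
  (forall a, eta i u (row a V) = 0) -> (eta ∧ im) i u V = 0.
Proof.
move=> V0; rewrite /fwedge /wedge_form big1 ?mulr0// => s _; rewrite /tprod.
rewrite [usubmx _](_ : _ = row (s (lshift 3 0)) V) ?V0 ?mul0r ?mulr0//.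
by apply/rowP => j; rewrite !mxE.
Qed.

(* g and vol are the metric and the volume form of the frame of P up to constant
   factors, which is enough here. *)
Lemma g2_psi_hyperplane (P : 'M[R]_(3, 7) -> R) g vol (al : 'rV[R]_7 -> R)
    (a : 'rV[R]_7) :
  g2_form P -> g2_metric P g vol -> al != 0 ->
  al =1 (fun X => (X *m a^T) 0 0) ->
  exists2 V : 'M[R]_(4, 7), (forall b, al (row b V) = 0) &
    hodge_star (erefl : (3 + 4 = 7)%N) g vol P V != 0.
Proof.
move=> [A uA PE] [gI _ gP] al0 alE.
have PE' : P =1 pull A (ev i_phi) by move=> V; rewrite PE g2_modelE.
(* Both pairs satisfy the defining identity for P, so their products agree and each factor is fixed
   up to a constant: g is c times the product of the frame and vol is the determinant over c, with c
   = g(E, E). *)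
have key X Y V : bilin g X Y * vol V = (X *m A *m (Y *m A)^T) 0 0 * \det (V *m A).
  have := gP X Y V; rewrite (bilin_frameE _ _ _ PE') -!mulrA.
  by apply: mulfI; rewrite pnatr_eq0.
pose E : 'rV[R]_7 := delta_mx 0 0 *m invmx A.
have EE : (E *m A *m (E *m A)^T) 0 0 = 1.
  rewrite /E mulmxKV// mxE (bigD1 0)//= big1 ?addr0; first by rewrite !mxE !eqxx mulr1.
  by move=> j /negbTE j0; rewrite !mxE j0 andbF mul0r.
have E0 : E != 0.
  by apply: contra_eq_neq EE => ->; rewrite !mul0mx mxE eq_sym oner_eq0.
have g0 : 0 < bilin g E E by case: gI => _ _; apply.
set c := bilin g E E in g0.
have cn0 : c != 0 by rewrite gt_eqF.
have volE V : vol V = c^-1 * \det (V *m A).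
  by have := key E E V; rewrite EE mul1r => <-; rewrite mulKf.
have gE X Y : bilin g X Y = c * (X *m A *m (Y *m A)^T) 0 0.
  have := key X Y (invmx A); rewrite volE mulVmx// det1 !mulr1 => <-.
  by rewrite mulrCA mulfV ?mulr1.
pose r := Num.sqrt c.
have rr : r ^+ 2 = c by rewrite sqr_sqrtr// ltW.
have rn0 : r != 0 by rewrite sqrtr_eq0 -ltNge.
(* Rescaling by r = sqrt c makes the coframe orthonormal for g, so the star is computed by
   [star_frame] up to nonzero factors. *)
pose B := A *m scale_mx r r.
have uB : B \in unitmx by rewrite unitmx_mul uA scale_mx_unit.
have gB X Y : bilin g X Y = (X *m B *m (Y *m B)^T) 0 0.
  by rewrite gE !mulmxA mul_scale_mx rr; ring.
have volB V : vol V = c^-1 * r ^- 7 * \det (V *m B).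
  rewrite volE mulmxA [\det (_ *m scale_mx _ _)]det_mulmx det_scale_mx.
  by move: (\det _) => x; field; rewrite rn0 cn0.
have PB : P =1 (fun W => r ^- 3 * pull B (ev i_phi) W).
  have hph : @ev R 6 3 i_phi =1 (fun W => ev (iwedge i_eta i_om) W + ev i_re W).
    by move=> W; rewrite ev_cat.
  move=> W; rewrite PE' /pull !hph mulmxA.
  rewrite (@ev_scale _ _ _ 1 2)// (@ev_scale _ _ _ 0 3)//.
  by move: (ev _ _) (ev _ _) => x y; field.
have aB : (invmx B *m a^T)^T != 0.
  apply: contra_neq al0 => /(congr1 trmx); rewrite trmxK trmx0 => aB0.
  apply/funext => X; rewrite alE -(mulmxK uB X) -[_ *m a^T]mulmxA aB0 mulmx0 mxE.
  by [].
have [W W0 Wn0] := psi_hyperplane aB.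
exists (W *m invmx B) => [b|].
  rewrite alE -row_mul -mulmxA; move: W0; rewrite trmxK => ->.
  by rewrite !mxE.
rewrite (eq_hodge_star _ _ _ PB) hodge_starZ.
rewrite (hodge_star_volZ _ _ (vol' := fun V => \det (V *m B)) _ _ volB).
rewrite (star_frame _ _ uB gB (fun=> erefl) (fun=> erefl) i_star_phi) mulmxKV//.
by rewrite !mulf_neq0// ?invr_neq0// ?expf_neq0.
Qed.

Lemma not_continues : ~ continues_to sol T0.
Proof.
move=> [D [_ D1 D2 D3] DL]; have [x _] := mfd_nonempty M.
have [i xi] := chart_dom_cover x; pose u := chart i x.
have iu : chart_img i u by exists x.
have [A fA] := exists_su3_frame C iu; have [uA _ eE _ _] := fA.
have pc := p_cvg0 eps_gt0.
case: DL => [phiL|psiL].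
(* The frame vectors dual to e0, e1, e2, on which eta /\ omega is 1. If phi_t(V) had a limit, p
   phi_t(V) would tend to 0; but it equals eps + p^4 Re Upsilon(V), which tends to eps. *)
- pose V : 'M[R]_(3, 7) := triple (delta_mx 0 0) (delta_mx 0 1) (delta_mx 0 2) *m invmx A.
  have V1 : (eta ∧ omega) i u V = 1.
    rewrite (eta_omega_frame fA) /pull mulmxKV// /ev /iwedge /=.
    rewrite !big_cons big_nil /= !ecov3 !mxE /= -!val_eqE /= !inordK//= /det3.
    by ring.
  have L := phiL i u iu V.
  have pL : (p t * (eps * (p t)^-1 + p t ^+ 3 * re i u V)) @[t --> T0^'+] --> (0 : R).
    rewrite -[X in _ --> X](mul0r (g2phi D i u V)); apply: cvgM => //.
    have -> : (fun t => eps * (p t)^-1 + p t ^+ 3 * re i u V) = (fun t => g2phi (sol t) i u V).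
      by apply/funext => t; rewrite -[LHS]/(eps * (p t)^-1 + _) -[eps * _]mulr1 -V1.
    exact: L.
  have eL : (p t * (eps * (p t)^-1 + p t ^+ 3 * re i u V)) @[t --> T0^'+] --> eps.
    have e4 : (eps + p t * p t * p t * p t * re i u V) @[t --> T0^'+] --> eps.
      rewrite -[X in _ --> X]addr0; apply: cvgD; first exact: cvg_cst.
      rewrite -[X in _ --> X](mul0r (re i u V)); apply: cvgMl.
      have := cvgM (cvgM (cvgM pc pc) pc) pc; rewrite !mulr0; exact.
    apply: cvg_trans e4; apply: near_eq_cvg; near=> t.
    have pt0 : p t != 0.
      by rewrite gt_eqF//; apply: p_gt0 => //; near: t; exact: nbhs_right_gt.
    by field.
  have := cvg_unique _ pL eL; move=> /(_ (@Rhausdorff R)) e0.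
  by move: eps_gt0; rewrite -e0 ltxx.
- pose a : 'rV[R]_7 := delta_mx 0 0 *m A^T.
  have etaa X : eta i u X = (X *m a^T) 0 0.
    rewrite eE /pull ecov1_row /a trmx_mul trmxK trmx_delta mulmxA.
    by rewrite -colE [RHS]mxE.
  have eta0 : eta i u != 0.
    apply/eqP => h; have := congr1 (fun f => f (delta_mx 0 0 *m invmx A)) h.
    rewrite eE /pull mulmxKV// ecov1_row mxE !eqxx => /eqP.
    by rewrite oner_eq0.
  (* A 4-tuple in ker eta on which the 4-form of the supposed limit is nonzero, whereas psi_t there
     is p^4 / 2 times omega /\ omega and tends to 0. *)
  have [V V0 Vn] := g2_psi_hyperplane (D1 i u iu) (D2 i u iu) eta0 etaa.
  move/eqP: Vn; apply; rewrite -[hodge_star _ _ _ _ _](D3 i u iu).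
  have L := psiL i u iu V.
  have L0 : (g2psi (sol t) i u V : R^o) @[t --> T0^'+] --> (0 : R^o).
    have -> : (fun t => g2psi (sol t) i u V : R^o) = (fun t : R =>
       p t * p t * p t * p t * (2%:R^-1 * (omega ∧ omega) i u V)).
      apply/funext => t; have -> : g2psi (sol t) i u V = 2%:R^-1 * p t ^+ 4 *
         (omega ∧ omega) i u V - eps * (eta ∧ im) i u V by [].
      by rewrite eta_wedge_horizontal//; move: (fwedge _ _ _ _ _) => y; ring.
    move: (_ * fwedge _ _ _ _ _) => y.
    rewrite -[X in _ --> X](mul0r y); apply: cvgMl.
    have := cvgM (cvgM (cvgM pc pc) pc) pc; rewrite !mulr0; exact.
  by have := cvg_unique _ L L0; apply; exact: Rhausdorff.
Unshelve. all: by end_near. Qed.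

End Singularity.

Local Open Scope form_scope.

Theorem theorem1 (R : realType) (M : manifold R 7) (C : contactCY M)
    (eps : R) (eps_gt0 : 0 < eps) :
  let sol := ccy_family C eps in
  let T := - (10%:R * eps ^+ 2)^-1 in
  [/\ (forall t, T < t -> g2_structure (sol t) /\ coclosed (sol t)),
      laplacian_coflow [set t | T < t] sol,
      g2phi (sol 0) ≡ ccy_phi0 C eps /\ g2psi (sol 0) ≡ ccy_psi0 C eps,
      (T < 0 /\ [set t | 0 <= t] `<=` [set t | T < t]) &
      backward_singularity sol T].
Proof.
move=> sol T.
have T_lt0 : T < 0 by rewrite oppr_lt0 invr_gt0 mulr_gt0// exprn_gt0.
split.
- move=> t tT; split; [exact: flow_g2_structure|exact: flow_coclosed].
- split; first by move=> t; exact: flow_g2_structure.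
    move=> s t sT tT i u iu V.
    (* Both volume forms are positive multiples of the same 7-form, so the product is a positive
       multiple of a square. *)
    have -> : g2vol (sol s) i u V * g2vol (sol t) i u V =
      (eps * ccy_p eps s ^+ 3) * (eps * ccy_p eps t ^+ 3) *
      (fwedge (ccy_eta C) (ccy_volD C) i u V * fwedge (ccy_eta C) (ccy_volD C) i u V).
      by rewrite mulrACA.
    rewrite mulr_ge0 -?expr2 ?sqr_ge0// mulr_ge0// mulr_ge0 ?exprn_ge0 ?ltW ?p_gt0//.
  by move=> t tT i u iu V; exact: psi_is_derive.
- split=> i u iu V.
    by rewrite /sol /ccy_family /ccy_phi0 p0 !expr1n invr1 mulr1 scale1r.
  by rewrite /sol /ccy_family /ccy_psi0 p0 !expr1n /= mulr1.
- by split=> // t /= t0; exact: lt_le_trans t0.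
- by split; [exact: volume_degenerates|exact: not_continues].
Qed.
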